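(* Let $\mathbb{K}$ be a field, let $q\in\mathbb{K}^*$ be not a root of unity, and for $(\alpha,\beta)\in\mathbb{K}^2\setminus\{(0,0)\}$ let $A_{\alpha,\beta}=U_q^+(G_2)/\langle\Omega_1-\alpha,\Omega_2-\beta\rangle$, with generators $e_1,\dots,e_6$ as in the context. Let $\theta$ be the $\mathbb{K}$-derivation of $A_{\alpha,0}$ ($\alpha\neq0$) with $$\theta(e_1)=-e_1,\ \theta(e_2)=-e_2,\ \theta(e_3)=0,\ \theta(e_4)=e_4,\ \theta(e_5)=e_5,\ \theta(e_6)=2e_6,$$ and let $\tilde\theta$ be the $\mathbb{K}$-derivation of $A_{0,\beta}$ ($\beta\neq0$) with $$\tilde\theta(e_1)=-2e_1,\ \tilde\theta(e_2)=-3e_2,\ \tilde\theta(e_3)=-e_3,\ \tilde\theta(e_4)=0,\ \tilde\theta(e_5)=e_5,\ \tilde\theta(e_6)=3e_6.$$ Then: 1. If $\alpha,\beta\neq 0$, then every derivation $D$ of $A_{\alpha,\beta}$ can uniquely be written as $D=\mathrm{ad}_x$, where $x\in A_{\alpha,\beta}$. 2. If $\alpha\neq0$ and $\beta=0$, then every derivation $D$ of $A_{\alpha,0}$ can uniquely be written as $D=\mathrm{ad}_x+\lambda\theta$, where $\lambda\in\mathbb{K}$ and $x\in A_{\alpha,0}$. 3. If $\alpha=0$ and $\beta\neq0$, then every derivation $D$ of $A_{0,\beta}$ can uniquely be written as $D=\mathrm{ad}_x+\lambda\tilde\theta$, where $\lambda\in\mathbb{K}$ and $x\in A_{0,\beta}$.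 4. $HH^1(A_{\alpha,0})=\mathbb{K}[\theta]$ (for $\alpha\neq0$) and $HH^1(A_{0,\beta})=\mathbb{K}[\tilde\theta]$ (for $\beta\neq0$), where $[\theta]$ and $[\tilde\theta]$ respectively denote the classes of $\theta$ and $\tilde\theta$ modulo the space of inner derivations. 5. If $\alpha,\beta\neq0$, then $HH^1(A_{\alpha,\beta})=\{[0]\}$, where $[0]$ denotes the class of $0$ modulo the space of inner derivations.
   Context: $A=U_q^+(G_2)$ is the $\mathbb{K}$-algebra generated by $E_1,\dots,E_6$ with defining relations \begin{align*} &E_2E_1=q^{-3}E_1E_2,\quad E_3E_1=q^{-1}E_1E_3-(q+q^{-1}+q^{-3})E_2,\quad E_3E_2=q^{-3}E_2E_3,\\ &E_4E_1=E_1E_4+(1-q^2)E_3^2,\quad E_4E_2=q^{-3}E_2E_4-\tfrac{q^4-2q^2+1}{q^4+q^2+1}E_3^3,\quad E_4E_3=q^{-3}E_3E_4,\\ &E_5E_1=qE_1E_5-(1+q^2)E_3,\quad E_5E_2=E_2E_5+(1-q^2)E_3^2,\\ &E_5E_3=q^{-1}E_3E_5-(q+q^{-1}+q^{-3})E_4,\quad E_5E_4=q^{-3}E_4E_5,\\ &E_6E_1=q^3E_1E_6-q^3E_5,\quad E_6E_2=q^3E_2E_6+(q^4+q^2-1)E_4+(q^2-q^4)E_3E_5,\\ &E_6E_3=E_3E_6+(1-q^2)E_5^2,\quad E_6E_4=q^{-3}E_4E_6-\tfrac{q^4-2q^2+1}{q^4+q^2+1}E_5^3,\quad E_6E_5=q^{-3}E_5E_6.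 \end{align*} It is a noetherian domain and the monomials $E_1^{k_1}\cdots E_6^{k_6}$ ($k_i\in\mathbb{N}$) form a $\mathbb{K}$-basis. Define the central elements \begin{align*} \Omega_1&=E_1E_3E_5+aE_1E_4+aE_2E_5+a'E_3^2,\\ \Omega_2&=E_2E_4E_6+bE_2E_5^3+bE_3^3E_6+b'E_3^2E_5^2+c'E_3E_4E_5+d'E_4^2, \end{align*} where $a=\frac{q^2+1+q^{-2}}{q^{-2}-1}$, $a'=\frac{q^6}{q^2-1}$, $b=-\frac{q^7-2q^5+q^3}{(q^4+q^2+1)(1-q^{-6})}$, $b'=\frac{q^{13}-q^{11}}{(q^4+q^2+1)^2}$, $c'=-\frac{q^9}{q^4+q^2+1}$, $d'=\frac{q^{12}}{q^6-1}$. $\langle\cdot\rangle$ denotes the two-sided ideal generated. $e_i$ denotes the image of $E_i$ in $A_{\alpha,\beta}$. Derivations are $\mathbb{K}$-derivations. For $x$ in an algebra, $\mathrm{ad}_x(y)=xy-yx$. $HH^1(B)$ is the first Hochschild cohomology group, i.e. the space of $\mathbb{K}$-derivations of $B$ modulo the space of inner derivations.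
   Formalization: The field K is assumed to have characteristic different from 2 (in characteristic 2 extra non-inner derivations exist and all five claims fail), and ''uniquely'' means that λ is unique and x is unique up to adding a scalar, since ad_{x+c} = ad_x for c in K. *)

(* Defs.v *)
(* Classical logic (mathcomp.classical) turns Prop-valued
   ideals and subspaces into MathComp predicates, and gives extensionality of
   derivations. *)
From HB Require Import structures.
From mathcomp Require Import all_boot all_order all_algebra.
From mathcomp Require Import finmap monalg.
From mathcomp Require Import boolp functions.
From mathcomp Require Import ring.

Set Implicit Arguments.
Unset Strict Implicit.
Unset Printing Implicit Defensive.

Import GRing.Theory.
Local Open Scope ring_scope.
Local Open Scope quotient_scope.

Section QuotientModule.
Variables (K : pzRingType) (V : lmodType K) (W : submodClosed V).

Definition submod_pred : {pred V} := W.

Lemma submod_pred_zmod_closed : zmod_closed submod_pred.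
Proof.
split=> [|x y Wx Wy]; first exact: (rpred0 W).
by rewrite -scaleN1r; apply: (@rpredD _ W) => //; exact: rpredZ.
Qed.

HB.instance Definition _ :=
  GRing.isZmodClosed.Build V submod_pred submod_pred_zmod_closed.

Definition mod_quot := Quotient.quot submod_pred.
HB.instance Definition _ := GRing.Zmodule.on mod_quot.

Definition mod_class (v : V) : mod_quot := \pi v.

Lemma mod_class_surj (c : mod_quot) : exists v, c = mod_class v.
Proof. by exists (repr c); rewrite /mod_class reprK. Qed.

Lemma mod_class_eq u v : (mod_class u == mod_class v) = (u - v \in W).
Proof. by rewrite -[RHS]/(u - v \in submod_pred) Quotient.idealrBE. Qed.

Lemma mod_class_eqP u v : reflect (mod_class u = mod_class v) (u - v \in W).
Proof. by rewrite -mod_class_eq; apply: eqP. Qed.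

Lemma mod_classD u v : mod_class (u + v) = mod_class u + mod_class v.
Proof. exact: (raddfD \pi_(Quotient.quot submod_pred)). Qed.

End QuotientModule.

(* The operations are sealed: unfolding them makes unification diverge. *)
HB.lock Definition mod_scale (K : pzRingType) (V : lmodType K)
    (W : submodClosed V) (k : K) (c : mod_quot W) : mod_quot W :=
  mod_class W (k *: repr c).

Section QuotientScale.
Variables (K : pzRingType) (V : lmodType K) (W : submodClosed V).
Local Notation mod_quot := (mod_quot W).
Local Notation mod_class := (mod_class W).
Local Notation mod_scale := (@mod_scale K V W).

Lemma mod_classZ k v : mod_class (k *: v) = mod_scale k (mod_class v).
Proof.
rewrite unlock; apply/mod_class_eqP; rewrite -scalerBr rpredZ //.
by apply/mod_class_eqP; rewrite /mod_class reprK.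
Qed.

Lemma mod_scaleA a b c : mod_scale a (mod_scale b c) = mod_scale (a * b) c.
Proof.
by have [v ->] := mod_class_surj c; rewrite -!mod_classZ scalerA.
Qed.

Lemma mod_scale1 : left_id 1 mod_scale.
Proof. by move=> c; have [v ->] := mod_class_surj c; rewrite -mod_classZ scale1r. Qed.

Lemma mod_scaleDr : right_distributive mod_scale +%R.
Proof.
move=> k c d; have [u ->] := mod_class_surj c; have [v ->] := mod_class_surj d.
by rewrite -mod_classD -!mod_classZ -mod_classD scalerDr.
Qed.

Lemma mod_scaleDl c : {morph mod_scale^~ c : a b / a + b}.
Proof.
move=> a b; have [v ->] := mod_class_surj c.
by rewrite -!mod_classZ -mod_classD scalerDl.
Qed.

HB.instance Definition _ := GRing.Zmodule_isLmodule.Build K mod_quot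
  mod_scaleA mod_scale1 mod_scaleDr mod_scaleDl.

Lemma mod_class_linear : linear mod_class.
Proof. by move=> k u v; rewrite mod_classD mod_classZ. Qed.

HB.instance Definition _ :=
  GRing.isLinear.Build K V mod_quot *:%R mod_class mod_class_linear.

End QuotientScale.

Section GeneratedIdeal.
Variables (K : pzRingType) (B : algType K) (S : B -> Prop).

Inductive ideal_gen : B -> Prop :=
| ideal_gen0 : ideal_gen 0
| ideal_genD a s b x : S s -> ideal_gen x -> ideal_gen (a * s * b + x).

Definition ideal : {pred B} := fun x => `[< ideal_gen x >].

Lemma ideal_genDD x y : ideal_gen x -> ideal_gen y -> ideal_gen (x + y).
Proof.
elim=> [|a s b z Ss _ IH] gy; first by rewrite add0r.
by rewrite -addrA; apply: ideal_genD => //; apply: IH.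
Qed.

Lemma ideal_genZ k x : ideal_gen x -> ideal_gen (k *: x).
Proof.
elim=> [|a s b z Ss _ IH]; first by rewrite scaler0; apply: ideal_gen0.
by rewrite scalerDr !scalerAl; apply: ideal_genD.
Qed.

Lemma ideal_genM c x d : ideal_gen x -> ideal_gen (c * x * d).
Proof.
elim=> [|a s b z Ss _ IH]; first by rewrite mulr0 mul0r; apply: ideal_gen0.
rewrite mulrDr mulrDl.
have -> : c * (a * s * b) * d = c * a * s * (b * d) by rewrite !mulrA.
exact: ideal_genD.
Qed.

Lemma ideal_submod : subsemimod_closed ideal.
Proof.
split; first split.
- by apply/asboolP; apply: ideal_gen0.
- by move=> x y /asboolP gx /asboolP gy; apply/asboolP; apply: ideal_genDD.
- by move=> k x /asboolP gx; apply/asboolP; apply: ideal_genZ.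
Qed.

HB.instance Definition _ := GRing.isSubmodClosed.Build K B ideal ideal_submod.

Lemma idealM c x d : x \in ideal -> c * x * d \in ideal.
Proof. by move=> /asboolP gx; apply/asboolP; apply: ideal_genM. Qed.

Lemma mem_ideal s : S s -> s \in ideal.
Proof.
move=> Ss; apply/asboolP.
by rewrite -[s]addr0 -[s]mul1r -[_ * s]mulr1; apply: ideal_genD Ss ideal_gen0.
Qed.

Definition alg_quot := mod_quot ideal.
HB.instance Definition _ := GRing.Lmodule.on alg_quot.

Definition alg_class : B -> alg_quot := @mod_class K B ideal.
HB.instance Definition _ := GRing.Linear.on alg_class.


Lemma alg_class_surj (c : alg_quot) : exists x, c = alg_class x.
Proof. exact: mod_class_surj. Qed.

Lemma alg_class_eqP x y : reflect (alg_class x = alg_class y) (x - y \in ideal).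
Proof. exact: mod_class_eqP. Qed.

End GeneratedIdeal.

HB.lock Definition alg_mul (K : pzRingType) (B : algType K) (S : B -> Prop)
    (x y : alg_quot S) : alg_quot S := alg_class S (repr x * repr y).

Section QuotientAlgebra.
Variables (K : pzRingType) (B : algType K) (S : B -> Prop).
Local Notation ideal := (ideal S).
Local Notation alg_quot := (alg_quot S).
Local Notation alg_class := (alg_class S).
Local Notation alg_mul := (@alg_mul K B S).

Lemma alg_classM x y : alg_class (x * y) = alg_mul (alg_class x) (alg_class y).
Proof.
have repr_class z : z - repr (alg_class z) \in ideal.
  by apply/alg_class_eqP; rewrite {2}/alg_class /mod_class reprK.
rewrite unlock; apply/alg_class_eqP; set x' := repr _; set y' := repr _.
have -> : x * y - x' * y' = 1 * (x - x') * y + x' * (y - y') * 1.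
  by rewrite mul1r mulr1 mulrBl mulrBr addrA subrK.
by rewrite rpredD ?idealM.
Qed.

Lemma alg_mulA : associative alg_mul.
Proof.
move=> a b c; have [x ->] := alg_class_surj a; have [y ->] := alg_class_surj b.
by have [z ->] := alg_class_surj c; rewrite -!alg_classM mulrA.
Qed.

Lemma alg_mul1 : left_id (alg_class 1) alg_mul.
Proof. by move=> a; have [x ->] := alg_class_surj a; rewrite -alg_classM mul1r. Qed.

Lemma alg_1mul : right_id (alg_class 1) alg_mul.
Proof. by move=> a; have [x ->] := alg_class_surj a; rewrite -alg_classM mulr1. Qed.

Lemma alg_mulDl : left_distributive alg_mul +%R.
Proof.
move=> a b c; have [x ->] := alg_class_surj a; have [y ->] := alg_class_surj b.
have [z ->] := alg_class_surj c.
by rewrite -linearD -!alg_classM mulrDl linearD.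
Qed.

Lemma alg_mulDr : right_distributive alg_mul +%R.
Proof.
move=> a b c; have [x ->] := alg_class_surj a; have [y ->] := alg_class_surj b.
have [z ->] := alg_class_surj c.
by rewrite -linearD -!alg_classM mulrDr linearD.
Qed.

HB.instance Definition _ := GRing.Zmodule_isPzRing.Build alg_quot
  alg_mulA alg_mul1 alg_1mul alg_mulDl alg_mulDr.

Lemma alg_class1 : alg_class 1 = 1.
Proof. by []. Qed.

Lemma alg_classMr x y : alg_class (x * y) = alg_class x * alg_class y.
Proof. exact: alg_classM. Qed.

Lemma alg_classZ (k : K) x : alg_class (k *: x) = k *: alg_class x.
Proof. exact: linearZ. Qed.

Lemma alg_scaleAl (k : K) (a b : alg_quot) : k *: (a * b) = (k *: a) * b.
Proof.
have [x ->] := alg_class_surj a; have [y ->] := alg_class_surj b.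
by rewrite -alg_classZ -!alg_classMr -alg_classZ scalerAl.
Qed.

Lemma alg_scaleAr (k : K) (a b : alg_quot) : k *: (a * b) = a * (k *: b).
Proof.
have [x ->] := alg_class_surj a; have [y ->] := alg_class_surj b.
by rewrite -alg_classZ -!alg_classMr -alg_classZ scalerAr.
Qed.

End QuotientAlgebra.

(* Derivations and HH^1 of a K-algebra presented as B / <S>.  Such an algebra
   may a priori be zero, so it carries a pzRingType and an lmodType structure
   but no algType structure. *)
Section Derivations.
Variables (K : fieldType) (B : algType K) (S : B -> Prop).
Local Notation A := (alg_quot S).

Definition is_derivation (D : A -> A) : Prop :=
  linear D /\ forall x y, D (x * y) = D x * y + x * D y.

Definition derivation_pred : {pred A -> A} := fun D => `[< is_derivation D >].

Lemma derivation_submod : subsemimod_closed derivation_pred.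
Proof.
split; first split.
- apply/asboolP; split=> [k x y|x y]; rewrite /GRing.zero /=.
    by rewrite scaler0 addr0.
  by rewrite mulr0 mul0r addr0.
- move=> D E /asboolP[Dl DM] /asboolP[El EM]; apply/asboolP.
  split=> [k x y|x y]; rewrite !addrfctE.
    by rewrite Dl El scalerDr addrACA.
  by rewrite DM EM mulrDl mulrDr addrACA.
- move=> k D /asboolP[Dl DM]; apply/asboolP.
  split=> [c x y|x y]; rewrite !scalrfctE.
    by rewrite Dl scalerDr !scalerA mulrC.
  by rewrite DM scalerDr alg_scaleAl alg_scaleAr.
Qed.

HB.instance Definition _ :=
  GRing.isSubmodClosed.Build K (A -> A) derivation_pred derivation_submod.
HB.instance Definition _ := GRing.isZmodClosed.Build (A -> A) derivation_pred
  (submod_pred_zmod_closed derivation_pred).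

Record derivation := Derivation {
  derivation_fun :> A -> A;
  _ : derivation_fun \in derivation_pred
}.

HB.instance Definition _ := [isSub for derivation_fun].
HB.instance Definition _ := [Choice of derivation by <:].
HB.instance Definition _ := [SubChoice_isSubLmodule of derivation by <:].

Lemma derivationP (D : derivation) : is_derivation D.
Proof. by apply/asboolP; exact: (valP D). Qed.

Lemma derivation_ext (D E : derivation) : D =1 E -> D = E.
Proof. by move=> DE; apply: val_inj; apply: funext. Qed.

Lemma derivationDE (D E : derivation) x : (D + E) x = D x + E x.
Proof. by []. Qed.

Lemma derivationZE (k : K) (D : derivation) x : (k *: D) x = k *: D x.
Proof. by []. Qed.

Lemma ad_subproof (x : A) : (fun y => x * y - y * x) \in derivation_pred.
Proof.
apply/asboolP; split=> [k y z|y z] /=.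
  rewrite mulrDl mulrDr -alg_scaleAl -alg_scaleAr scalerBr opprD.
  by rewrite addrACA.
by rewrite mulrBl mulrBr !mulrA addrA subrK.
Qed.

Definition ad (x : A) : derivation := Derivation (ad_subproof x).

Lemma adE x y : ad x y = x * y - y * x.
Proof. by []. Qed.

Definition inner : {pred derivation} := fun D => `[< exists x, D = ad x >].

Lemma inner_submod : subsemimod_closed inner.
Proof.
split; first split.
- apply/asboolP; exists 0; apply: derivation_ext => y.
  by rewrite adE mul0r mulr0 subr0.
- move=> _ _ /asboolP[x ->] /asboolP[y ->]; apply/asboolP; exists (x + y).
  apply: derivation_ext => z.
  by rewrite derivationDE !adE mulrDl mulrDr opprD addrACA.
- move=> k _ /asboolP[x ->]; apply/asboolP; exists (k *: x).
  apply: derivation_ext => z.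
  by rewrite derivationZE !adE scalerBr alg_scaleAl alg_scaleAr.
Qed.

HB.instance Definition _ :=
  GRing.isSubmodClosed.Build K derivation inner inner_submod.

Definition HH1 : lmodType K := mod_quot inner.
Definition HH1_class : derivation -> HH1 := @mod_class K derivation inner.

(* A derivation of B that maps S into <S> induces a derivation of B / <S>. *)
Lemma induced_derivation (d : B -> B) :
    linear d -> (forall x y, d (x * y) = d x * y + x * d y) ->
    (forall s, S s -> d s \in ideal S) ->
  exists D : derivation, forall x, D (alg_class S x) = alg_class S (d x).
Proof.
move=> dl dM dS.
have d0 : d 0 = 0.
  by have := dM 0 0; rewrite !mulr0 mul0r addr0.
have dD x y : d (x + y) = d x + d y by have := dl 1 x y; rewrite !scale1r.
have dI x : x \in ideal S -> d x \in ideal S.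
  move=> /asboolP; elim=> [|a s b z Ss gz IH]; first by rewrite d0 rpred0.
  have Is : s \in ideal S by apply: mem_ideal.
  by rewrite dD rpredD // !dM mulrDl !rpredD ?idealM ?dS.
pose D (c : A) : A := alg_class S (d (repr c)).
have DE x : D (alg_class S x) = alg_class S (d x).
  apply/alg_class_eqP.
  have -> : d (repr (alg_class S x)) - d x = d (repr (alg_class S x) - x).
    by rewrite -scaleN1r addrC -dl scaleN1r addrC.
  by apply: dI; apply/alg_class_eqP; rewrite /alg_class /mod_class reprK.
have DD : D \in derivation_pred.
  apply/asboolP; split=> [k c e|c e].
    have [x ->] := alg_class_surj c; have [y ->] := alg_class_surj e.
    by rewrite -alg_classZ -linearD !DE dl linearD linearZ.
  have [x ->] := alg_class_surj c; have [y ->] := alg_class_surj e.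
  by rewrite -alg_classMr !DE dM linearD /= !alg_classMr.
by exists (Derivation DD).
Qed.

End Derivations.

Section FreeMonoidAlgebra.
Variables (K : comNzRingType) (I : choiceType).
Implicit Types x y : {malg K[{fmonom I}]}.

Lemma fmalg_scaleAr (k : K) x y : k *: (x * y) = x * (k *: y).
Proof.
apply/malgP => m; rewrite [LHS](mcoeffZ k (x * y) m).
rewrite [RHS](mcoeffMlw m (fsubset_refl (msupp x)) (msuppZ_le k y)).
rewrite [X in k * X]mcoeffMl.
rewrite mulr_sumr; apply: eq_bigr => m1 _.
rewrite mulr_sumr; apply: eq_bigr => m2 _.
by rewrite mcoeffZ mulrnAr mulrCA.
Qed.

Variable w : I -> K.

Definition fmonom_weight (m : {fmonom I}) : K := \sum_(i <- m) w i.
Local Notation W := fmonom_weight.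

Definition fmalg_der x : {malg K[{fmonom I}]} :=
  \sum_(m <- msupp x) << W m * x@_m *g m >>.
Local Notation d := fmalg_der.

Lemma fmalg_derE x m : (d x)@_m = W m * x@_m.
Proof.
rewrite [X in W m * X@_m]monalgE [RHS]/= /fmalg_der.
rewrite [LHS](raddf_sum (mcoeff m)) [X in _ * X](raddf_sum (mcoeff m)) mulr_sumr.
apply: eq_bigr => m1 _ /=; rewrite [LHS]mcoeffU [X in _ = _ * X]mcoeffU.
by case: eqP => [->|]; rewrite ?mulr0.
Qed.

Lemma fmalg_der_supp x : (msupp (d x) `<=` msupp x)%fset.
Proof.
apply/fsubsetP => m; rewrite -!mcoeff_neq0 fmalg_derE.
by apply: contraNneq => ->; rewrite mulr0.
Qed.

Lemma fmalg_der_linear k x y : d (k *: x + y) = k *: d x + d y.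
Proof.
apply/malgP => m; rewrite fmalg_derE.
rewrite [X in _ * X](mcoeffD m (k *: x) y) [RHS](mcoeffD m (k *: d x) (d y)).
rewrite mulrDr; congr (_ + _); last by rewrite fmalg_derE.
rewrite [RHS](mcoeffZ k (d x) m) [X in _ * X](mcoeffZ k x m) fmalg_derE.
by rewrite mulrCA.
Qed.

Lemma fmalg_derM x y : d (x * y) = d x * y + x * d y.
Proof.
apply/malgP => m; rewrite fmalg_derE [RHS](mcoeffD m (d x * y) (x * d y)).
rewrite [X in X + _](mcoeffMlw m (fmalg_der_supp x) (fsubset_refl (msupp y))).
rewrite [X in _ + X](mcoeffMlw m (fsubset_refl (msupp x)) (fmalg_der_supp y)).
rewrite [X in _ * X](mcoeffMl x y m).
rewrite -big_split mulr_sumr; apply: eq_bigr => m1 _ /=.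
rewrite -big_split mulr_sumr; apply: eq_bigr => m2 _ /=.
rewrite !fmalg_derE; case: eqP => [<-|_]; last by rewrite mulr0 addr0.
rewrite !mulr1n /fmonom_weight fmM big_cat /= mulrDl mulrA.
by rewrite [x@_m1 * (_ * _)]mulrCA.
Qed.

Lemma fmalg_der_gen i : d << fmu i >> = w i *: << fmu i >>.
Proof.
apply/malgP => m; rewrite [LHS]fmalg_derE [RHS](mcoeffZ (w i) << fmu i >> m).
rewrite [X in _ * X]mcoeffU1 [X in _ = _ * X]mcoeffU1.
by case: eqP => [<-|_]; rewrite ?mulr0 // /fmonom_weight fmU big_seq1.
Qed.

Lemma fmalg_coef1M x y :
  (x * y)@_(@mone {fmonom I}) = x@_(@mone {fmonom I}) * y@_(@mone {fmonom I}).
Proof. exact: (mcoeff1g_is_multiplicative _ _).1. Qed.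

End FreeMonoidAlgebra.

Section FreeAlgebra.
Variables (K : comNzRingType) (I : choiceType).

Definition free_alg := {malg K[{fmonom I}]}.
HB.instance Definition _ := GRing.Lalgebra.on free_alg.
HB.instance Definition _ :=
  GRing.Lalgebra_isAlgebra.Build K free_alg (@fmalg_scaleAr K I).

Definition free_gen (i : I) : free_alg := << fmu i >>.

Definition free_aug (x : free_alg) : K := mcoeff (@mone {fmonom I}) x.

Lemma free_augD (x y : free_alg) : free_aug (x + y) = free_aug x + free_aug y.
Proof. exact: mcoeffD. Qed.

Lemma free_augN (x : free_alg) : free_aug (- x) = - free_aug x.
Proof. exact: mcoeffN. Qed.

Lemma free_augZ k (x : free_alg) : free_aug (k *: x) = k * free_aug x.
Proof. exact: mcoeffZ. Qed.

Lemma free_augM (x y : free_alg) : free_aug (x * y) = free_aug x * free_aug y.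
Proof. exact: fmalg_coef1M. Qed.

Lemma free_aug0 : free_aug 0 = 0.
Proof. exact: mcoeff0. Qed.

Lemma free_aug1 : free_aug 1 = 1.
Proof. exact: (mcoeffUU (@mone {fmonom I})). Qed.

Lemma free_aug_gen i : free_aug (free_gen i) = 0.
Proof. by rewrite /free_aug mcoeffU1 -val_eqE /= fmU fm1. Qed.

(* The derivation of the free algebra that multiplies each generator i by w i. *)
Lemma free_weight_derivation (w : I -> K) :
  exists d : free_alg -> free_alg, [/\ linear d,
    forall x y, d (x * y) = d x * y + x * d y &
    forall i, d (free_gen i) = w i *: free_gen i].
Proof.
exists (fmalg_der w); split; first exact: fmalg_der_linear.
  exact: fmalg_derM.
exact: fmalg_der_gen.
Qed.

End FreeAlgebra.

Lemma in_foldrP (T : eqType) (P : T -> Prop) (s : seq T) :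
  foldr (fun r Q => P r /\ Q) True s -> {in s, forall r, P r}.
Proof.
elim: s => [//|r s IHs] /= [Pr /IHs Ps] r'.
by rewrite inE => /orP[/eqP->|/Ps].
Qed.

Section G2Relations.
Variables (K : fieldType) (q : K) (R : algType K) (E : nat -> R).

Local Notation E1 := (E 1).
Local Notation E2 := (E 2).
Local Notation E3 := (E 3).
Local Notation E4 := (E 4).
Local Notation E5 := (E 5).
Local Notation E6 := (E 6).

Definition G2_relations : seq (R * R) :=
  let h := q + q^-1 + q ^- 3 in
  let g := (q ^+ 4 - 2%:R * q ^+ 2 + 1) / (q ^+ 4 + q ^+ 2 + 1) in
  [:: (E2 * E1, q ^- 3 *: (E1 * E2));
      (E3 * E1, q^-1 *: (E1 * E3) - h *: E2);
      (E3 * E2, q ^- 3 *: (E2 * E3));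
      (E4 * E1, E1 * E4 + (1 - q ^+ 2) *: E3 ^+ 2);
      (E4 * E2, q ^- 3 *: (E2 * E4) - g *: E3 ^+ 3);
      (E4 * E3, q ^- 3 *: (E3 * E4));
      (E5 * E1, q *: (E1 * E5) - (1 + q ^+ 2) *: E3);
      (E5 * E2, E2 * E5 + (1 - q ^+ 2) *: E3 ^+ 2);
      (E5 * E3, q^-1 *: (E3 * E5) - h *: E4);
      (E5 * E4, q ^- 3 *: (E4 * E5));
      (E6 * E1, q ^+ 3 *: (E1 * E6) - q ^+ 3 *: E5);
      (E6 * E2, q ^+ 3 *: (E2 * E6) + (q ^+ 4 + q ^+ 2 - 1) *: E4
                  + (q ^+ 2 - q ^+ 4) *: (E3 * E5));
      (E6 * E3, E3 * E6 + (1 - q ^+ 2) *: E5 ^+ 2);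
      (E6 * E4, q ^- 3 *: (E4 * E6) - g *: E5 ^+ 3);
      (E6 * E5, q ^- 3 *: (E5 * E6))].

Definition Omega1_expr : R :=
  let a := (q ^+ 2 + 1 + q ^- 2) / (q ^- 2 - 1) in
  let a' := q ^+ 6 / (q ^+ 2 - 1) in
  E1 * E3 * E5 + a *: (E1 * E4) + a *: (E2 * E5) + a' *: E3 ^+ 2.

Definition Omega2_expr : R :=
  let n := q ^+ 4 + q ^+ 2 + 1 in
  let b := - ((q ^+ 7 - 2%:R * q ^+ 5 + q ^+ 3) / (n * (1 - q ^- 6))) in
  let b' := (q ^+ 13 - q ^+ 11) / n ^+ 2 in
  let c' := - (q ^+ 9 / n) in
  let d' := q ^+ 12 / (q ^+ 6 - 1) in
  E2 * E4 * E6 + b *: (E2 * E5 ^+ 3) + b *: (E3 ^+ 3 * E6)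
    + b' *: (E3 ^+ 2 * E5 ^+ 2) + c' *: (E3 * E4 * E5) + d' *: E4 ^+ 2.

Lemma G2_relations_aug (f : R -> K) :
    {morph f : x y / x + y} -> {morph f : x / - x} ->
    (forall k x, f (k *: x) = k * f x) -> {morph f : x y / x * y} ->
    (forall i, f (E i) = 0) ->
  {in G2_relations, forall r, f (r.1 - r.2) = 0}.
Proof.
move=> fD fN fZ fM fE.
have f0D x y : f x = 0 -> f y = 0 -> f (x + y) = 0.
  by move=> fx fy; rewrite fD fx fy addr0.
have f0N x : f x = 0 -> f (- x) = 0 by move=> fx; rewrite fN fx oppr0.
have f0Z k x : f x = 0 -> f (k *: x) = 0 by move=> fx; rewrite fZ fx mulr0.
have f0M x y : f x = 0 -> f (x * y) = 0 by move=> fx; rewrite fM fx mul0r.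
have f0X x n : f x = 0 -> f (x ^+ n.+1) = 0 by move=> fx; rewrite exprS f0M.
apply: in_foldrP => /=.
repeat match goal with |- _ /\ _ => split | |- True => exact: I end.
all: by repeat first [ exact: fE | apply: (f0D) | apply: (f0N) | apply: (f0Z)
                     | apply: (f0M) | apply: (f0X) ].
Qed.

(* The grading of U_q^+(G_2) in which E_1 and E_6 have weights u and v. *)
Definition G2_weight (u v : K) (i : nat) : K :=
  nth 0 [:: 0; u; 3%:R * u + v; 2%:R * u + v; 3%:R * u + 2%:R * v; u + v; v] i.

Section Homogeneous.
Variables (u v : K) (d : R -> R).
Hypotheses (dl : linear d) (dM : forall x y, d (x * y) = d x * y + x * d y).
Hypothesis dE : forall i, (0 < i <= 6)%N -> d (E i) = G2_weight u v i *: E i.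

Let hom a x := d x = a *: x.

Let homD a x y : hom a x -> hom a y -> hom a (x + y).
Proof.
rewrite /hom => hx hy; have := dl 1 x y.
by rewrite !scale1r hx hy scalerDr.
Qed.

Let hom0 a : hom a 0.
Proof. by rewrite /hom; have := dM 0 0; rewrite !mulr0 mul0r addr0 scaler0. Qed.

Let homZ a k x : hom a x -> hom a (k *: x).
Proof.
rewrite /hom => hx; have := dl k x 0.
by rewrite !addr0 hx (hom0 0) scaler0 addr0 !scalerA mulrC.
Qed.

Let homN a x : hom a x -> hom a (- x).
Proof. by rewrite -scaleN1r; apply: homZ. Qed.

Let homM a b x y : hom a x -> hom b y -> hom (a + b) (x * y).
Proof. by rewrite /hom dM => -> ->; rewrite -scalerAl -scalerAr -scalerDl. Qed.

Let homX a x n : hom a x -> hom (a *+ n) (x ^+ n).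
Proof.
move=> hx; elim: n => [|n IHn]; last by rewrite exprS mulrS; apply: homM.
rewrite /hom mulr0n scale0r; have := dM 1 1; rewrite !mulr1 mul1r => d1.
by apply: (addrI (d 1)); rewrite addr0 -d1.
Qed.

Let hom_cast a b x : hom a x -> a = b -> hom b x.
Proof. by move=> hx <-. Qed.

Ltac hom_synth :=
  first [ by apply: dE | eapply homM; hom_synth | eapply homX; hom_synth ].
Ltac hom_check :=
  first [ apply: homD; hom_check | apply: homN; hom_check
        | apply: homZ; hom_check
        | eapply hom_cast; [hom_synth | rewrite /G2_weight /=; ring] ].

Lemma Omega1_hom : d Omega1_expr = (4%:R * u + 2%:R * v) *: Omega1_expr.
Proof. rewrite -/(hom _ _) /Omega1_expr; hom_check. Qed.

Lemma Omega2_hom : d Omega2_expr = (6%:R * u + 4%:R * v) *: Omega2_expr.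
Proof. rewrite -/(hom _ _) /Omega2_expr; hom_check. Qed.

Lemma G2_relations_hom r : r \in G2_relations ->
  exists a, d (r.1 - r.2) = a *: (r.1 - r.2).
Proof.
move: r; apply: in_foldrP; rewrite /=.
repeat match goal with |- _ /\ _ => split | |- True => exact: I end.
all: match goal with |- exists a, d (E ?i * E ?j - _) = _ =>
  exists (G2_weight u v i + G2_weight u v j) end.
all: rewrite -/(hom _ _); hom_check.
Qed.
End Homogeneous.
End G2Relations.

Section UqG2.
Variables (K : fieldType) (q : K).

(* E_1, ..., E_6 are indexed by the naturals 1, ..., 6; the value at other
   indices is never used. *)
Definition free_E (i : nat) : free_alg K 'I_6 := free_gen K (inord i.-1).

Definition G2_relators (x : free_alg K 'I_6) : Prop :=
  exists2 r, r \in G2_relations q free_E & x = r.1 - r.2.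

Definition UqG2 := alg_quot G2_relators.
HB.instance Definition _ := GRing.Lmodule.on UqG2.
HB.instance Definition _ := GRing.PzRing.on UqG2.

Lemma UqG2_neq0 : 1 != 0 :> UqG2.
Proof.
have aug_rel x : G2_relators x -> free_aug x = 0.
  case=> r /[swap] ->; move: r; apply: G2_relations_aug.
  - exact: free_augD.
  - exact: free_augN.
  - exact: free_augZ.
  - exact: free_augM.
  - by move=> i; apply: free_aug_gen.
have aug_ideal x : ideal_gen G2_relators x -> free_aug x = 0.
  elim=> [|a s b y rs _ IHy]; first exact: free_aug0.
  by rewrite free_augD !free_augM (aug_rel s) // IHy mulr0 mul0r addr0.
apply/eqP; rewrite -[1]/(alg_class G2_relators 1) -[0](linear0 (alg_class G2_relators)).
move/alg_class_eqP/asboolP/aug_ideal; rewrite subr0 free_aug1.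
by apply/eqP; rewrite oner_eq0.
Qed.

HB.instance Definition _ := GRing.PzSemiRing_isNonZero.Build UqG2 UqG2_neq0.
HB.instance Definition _ := GRing.Lmodule_isLalgebra.Build K UqG2
  (@alg_scaleAl _ _ G2_relators).
HB.instance Definition _ := GRing.Lalgebra_isAlgebra.Build K UqG2
  (@alg_scaleAr _ _ G2_relators).

Definition E (i : nat) : UqG2 := alg_class G2_relators (free_E i).

Definition Omega1 : UqG2 := Omega1_expr q E.
Definition Omega2 : UqG2 := Omega2_expr q E.

Variables alpha beta : K.

Definition A_relators (x : UqG2) : Prop :=
  x = Omega1 - alpha%:A \/ x = Omega2 - beta%:A.

Definition e (i : nat) : alg_quot A_relators := alg_class A_relators (E i).

Lemma weight_derivation_exists (u v : K) :
    (4%:R * u + 2%:R * v) * alpha = 0 -> (6%:R * u + 4%:R * v) * beta = 0 ->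
  exists D : derivation A_relators,
    forall i, (0 < i <= 6)%N -> D (e i) = G2_weight u v i *: e i.
Proof.
move=> ha hb.
have [d [dl dM dgen]] :=
  @free_weight_derivation K 'I_6 (fun i => G2_weight u v i.+1).
have dE i : (0 < i <= 6)%N -> d (free_E i) = G2_weight u v i *: free_E i.
  by case: i => // i ilt; rewrite /free_E dgen inordK.
have dI x : G2_relators x -> d x \in ideal G2_relators.
  move=> [r rP ->]; have [a ->] := G2_relations_hom dl dM dE rP.
  by rewrite rpredZ // mem_ideal //; exists r.
have [D DE] := induced_derivation dl dM dI.
pose D' : UqG2 -> UqG2 := D.
have D'l : linear D' := (derivationP D).1.
have D'M x y : D' (x * y) = D' x * y + x * D' y := (derivationP D).2 x y.
have D'E i : (0 < i <= 6)%N -> D' (E i) = G2_weight u v i *: E i.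
  by move=> hi; rewrite /D' [LHS]DE (dE i hi); apply: alg_classZ.
have D'0 : D' 0 = 0.
  by have := D'M 0 0; rewrite !mulr0 mul0r addr0.
have D'1 : D' 1 = 0.
  have := D'M 1 1; rewrite !mulr1 mul1r => D11.
  by apply: (addrI (D' 1)); rewrite addr0 -D11.
have D'C (k : K) x : D' (x - k%:A) = D' x.
  by rewrite addrC -scaleNr D'l D'1 scaler0 add0r.
have D'I x : A_relators x -> D' x \in ideal A_relators.
  have wI a k y : a * k = 0 -> A_relators (y - k%:A) -> D' y = a *: y ->
      D' (y - k%:A) \in ideal A_relators.
    move=> ak0 Ay Dy.
    have -> : D' (y - k%:A) = a *: (y - k%:A).
      by rewrite D'C Dy scalerBr scalerA ak0 scale0r subr0.
    by rewrite rpredZ // mem_ideal.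
  case=> ->.
    by apply: wI ha _ (Omega1_hom q D'l D'M D'E); left.
  by apply: wI hb _ (Omega2_hom q D'l D'M D'E); right.
have [F FE] := induced_derivation D'l D'M D'I.
exists F => i hi; rewrite /e [LHS]FE (D'E i hi); exact: alg_classZ.
Qed.

End UqG2.

Arguments G2_relators {K} q x.
Arguments A_relators {K} q alpha beta x.

Notation Aquot q alpha beta := (alg_quot (A_relators q alpha beta)).

Section Theta.
Variables (K : fieldType) (q : K).

Definition is_theta (alpha : K) (D : derivation (A_relators q alpha 0)) : Prop :=
  let e := e q alpha 0 in
  [/\ D (e 1%N) = - e 1%N, D (e 2%N) = - e 2%N & D (e 3%N) = 0] /\
  [/\ D (e 4%N) = e 4%N, D (e 5%N) = e 5%N & D (e 6%N) = e 6%N *+ 2].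

Definition is_theta_tilde (beta : K) (D : derivation (A_relators q 0 beta)) : Prop :=
  let e := e q 0 beta in
  [/\ D (e 1%N) = - (e 1%N *+ 2), D (e 2%N) = - (e 2%N *+ 3)
    & D (e 3%N) = - e 3%N] /\
  [/\ D (e 4%N) = 0, D (e 5%N) = e 5%N & D (e 6%N) = e 6%N *+ 3].

Let scale_weight (V : lmodType K) (a b : K) (x y : V) :
  a *: x = y -> b = a -> b *: x = y.
Proof. by move=> <- ->. Qed.

Let scaleN_nat (V : lmodType K) n (x : V) : (- n%:R : K) *: x = - (x *+ n).
Proof. by rewrite scaleNr scaler_nat. Qed.

Lemma theta_exists (alpha : K) :
  exists D : derivation (A_relators q alpha 0), is_theta D.
Proof.
have [||D DE] := @weight_derivation_exists K q alpha 0 (-1) 2%:R; try by ring.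
exists D; rewrite /is_theta /= !DE //.
split; split.
- by apply: scale_weight (scaleN1r _) _; rewrite /G2_weight /=; ring.
- by apply: scale_weight (scaleN1r _) _; rewrite /G2_weight /=; ring.
- by apply: scale_weight (scale0r _) _; rewrite /G2_weight /=; ring.
- by apply: scale_weight (scale1r _) _; rewrite /G2_weight /=; ring.
- by apply: scale_weight (scale1r _) _; rewrite /G2_weight /=; ring.
- by apply: scale_weight (scaler_nat 2 _) _; rewrite /G2_weight /=; ring.
Qed.

Lemma theta_tilde_exists (beta : K) :
  exists D : derivation (A_relators q 0 beta), is_theta_tilde D.
Proof.
have [||D DE] := @weight_derivation_exists K q 0 beta (- 2%:R) 3%:R; try by ring.
exists D; rewrite /is_theta_tilde /= !DE //.
split; split.
- by apply: scale_weight (scaleN_nat 2 _) _; rewrite /G2_weight /=; ring.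
- by apply: scale_weight (scaleN_nat 3 _) _; rewrite /G2_weight /=; ring.
- by apply: scale_weight (scaleN1r _) _; rewrite /G2_weight /=; ring.
- by apply: scale_weight (scale0r _) _; rewrite /G2_weight /=; ring.
- by apply: scale_weight (scale1r _) _; rewrite /G2_weight /=; ring.
- by apply: scale_weight (scaler_nat 3 _) _; rewrite /G2_weight /=; ring.
Qed.

End Theta.

(* Main.v *)
(* Deleting derivations embeds A = A_{alpha,beta} into a quantum torus T of rank
   4, in which y = E_3 E_5 + a E_4, Z = E_4 E_6 + b E_5^3, E_5 and E_6 become, up
   to scalars, monomials generating T.  Hence a derivation D of A becomes ad u +
   delta on A for some u in T and some derivation delta of T which is diagonal
   on monomials.

   The left ideal J = {x in A | x u in A} contains some y^m Z^n E_5^i E_6^j.  Each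
   of E_4, E_3, E_2, E_1 is a quotient (X + Y) / s with s = E_6, E_5, Z, y, where
   conjugation by s rescales X and Y differently; commuting it past an element
   r s^(j+1) of J gives r Y s^j in J.  So the exponents j, i, n, m drop one after
   the other to 0, that is 1 in J and u in A.  When alpha or beta vanishes, Y = 0
   for E_1 or E_2, and an element whose product with y or Z is c y^k, c != 0,
   replaces it.  Each time an exponent reaches 0, comparing the weights of X and
   Y under delta yields either an equality of weights or a divisibility in A that
   a second embedding into a torus excludes.  Hence D = ad u + a weight
   derivation, and weight derivations must fix alpha and beta.

   The embedding is injective because A is spanned by ordered monomials avoiding
   two (or, with one more generator, three) forbidden factors, and the leading
   exponents of their images are distinct. *)
Require Import Defs.
From HB Require Import structures.
From mathcomp Require Import all_boot all_order all_algebra.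
From mathcomp Require Import finmap monalg.
From mathcomp Require Import boolp.
From mathcomp Require Import zify ring.

Set Implicit Arguments.
Unset Strict Implicit.
Unset Printing Implicit Defensive.

Import Order.TTheory GRing.Theory Num.Theory.
Local Open Scope ring_scope.

(** * Quantum tori of rank four *)

(* In [qtorus q0 c] below, t^g t^h = q^(kap c g h) t^(g + h); the tuple [c] lists the
   exponents c_ij, i > j, such that t_i t_j = q^(c_ij) t_j t_i. *)
Notation Z4 := (int * int * int * int)%type.
Notation Z6 := (int * int * int * int * int * int)%type.

Definition kap (c : Z6) (g h : Z4) : int :=
  let: (c10, c20, c21, c30, c31, c32) := c in
  let: (g0, g1, g2, g3) := g in
  let: (h0, h1, h2, h3) := h in
  c10 * (g1 * h0) + c20 * (g2 * h0) + c21 * (g2 * h1)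
  + c30 * (g3 * h0) + c31 * (g3 * h1) + c32 * (g3 * h2).

Lemma kapDl c g g' h : kap c (g + g') h = kap c g h + kap c g' h.
Proof.
move: c g g' h => [[[[[??]?]?]?]?] [[[??]?]?] [[[??]?]?] [[[??]?]?].
rewrite /kap /=; ring.
Qed.

Lemma kapDr c g h h' : kap c g (h + h') = kap c g h + kap c g h'.
Proof.
move: c g h h' => [[[[[??]?]?]?]?] [[[??]?]?] [[[??]?]?] [[[??]?]?].
rewrite /kap /=; ring.
Qed.

Lemma kap0l c h : kap c 0 h = 0.
Proof. by apply: (addIr (kap c 0 h)); rewrite -kapDl !add0r. Qed.

Lemma kap0r c g : kap c g 0 = 0.
Proof. by apply: (addIr (kap c g 0)); rewrite -kapDr !add0r. Qed.

Section MalgLinear.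
Variables (K : fieldType) (X : choiceType) (V : lmodType K).

Definition mlin (F : X -> V) (x : {malg K[X]}) : V :=
  \sum_(g <- msupp x) x@_g *: F g.

Lemma mlinEw F x (d : {fset X}) : (msupp x `<=` d)%fset ->
  mlin F x = \sum_(g <- d) x@_g *: F g.
Proof.
move=> sd; rewrite /mlin (big_fset_incl _ sd) // => g _ gx.
by rewrite mcoeff_outdom // scale0r.
Qed.

Lemma mlin_linear F : linear (mlin F).
Proof.
move=> k x y.
have sx : (msupp x `<=` msupp x `|` msupp y)%fset by apply: fsubsetUl.
have sy : (msupp y `<=` msupp x `|` msupp y)%fset by apply: fsubsetUr.
have sxy : (msupp (k *: x + y) `<=` msupp x `|` msupp y)%fset.
  apply: (fsubset_trans (msuppD_le _ _)); rewrite fsetSU //; exact: msuppZ_le.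
rewrite (mlinEw F sx) (mlinEw F sy) (mlinEw F sxy) scaler_sumr -big_split /=.
by apply: eq_bigr => g _; rewrite mcoeffD mcoeffZ scalerDl scalerA.
Qed.

Lemma mlinP F k x y : mlin F (k *: x + y) = k *: mlin F x + mlin F y.
Proof. exact: mlin_linear. Qed.

Lemma mlinZ F k x : mlin F (k *: x) = k *: mlin F x.
Proof.
rewrite (mlinEw F (msuppZ_le k x)) scaler_sumr.
by apply: eq_bigr => g _; rewrite mcoeffZ scalerA.
Qed.

HB.instance Definition _ F :=
  GRing.isLinear.Build K {malg K[X]} V *:%R (mlin F) (mlin_linear F).

Lemma mlinU F c g : mlin F << c *g g >> = c *: F g.
Proof.
rewrite (mlinEw F (@msuppU_le _ _ _ _)) big_seq_fset1.
by rewrite mcoeffUU.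
Qed.

Lemma malg_ZU (c : K) (g : X) : << c *g g >> = c *: << g >> :> {malg K[X]}.
Proof.
by apply/malgP => h; rewrite mcoeffZ !mcoeffU mulrnAr mulr1.
Qed.

Lemma malg_span (x : {malg K[X]}) : x = \sum_(g <- msupp x) x@_g *: << g >>.
Proof. by rewrite {1}[x]monalgE; apply: eq_bigr => g _; rewrite malg_ZU. Qed.

Lemma eq_malg_linear (f f' : {malg K[X]} -> V) :
  linear f -> linear f' -> (forall g, f << g >> = f' << g >>) -> f =1 f'.
Proof.
move=> fl fl' ff' x.
have l0 (h : {malg K[X]} -> V) : linear h -> h 0 = 0.
  by move=> hl; have := hl (-1) 0 0; rewrite !scaleN1r oppr0 addr0 addNr.
rewrite (malg_span x); apply: (big_ind (fun y => f y = f' y)).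
- by rewrite !l0.
- by move=> y z fy fz; rewrite -[y]scale1r fl fl' fy fz.
- by move=> g _; rewrite -[_ *: _]addr0 fl fl' ff' !l0.
Qed.

End MalgLinear.

Definition qtorus (K : fieldType) (q : K) of (q != 0) & Z6 := {malg K[Z4]}.

Section QTorusLmodule.
Variables (K : fieldType) (q : K) (q0 : q != 0) (c : Z6).
HB.instance Definition _ := GRing.Lmodule.on (qtorus q0 c).
End QTorusLmodule.

(* Sealed: unification otherwise unfolds these operations down to finite maps. *)
HB.lock Definition tmon (K : fieldType) (q : K) (q0 : q != 0) (c : Z6)
  (g : Z4) : qtorus q0 c := << g >>.
HB.lock Definition tcf (K : fieldType) (q : K) (q0 : q != 0) (c : Z6)
  (x : qtorus q0 c) (g : Z4) : K := mcoeff g (x : {malg K[Z4]}).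
HB.lock Definition tmul (K : fieldType) (q : K) (q0 : q != 0) (c : Z6)
    (x y : qtorus q0 c) : qtorus q0 c :=
  mlin (fun g => mlin (fun h => q ^ kap c g h *: tmon q0 c (g + h)) y) x.

Section QTorus.
Variables (K : fieldType) (q : K) (q0 : q != 0) (c : Z6).
Notation T := (qtorus q0 c).
Notation tmon := (tmon q0 c).
Notation tmul := (@tmul K q q0 c).
Implicit Types (x y z : T) (g h : Z4) (k : K).

Lemma tmonE g : << g >> = tmon g.
Proof. by rewrite tmon.unlock. Qed.

Lemma tmulMM g h : tmul (tmon g) (tmon h) = q ^ kap c g h *: tmon (g + h).
Proof. by rewrite tmul.unlock tmon.unlock mlinU scale1r mlinU scale1r. Qed.

Lemma tmul_linl y : linear (tmul^~ y).
Proof. by rewrite tmul.unlock => k x x'; exact: mlinP. Qed.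

Lemma tmul_linr x : linear (tmul x).
Proof.
rewrite tmul.unlock => k y y'; rewrite {1 3 5}/mlin scaler_sumr -big_split /=.
by apply: eq_bigr => g _; rewrite [mlin _ _]mlinP scalerDr !scalerA mulrC.
Qed.

Lemma eq_linear (f f' : T -> T) : linear f -> linear f' ->
  (forall g, f (tmon g) = f' (tmon g)) -> f =1 f'.
Proof.
by move=> fl fl' ff'; apply: eq_malg_linear => // g; rewrite tmonE.
Qed.

Lemma lin_comp (f h : T -> T) : linear f -> linear h -> linear (f \o h).
Proof. by move=> fl hl k x y; rewrite /= hl fl. Qed.

Lemma tmulZl k x y : tmul (k *: x) y = k *: tmul x y.
Proof. by rewrite tmul.unlock; exact: mlinZ. Qed.

Lemma tmulZr k x y : tmul x (k *: y) = k *: tmul x y.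
Proof.
rewrite tmul.unlock {1 3}/mlin scaler_sumr; apply: eq_bigr => g _.
by rewrite [mlin _ _]mlinZ !scalerA mulrC.
Qed.

Lemma tmulA : associative tmul.
Proof.
move=> x y z.
apply: (@eq_linear (fun x => tmul x (tmul y z)) (fun x => tmul (tmul x y) z)) => [||g].
- exact: tmul_linl.
- exact: (lin_comp (tmul_linl z) (tmul_linl y)).
apply: (@eq_linear (fun y => tmul (tmon g) (tmul y z)) (fun y => tmul (tmul (tmon g) y) z)) => [||h].
- exact: (lin_comp (tmul_linr _) (tmul_linl _)).
- exact: (lin_comp (tmul_linl _) (tmul_linr _)).
apply: (@eq_linear (fun z => tmul (tmon g) (tmul (tmon h) z)) (tmul (tmul (tmon g) (tmon h)))) => [||l].
- exact: (lin_comp (tmul_linr _) (tmul_linr _)).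
- exact: tmul_linr.
rewrite (tmulMM g h) (tmulMM h l) tmulZl tmulZr.
rewrite (tmulMM (g + h) l) (tmulMM g (h + l)).
rewrite [LHS]scalerA [RHS]scalerA.
rewrite -(expfzDr _ _ q0) -(expfzDr _ _ q0) kapDl kapDr (addrA g).

by rewrite (addrC (kap c h l)) -(addrA (kap c g h)).
Qed.

Lemma tmul1 : left_id (tmon 0) tmul.
Proof.
apply: (@eq_linear (tmul (tmon 0)) id) => [||g] //; first exact: tmul_linr.
by rewrite tmulMM kap0l add0r scale1r.
Qed.

Lemma t1mul : right_id (tmon 0) tmul.
Proof.
apply: (@eq_linear (fun x => tmul x (tmon 0)) id) => [||g] //.
  exact: tmul_linl.
by rewrite tmulMM kap0r addr0 scale1r.
Qed.

Lemma tmulDl : left_distributive tmul +%R.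
Proof. by move=> x y z; have := tmul_linl z 1 x y; rewrite !scale1r. Qed.

Lemma tmulDr : right_distributive tmul +%R.
Proof. by move=> x y z; have := tmul_linr x 1 y z; rewrite !scale1r. Qed.

Lemma tone_neq0 : tmon 0 != 0.
Proof. by rewrite -tmonE monalgU_eq0 oner_eq0. Qed.

HB.instance Definition _ := GRing.Zmodule_isNzRing.Build T
  tmulA tmul1 t1mul tmulDl tmulDr tone_neq0.

Lemma tscaleAl (k : K) (x y : T) : k *: (x * y) = (k *: x) * y.
Proof. by rewrite [RHS]tmulZl. Qed.
HB.instance Definition _ := GRing.Lmodule_isLalgebra.Build K T tscaleAl.

Lemma tscaleAr (k : K) (x y : T) : k *: (x * y) = x * (k *: y).
Proof. by rewrite [RHS]tmulZr. Qed.
HB.instance Definition _ := GRing.Lalgebra_isAlgebra.Build K T tscaleAr.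

End QTorus.

Definition tsupp (K : fieldType) (q : K) (q0 : q != 0) (c : Z6)
  (x : qtorus q0 c) : seq Z4 := msupp (x : {malg K[Z4]}).

Definition om (c : Z6) (g h : Z4) : int := kap c g h - kap c h g.
Arguments kap : simpl never.
Arguments om : simpl never.

Section QTorusTheory.
Variables (K : fieldType) (q : K) (q0 : q != 0) (c : Z6).
Notation T := (qtorus q0 c).
Notation t := (tmon q0 c).
Implicit Types (x y z : T) (g h : Z4) (k : K).

Lemma tcfD x y g : tcf (x + y) g = tcf x g + tcf y g.
Proof. by rewrite tcf.unlock; exact: mcoeffD. Qed.

Lemma tcf0 g : tcf (0 : T) g = 0.
Proof. by rewrite tcf.unlock; exact: mcoeff0. Qed.

Lemma tcfZ k x g : tcf (k *: x) g = k * tcf x g.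
Proof. by rewrite tcf.unlock; exact: mcoeffZ. Qed.

Lemma tcfN x g : tcf (- x) g = - tcf x g.
Proof. by rewrite -scaleN1r tcfZ mulN1r. Qed.

Lemma tcfB x y g : tcf (x - y) g = tcf x g - tcf y g.
Proof. by rewrite tcfD tcfN. Qed.

Lemma tcf_sum I (r : seq I) (P : pred I) (F : I -> T) g :
  tcf (\sum_(i <- r | P i) F i) g = \sum_(i <- r | P i) tcf (F i) g.
Proof.
elim/big_rec2: _ => [|i a b _ <-]; first by rewrite tcf0.
by rewrite tcfD.
Qed.

Lemma tcfM g h : tcf (t g) h = (g == h)%:R.
Proof. by rewrite tcf.unlock tmon.unlock; exact: mcoeffU. Qed.

Lemma tcfP x y : (forall g, tcf x g = tcf y g) -> x = y.
Proof. by rewrite tcf.unlock => e; apply/malgP. Qed.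

Lemma tsuppP x g : (g \in tsupp x) = (tcf x g != 0).
Proof. by rewrite tcf.unlock mcoeff_neq0. Qed.

Lemma tsupp_uniq x : uniq (tsupp x).
Proof. exact: fset_uniq. Qed.

Lemma tsumE x : x = \sum_(g <- tsupp x) tcf x g *: t g.
Proof. by rewrite tcf.unlock tmon.unlock; exact: malg_span. Qed.

Lemma tmonM g h : t g * t h = q ^ kap c g h *: t (g + h).
Proof. exact: tmulMM. Qed.

Lemma qz_neq0 (n : int) : q ^ n != 0.
Proof. exact: expfz_neq0. Qed.

Lemma tmon_comm g h : t g * t h = q ^ om c g h *: (t h * t g).
Proof.
by rewrite !tmonM scalerA -(expfzDr _ _ q0) (addrC h g) /om subrK.
Qed.

Lemma tcfMr x h g : tcf (x * t h) (g + h) = tcf x g * q ^ kap c g h.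
Proof.
rewrite {1}(tsumE x) mulr_suml tcf_sum.
transitivity (\sum_(i <- tsupp x) tcf x i * (q ^ kap c i h * (i == g)%:R)).
  apply: eq_bigr => i _.
  by rewrite -scalerAl tcfZ tmonM tcfZ tcfM (inj_eq (addIr h)).
case: (boolP (g \in tsupp x)) => gx.
  rewrite (bigD1_seq g) ?tsupp_uniq //= eqxx mulr1 big1 ?addr0 // => i.
  by move=> /negPf ->; rewrite !mulr0.
have /eqP -> : tcf x g == 0 by rewrite -[_ == _]negbK -tsuppP.
rewrite mul0r big_seq big1 // => i ix; case: eqP => [ei|_]; last by rewrite !mulr0.
by rewrite -ei ix in gx.
Qed.

Lemma tcfMl x h g : tcf (t h * x) (h + g) = q ^ kap c h g * tcf x g.
Proof.
rewrite {1}(tsumE x) mulr_sumr tcf_sum.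
transitivity (\sum_(i <- tsupp x) tcf x i * (q ^ kap c h i * (i == g)%:R)).
  apply: eq_bigr => i _.
  by rewrite -scalerAr tcfZ tmonM tcfZ tcfM (inj_eq (addrI h)).
case: (boolP (g \in tsupp x)) => gx.
  rewrite (bigD1_seq g) ?tsupp_uniq //= eqxx mulr1 big1 ?addr0 1?mulrC // => i.
  by move=> /negPf ->; rewrite !mulr0.
have /eqP -> : tcf x g == 0 by rewrite -[_ == _]negbK -tsuppP.
rewrite mulr0 big_seq big1 // => i ix; case: eqP => [ei|_]; last by rewrite !mulr0.
by rewrite -ei ix in gx.
Qed.

Lemma tcf_mulZr k x y g : tcf (x * (k *: y)) g = k * tcf (x * y) g.
Proof. by rewrite -scalerAr tcfZ. Qed.

Lemma tcf_mulZl k x y g : tcf ((k *: x) * y) g = k * tcf (x * y) g.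
Proof. by rewrite -scalerAl tcfZ. Qed.

Lemma tmon_regr x g : x * t g = 0 -> x = 0.
Proof.
move=> xg; apply: tcfP => h; rewrite tcf0; apply/eqP.
have := tcfMr x g h; rewrite xg tcf0 => /eqP.
by rewrite eq_sym mulf_eq0 (negPf (qz_neq0 _)) orbF.
Qed.

Lemma tcf_mul_neq0 x y g : tcf (x * y) g != 0 ->
  exists a b, [/\ g = a + b, tcf x a != 0 & tcf y b != 0].
Proof.
rewrite {1}(tsumE x) mulr_suml tcf_sum => ne.
have [a ax] : exists2 a, a \in tsupp x & tcf (tcf x a *: t a * y) g != 0.
  apply: contrapT => H; case/eqP: ne; rewrite big_seq big1 // => a ax.
  by apply/eqP; apply: contrapT => /negP na; apply: H; exists a.
rewrite -scalerAl tcfZ mulf_eq0 negb_or => /andP[xa].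
rewrite -(subrK a g) addrC tcfMl mulf_eq0 negb_or => /andP[_ yb].
by exists a, (g - a).
Qed.

Section Degree.
Variable f : Z4 -> int.
Hypothesis fD : forall g h, f (g + h) = f g + f h.

Definition tdle x (d : int) := forall g, tcf x g != 0 -> f g <= d.

Definition tlead x g :=
  tcf x g != 0 /\ forall h, h != g -> tcf x h != 0 -> f h < f g.

Lemma tlead_tdle x g : tlead x g -> tdle x (f g).
Proof.
by case=> _ lt h xh; case: (eqVneq h g) => [->//|hg]; apply/ltW/lt.
Qed.

Lemma tlead_mon g : tlead (t g) g.
Proof.
split=> [|h hg]; first by rewrite tcfM eqxx oner_eq0.
by rewrite tcfM [g == h]eq_sym (negPf hg) eqxx.
Qed.

Lemma tleadZ k x g : k != 0 -> tlead x g -> tlead (k *: x) g.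
Proof.
move=> k0 [x0 lt]; split=> [|h hg].
  by rewrite tcfZ mulf_neq0.
by rewrite tcfZ mulf_eq0 negb_or => /andP[_]; apply: lt.
Qed.

(* The top coefficient of a product is a product of top coefficients as soon as
   one factor has a unique top exponent. *)
Lemma tcf_leadM x y d g a : tdle x d -> tlead y g -> f a = d ->
  tcf (x * y) (a + g) = tcf x a * tcf y g * q ^ kap c a g.
Proof.
move=> xd [yg ylt] fa; rewrite {1}(tsumE y) mulr_sumr tcf_sum.
have gy : g \in tsupp y by rewrite tsuppP.
transitivity (\sum_(h <- tsupp y) tcf y h * tcf (x * t h) (a + g)).
  by apply: eq_bigr => h _; rewrite tcf_mulZr.
rewrite (bigD1_seq g gy (tsupp_uniq y)) big1_seq => [|h /andP[hg]].
  by apply: (etrans (addr0 _)); rewrite (tcfMr x g a) mulrCA mulrA.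
rewrite tsuppP => yh.
rewrite -(subrK h (a + g)) tcfMr; apply/eqP; rewrite !mulf_eq0 (negPf (qz_neq0 _)).
rewrite orbF (negPf yh) orFb; apply: contrapT => /negP /xd.
have -> : f (a + g - h) = d + (f g - f h).
  by apply: (addIr (f h)); rewrite -fD subrK fD fa -addrA subrK.
by rewrite gerDl subr_le0 leNgt ylt.
Qed.

Lemma tleadM x y a b : tlead x a -> tlead y b -> tlead (x * y) (a + b).
Proof.
move=> la lb; split.
  rewrite (tcf_leadM (tlead_tdle la) lb erefl).
  by rewrite !mulf_neq0 ?qz_neq0 //; [exact: la.1|exact: lb.1].
move=> h hab /tcf_mul_neq0[a' [b' [eh xa yb]]].
rewrite eh fD fD; have ha := tlead_tdle la xa; have hb := tlead_tdle lb yb.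
case: (eqVneq a' a) => [ea|na]; last by rewrite ltr_leD // la.2.
case: (eqVneq b' b) => [eb|nb]; last by rewrite ler_ltD // lb.2.
by move: hab; rewrite eh ea eb eqxx.
Qed.

Lemma tlead1 : tlead 1 0.
Proof. exact: (tlead_mon 0). Qed.

Lemma tleadX x a n : tlead x a -> tlead (x ^+ n) (a *+ n).
Proof.
move=> la; elim: n => [|n IHn]; first by rewrite expr0 mulr0n; apply: tlead1.
by rewrite exprS mulrS; apply: tleadM.
Qed.

Lemma tdeg_ex x : x != 0 -> exists a, tcf x a != 0 /\ tdle x (f a).
Proof.
move=> x0; have : tsupp x != [::].
  by apply: contra x0 => /eqP s0; rewrite (tsumE x) s0 big_nil.
move=> sx; pose b := head 0 (tsupp x).
have bx : b \in tsupp x by rewrite /b; case: (tsupp x) sx => //= ? ?; rewrite mem_head.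
have [a ax amax] : exists2 a, a \in tsupp x & forall g, g \in tsupp x -> f g <= f a.
  elim: (tsupp x) sx => // u s IH _; case: (eqVneq s [::]) => [->|s0].
    by exists u; rewrite ?mem_head // => g; rewrite inE => /eqP ->.
  have [v vs vmax] := IH s0; case: (lerP (f u) (f v)) => uv.
    exists v => [|g]; first by rewrite inE vs orbT.
    by rewrite inE => /orP[/eqP ->//|/vmax].
  exists u => [|g]; first exact: mem_head.
  by rewrite inE => /orP[/eqP ->//|/vmax/le_trans]; apply; exact: ltW.
by exists a; split=> [|g]; rewrite -?tsuppP //; apply: amax.
Qed.

Lemma tdeg_quot x y p g b : tlead p g -> tlead y b -> p = x * y -> tdle x (f g - f b).
Proof.
move=> lp ly e; have x0 : x != 0.
  by apply/eqP => x0; case: lp.1; rewrite e x0 mul0r tcf0 eqxx.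
have [a [xa xd]] := tdeg_ex x0.
have pab : tcf p (a + b) != 0.
  by rewrite e (tcf_leadM xd ly erefl) !mulf_neq0 ?qz_neq0 //; exact: ly.1.
have := tlead_tdle lp pab; rewrite fD => ab h /xd ha.
by apply: (le_trans ha); rewrite lerBrDr.
Qed.
End Degree.

End QTorusTheory.

(** * Computing with Laurent expressions *)

(* The pair (n, k) stands for n q^k. *)
Definition lau := seq (int * int).

Section Lau.
Variables (K : fieldType) (q : K).
Definition lev (l : lau) : K := \sum_(p <- l) p.1%:~R * q ^ p.2.
Definition lsum (V : lmodType K) (f : seq nat -> V) (l : seq (lau * seq nat)) : V :=
  \sum_(p <- l) lev p.1 *: f p.2.
End Lau.

Section FormalSums.
Variables (K : fieldType) (X : eqType) (V : lmodType K) (ev : X -> V).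
Implicit Types (l : seq (int * X)).

Definition gev l : V := \sum_(p <- l) p.1%:~R *: ev p.2.

Fixpoint gins (x : int * X) l : seq (int * X) :=
  if l is y :: l' then
    if x.2 == y.2 then (x.1 + y.1, y.2) :: l' else y :: gins x l'
  else [:: x].
Definition gnorm l : seq (int * X) :=
  filter (fun p => p.1 != 0) (foldr gins [::] l).

Lemma gev_cat l1 l2 : gev (l1 ++ l2) = gev l1 + gev l2.
Proof. by rewrite /gev big_cat. Qed.

Lemma gev_nil : gev [::] = 0.
Proof. by rewrite /gev big_nil. Qed.

Lemma gev_cons x l : gev (x :: l) = x.1%:~R *: ev x.2 + gev l.
Proof. by rewrite /gev big_cons. Qed.

Lemma gev_flatten ls : gev (flatten ls) = \sum_(l <- ls) gev l.
Proof.
elim: ls => [|l ls IH] /=; first by rewrite big_nil gev_nil.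
by rewrite gev_cat IH big_cons.
Qed.

Lemma gev_ins x l : gev (gins x l) = x.1%:~R *: ev x.2 + gev l.
Proof.
elim: l => [|y l IH]; first by rewrite [LHS]gev_cons.
rewrite [gins x _]/=; case: eqP => [e|_].
  by rewrite !gev_cons e intrD scalerDl addrA.
by rewrite !gev_cons IH addrCA.
Qed.

Lemma gev_norm l : gev (gnorm l) = gev l.
Proof.
rewrite /gnorm; transitivity (gev (foldr gins [::] l)).
  elim: (foldr _ _ _) => // x s IH.
  rewrite [filter _ _]/=; case: ifP => [_|/negbFE/eqP e].
    by rewrite !gev_cons IH.
  by rewrite IH [RHS]gev_cons e scale0r add0r.
elim: l => // x l IH.
by rewrite [foldr _ _ _]/= gev_ins IH [RHS]gev_cons.
Qed.

Lemma gev_map (P : Type) (f : P -> int * X) (r : seq P) :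
  gev [seq f x | x <- r] = \sum_(x <- r) (f x).1%:~R *: ev (f x).2.
Proof. by rewrite /gev big_map. Qed.

End FormalSums.

(* (n, (k, (a, b), g)) stands for n q^k alpha^a beta^b t^g. *)
Definition tterm := (int * (int * (nat * nat) * Z4))%type.
Definition mk_tterm (k : int) (a b : nat) (g0 g1 g2 g3 : int) : tterm :=
  (1, (k, (a, b), (g0, g1, g2, g3))).

Section Reflect.
Variables (K : fieldType) (q : K) (q0 : q != 0) (c : Z6) (al be : K).
Notation T := (qtorus q0 c).
Implicit Types (l : seq tterm).

Definition kev (k : int * (nat * nat) * Z4) : T :=
  (q ^ k.1.1 * al ^+ k.1.2.1 * be ^+ k.1.2.2) *: tmon q0 c k.2.
Local Notation tev := (gev kev).

Definition tmul1t (x y : tterm) : tterm :=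
  (x.1 * y.1, (x.2.1.1 + y.2.1.1 + kap c x.2.2 y.2.2,
    ((x.2.1.2.1 + y.2.1.2.1)%N, (x.2.1.2.2 + y.2.1.2.2)%N), x.2.2 + y.2.2)).

Definition lmul l1 l2 : seq tterm :=
  gnorm (flatten [seq [seq tmul1t x y | y <- l2] | x <- l1]).
Definition lscale (u : lau) l : seq tterm :=
  flatten [seq [seq (p.1 * x.1, (p.2 + x.2.1.1, x.2.1.2, x.2.2)) | x <- l] | p <- u].
Definition lword (ch : nat -> seq tterm) (w : seq nat) : seq tterm :=
  foldr (fun i => lmul (ch i)) [:: (1, (0, (0%N, 0%N), 0))] w.
Definition llin ch (r : seq (lau * seq nat)) : seq tterm :=
  gnorm (flatten [seq lscale p.1 (lword ch p.2) | p <- r]).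
Definition fword (R : nzRingType) (F : nat -> R) (w : seq nat) : R := \prod_(i <- w) F i.

Lemma tmonZM (a b : K) g h :
  (a *: tmon q0 c g) * (b *: tmon q0 c h) = (a * b * q ^ kap c g h) *: tmon q0 c (g + h).
Proof.
by rewrite -scalerAl -scalerAr tmonM [b *: _]scalerA [LHS]scalerA mulrA.
Qed.

Lemma kev_coef (k k' m : int) (a b a' b' : nat) :
  q ^ k * al ^+ a * be ^+ b * (q ^ k' * al ^+ a' * be ^+ b') * q ^ m =
  q ^ (k + k' + m) * al ^+ (a + a') * be ^+ (b + b').
Proof. by rewrite !exprD (expfzDr _ _ q0) (expfzDr _ _ q0); ring. Qed.

Lemma kevM x y : kev x.2 * kev y.2 = kev (tmul1t x y).2.
Proof.
case: x => x1 [[k [a b]] g]; case: y => y1 [[k' [a' b']] h].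
by apply: (etrans (tmonZM _ _ _ _)); rewrite kev_coef.
Qed.

Lemma kevZM (a b : K) (x y : T) : (a *: x) * (b *: y) = (a * b) *: (x * y).
Proof. by rewrite -scalerAl -scalerAr scalerA. Qed.

Lemma tev_mul l1 l2 : tev (lmul l1 l2) = tev l1 * tev l2.
Proof.
rewrite /lmul gev_norm gev_flatten big_map [tev l1]/gev mulr_suml.
apply: eq_bigr => x _.
rewrite gev_map [tev l2]/gev mulr_sumr; apply: eq_bigr => y _.
by rewrite (kevZM _ _ (kev x.2)) kevM -intrM.
Qed.

Lemma kev_shift (k : int) x :
  kev (k + x.1.1, x.1.2, x.2) = q ^ k *: kev x.
Proof.
case: x => [[m [a b]] g]; apply/esym/(etrans (scalerA _ _ _)).
by rewrite /kev [(_, _).1.1]/= (expfzDr _ _ q0) !mulrA.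
Qed.

Lemma tev_scale u l : tev (lscale u l) = lev q u *: tev l.
Proof.
rewrite /lscale gev_flatten big_map /lev scaler_suml; apply: eq_bigr => p _.
rewrite gev_map [tev l]/gev scaler_sumr; apply: eq_bigr => x _.
rewrite -[(_, _).2]/(p.2 + x.2.1.1, x.2.1.2, x.2.2) kev_shift.
rewrite -[(_, _).1]/(p.1 * x.1) intrM.
by rewrite [LHS]scalerA [RHS]scalerA mulrAC.
Qed.

Lemma tev_word ch w : tev (lword ch w) = fword (fun i => tev (ch i)) w.
Proof.
elim: w => [|i w IH].
  rewrite /fword big_nil /gev big_seq1 /kev [_.1%:~R]/= /=.
  by rewrite !mulr1 scale1r; apply: (etrans (scale1r _)).
by rewrite [lword _ _]/= tev_mul IH /fword big_cons.
Qed.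

Lemma tev_lin ch r : tev (llin ch r) = lsum q (fword (fun i => tev (ch i))) r.
Proof.
rewrite /llin gev_norm gev_flatten big_map; apply: eq_bigr => p _.
by rewrite tev_scale tev_word.
Qed.

End Reflect.

Notation tev q0 c al be := (gev (kev q0 c al be)).

(** * The two charts *)

(* Images of the normalized generators F_i = E_i / gen_scale q i, with the
   parameters alpha_of and beta_of.  [chart1] deletes derivations in the order
   E_6, ..., E_1 and uses the torus of t_3, ..., t_6, the images of y and Z being
   t_3 t_5 and t_4 t_6; [chart2] proceeds in the opposite order, with the torus
   of t_1, ..., t_4.  Omega_1 and Omega_2 eliminate the two remaining variables. *)
Definition chart1 (i : nat) : seq tterm :=
  match i with
  | 1 => [:: mk_tterm (-12) 0 0 (0) (0) (1) (-1); mk_tterm (-6) 0 0 (0) (1) (-2) (0); 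
      mk_tterm (-8) 0 0 (1) (0) (-1) (0); mk_tterm (-6) 0 0 (1) (0) (-1) (0); 
      mk_tterm (-3) 0 0 (2) (-1) (0) (0); mk_tterm (-6) 0 1 (-1) (-1) (0) (-1); 
      mk_tterm (-1) 1 0 (-1) (0) (-1) (0)]
  | 2 => [:: mk_tterm (-9) 0 0 (0) (0) (3) (-2); mk_tterm (-15) 0 0 (0) (1) (0) (-1); 
      mk_tterm (-9) 0 0 (0) (1) (0) (-1); mk_tterm (0) 0 0 (0) (2) (-3) (0); 
      mk_tterm (-13) 0 0 (1) (0) (1) (-1); mk_tterm (-11) 0 0 (1) (0) (1) (-1); 
      mk_tterm (-9) 0 0 (1) (0) (1) (-1); mk_tterm (-7) 0 0 (1) (1) (-2) (0); 
      mk_tterm (-5) 0 0 (1) (1) (-2) (0); mk_tterm (-3) 0 0 (1) (1) (-2) (0); 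
      mk_tterm (-7) 0 0 (2) (0) (-1) (0); mk_tterm (-5) 0 0 (2) (0) (-1) (0); 
      mk_tterm (-3) 0 0 (2) (0) (-1) (0); mk_tterm (0) 0 0 (3) (-1) (0) (0); 
      mk_tterm (-3) 0 1 (0) (-1) (0) (-1)]
  | 3 => [:: mk_tterm (-3) 0 0 (0) (0) (2) (-1); mk_tterm (0) 0 0 (0) (1) (-1) (0); 
      mk_tterm (0) 0 0 (1) (0) (0) (0)]
  | 4 => [:: mk_tterm (0) 0 0 (0) (0) (3) (-1); mk_tterm (0) 0 0 (0) (1) (0) (0)]
  | 5 => [:: mk_tterm (0) 0 0 (0) (0) (1) (0)]
  | 6 => [:: mk_tterm (0) 0 0 (0) (0) (0) (1)]
  | _ => [::]
  end%N.

Definition chart2 (i : nat) : seq tterm :=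
  match i with
  | 1 => [:: mk_tterm (0) 0 0 (1) (0) (0) (0)]
  | 2 => [:: mk_tterm (0) 0 0 (0) (1) (0) (0)]
  | 3 => [:: mk_tterm (0) 0 0 (-1) (1) (0) (0); mk_tterm (0) 0 0 (0) (0) (1) (0)]
  | 4 => [:: mk_tterm (0) 0 0 (-3) (2) (0) (0); mk_tterm (-7) 0 0 (-2) (1) (1) (0); 
      mk_tterm (-5) 0 0 (-2) (1) (1) (0); mk_tterm (-3) 0 0 (-2) (1) (1) (0); 
      mk_tterm (-7) 0 0 (-1) (0) (2) (0); mk_tterm (-5) 0 0 (-1) (0) (2) (0); 
      mk_tterm (-3) 0 0 (-1) (0) (2) (0); mk_tterm (0) 0 0 (0) (-1) (3) (0); 
      mk_tterm (0) 0 0 (0) (0) (0) (1)]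
  | 5 => [:: mk_tterm (-6) 0 0 (-2) (1) (0) (0); mk_tterm (-8) 0 0 (-1) (0) (1) (0); 
      mk_tterm (-6) 0 0 (-1) (0) (1) (0); mk_tterm (-3) 0 0 (0) (-1) (2) (0); 
      mk_tterm (0) 0 0 (0) (0) (-1) (1); mk_tterm (-1) 1 0 (-1) (0) (-1) (0)]
  | 6 => [:: mk_tterm (-18) 0 0 (-3) (1) (0) (0); mk_tterm (-22) 0 0 (-2) (0) (1) (0); 
      mk_tterm (-20) 0 0 (-2) (0) (1) (0); mk_tterm (-18) 0 0 (-2) (0) (1) (0); 
      mk_tterm (-19) 0 0 (-1) (-1) (2) (0); mk_tterm (-17) 0 0 (-1) (-1) (2) (0); 
      mk_tterm (-15) 0 0 (-1) (-1) (2) (0); mk_tterm (-16) 0 0 (-1) (0) (-1) (1); 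
      mk_tterm (-14) 0 0 (-1) (0) (-1) (1); mk_tterm (-12) 0 0 (-1) (0) (-1) (1); 
      mk_tterm (-9) 0 0 (0) (-2) (3) (0); mk_tterm (-15) 0 0 (0) (-1) (0) (1); 
      mk_tterm (-9) 0 0 (0) (-1) (0) (1); mk_tterm (0) 0 0 (0) (0) (-3) (2); 
      mk_tterm (-3) 0 1 (0) (-1) (0) (-1); mk_tterm (-17) 1 0 (-2) (0) (-1) (0); 
      mk_tterm (-15) 1 0 (-2) (0) (-1) (0); mk_tterm (-13) 1 0 (-2) (0) (-1) (0); 
      mk_tterm (-16) 1 0 (-1) (-1) (0) (0); mk_tterm (-14) 1 0 (-1) (-1) (0) (0); 
      mk_tterm (-12) 1 0 (-1) (-1) (0) (0); mk_tterm (-7) 1 0 (-1) (0) (-3) (1); 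
      mk_tterm (-5) 1 0 (-1) (0) (-3) (1); mk_tterm (-3) 1 0 (-1) (0) (-3) (1); 
      mk_tterm (-12) 2 0 (-2) (0) (-3) (0); mk_tterm (-10) 2 0 (-2) (0) (-3) (0); 
      mk_tterm (-8) 2 0 (-2) (0) (-3) (0); mk_tterm (-15) 3 0 (-3) (0) (-3) (-1)]
  | _ => [::]
  end%N.

(* A row (j, i, k, tl) is the relation F_j F_i = q^k F_i F_j + tl.  After the
   normalization all coefficients are Laurent polynomials over the integers. *)
Definition rels : seq (nat * nat * int * seq (lau * seq nat)) :=
  [::
   (2%N, 1%N, -3, [:: ]);
   (3%N, 1%N, -1, [:: ([:: (1, -3); (-1, -1)], [:: 2%N])]);
   (3%N, 2%N, -3, [:: ]);
   (4%N, 1%N, 0, [:: ([:: (1, -9); (-1, -3)], [:: 3%N; 3%N])]);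
   (4%N, 2%N, -3, [:: ([:: (1, -9); (-1, -3)], [:: 3%N; 3%N; 3%N])]);
   (4%N, 3%N, -3, [:: ]);
   (5%N, 1%N, 1, [:: ([:: (1, -9); (-1, -5)], [:: 3%N])]);
   (5%N, 2%N, 0, [:: ([:: (1, -9); (-1, -3)], [:: 3%N; 3%N])]);
   (5%N, 3%N, -1, [:: ([:: (1, -3); (-1, -1)], [:: 4%N])]);
   (5%N, 4%N, -3, [:: ]);
   (6%N, 1%N, 3, [:: ([:: (1, -15); (-1, -9)], [:: 5%N])]);
   (6%N, 2%N, 3, [:: ([:: (1, -18); (-1, -16); (-1, -14); (-1, -12); (1, -10); (1, -8)], [:: 4%N]); ([:: (1, -16); (1, -14); (1, -12); (-1, -10); (-1, -8); (-1, -6)], [:: 3%N; 5%N])]);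
   (6%N, 3%N, 0, [:: ([:: (1, -9); (-1, -3)], [:: 5%N; 5%N])]);
   (6%N, 4%N, -3, [:: ([:: (1, -9); (-1, -3)], [:: 5%N; 5%N; 5%N])]);
   (6%N, 5%N, -3, [:: ])].
Definition rel_Om1 : seq (lau * seq nat) :=
  [:: ([:: (1, 0)], [:: 1%N; 3%N; 5%N]);
      ([:: (-1, 0)], [:: 1%N; 4%N]);
      ([:: (-1, 0)], [:: 2%N; 5%N]);
      ([:: (1, -3)], [:: 3%N; 3%N])].
Definition rel_Om2 : seq (lau * seq nat) :=
  [:: ([:: (1, 0)], [:: 2%N; 4%N; 6%N]);
      ([:: (-1, 0)], [:: 2%N; 5%N; 5%N; 5%N]);
      ([:: (-1, 0)], [:: 3%N; 3%N; 3%N; 6%N]);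
      ([:: (1, -7); (1, -5); (1, -3)], [:: 3%N; 3%N; 5%N; 5%N]);
      ([:: (-1, -9); (-1, -7); (-1, -5)], [:: 3%N; 4%N; 5%N]);
      ([:: (1, -6)], [:: 4%N; 4%N])].

Definition rel_lin (r : nat * nat * int * seq (lau * seq nat)) : seq (lau * seq nat) :=
  let: (j, i, k, tl) := r in
  ([:: (1, 0)], [:: j; i]) :: ([:: (-1, k)], [:: i; j]) ::
    [seq ([seq (- x.1, x.2) | x <- p.1], p.2) | p <- tl].

(* Both charts have the same commutation exponents, c_21, ..., c_43 being equal to
   c_43, ..., c_65. *)
Definition G2_cocycle : Z6 := (-3, -1, -3, 0, -3, -3).

Lemma chart1_rels : all (fun r => llin G2_cocycle chart1 (rel_lin r) == [::]) rels.
Proof. by vm_compute. Qed.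
Lemma chart2_rels : all (fun r => llin G2_cocycle chart2 (rel_lin r) == [::]) rels.
Proof. by vm_compute. Qed.
Lemma chart1_Om1 : llin G2_cocycle chart1 rel_Om1 = [:: mk_tterm 0 1 0 0 0 0 0].
Proof. by vm_compute. Qed.
Lemma chart1_Om2 : llin G2_cocycle chart1 rel_Om2 = [:: mk_tterm 0 0 1 0 0 0 0].
Proof. by vm_compute. Qed.
Lemma chart2_Om1 : llin G2_cocycle chart2 rel_Om1 = [:: mk_tterm 0 1 0 0 0 0 0].
Proof. by vm_compute. Qed.
Lemma chart2_Om2 : llin G2_cocycle chart2 rel_Om2 = [:: mk_tterm 0 0 1 0 0 0 0].
Proof. by vm_compute. Qed.

(** * Computing with words in the generators *)

Definition wterm := (int * (int * seq nat))%type.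

Definition lflat (r : seq (lau * seq nat)) : seq wterm :=
  flatten [seq [seq (x.1, (x.2, p.2)) | x <- p.1] | p <- r].
Definition wmul1 (s t : wterm) : wterm :=
  (s.1 * t.1, (s.2.1 + t.2.1, s.2.2 ++ t.2.2)).
Definition wmul (l1 l2 : seq wterm) : seq wterm :=
  flatten [seq [seq wmul1 s t | t <- l2] | s <- l1].
Definition wlet (i : nat) : seq wterm := [:: (1, (0, [:: i]))].

Definition rel_rhs (r : nat * nat * int * seq (lau * seq nat)) : seq wterm :=
  let: (j, i, k, tl) := r in lflat (([:: (1, k)], [:: i; j]) :: tl).
Definition rule (j i : nat) : option (seq wterm) :=
  if [seq rel_rhs r | r <- rels & (r.1.1.1 == j) && (r.1.1.2 == i)] is l :: _
  then Some l else None.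

Fixpoint wred (w : seq nat) : seq wterm :=
  if w is a :: one_letter then
    if one_letter is b :: w' then
      if rule a b is Some l then wmul l [:: (1, (0, w'))]
      else wmul (wlet a) (wred one_letter)
    else [:: (1, (0, w))]
  else [:: (1, (0, w))].
Definition wred1 (t : wterm) : seq wterm := wmul [:: (t.1, (t.2.1, [::]))] (wred t.2.2).
Fixpoint wnf (n : nat) (l : seq wterm) : seq wterm :=
  if n is n'.+1 then wnf n' (gnorm (flatten [seq wred1 t | t <- l])) else l.

Arguments wnf : simpl never.

(* The letter 7 stands for the element given by the combination [d]. *)
Definition wexp (d : seq (lau * seq nat)) (w : seq nat) : seq wterm :=
  foldr (fun i => wmul (if i == 7%N then lflat d else wlet i)) [:: (1, (0, [::]))] w.
Definition lexp d (r : seq (lau * seq nat)) : seq wterm :=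
  flatten [seq wmul (lflat [:: (p.1, [::])]) (wexp d p.2) | p <- r].

Section WordReflect.
Variables (K : fieldType) (q : K) (q0 : q != 0) (A : algType K) (F : nat -> A).

Definition wev1 (k : int * seq nat) : A := q ^ k.1 *: fword F k.2.
Local Notation wev := (gev wev1).

Lemma wev_flat r : wev (lflat r) = lsum q (fword F) r.
Proof.
rewrite /lflat gev_flatten big_map; apply: eq_bigr => p _.
rewrite gev_map /lev scaler_suml; apply: eq_bigr => x _.
by rewrite /wev1 /= scalerA.
Qed.

Lemma fword_cat w v : fword F (w ++ v) = fword F w * fword F v.
Proof. by rewrite /fword big_cat. Qed.

Lemma fword_cons i w : fword F (i :: w) = F i * fword F w.
Proof. by rewrite /fword big_cons. Qed.

Lemma fword1 i : fword F [:: i] = F i.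
Proof. by rewrite /fword big_seq1. Qed.

Lemma wev_mul l1 l2 : wev (wmul l1 l2) = wev l1 * wev l2.
Proof.
rewrite /wmul gev_flatten big_map [wev l1]/gev mulr_suml; apply: eq_bigr => s _.
rewrite gev_map [wev l2]/gev mulr_sumr; apply: eq_bigr => t _.
rewrite /wev1 /= fword_cat expfzDr // intrM -!scalerAl -!scalerAr !scalerA.
by congr (_ *: _); ring.
Qed.

Lemma wev_one w : wev [:: (1, (0, w))] = fword F w.
Proof. by rewrite gev_cons gev_nil addr0 /wev1 /= expr0z !scale1r. Qed.

Lemma fword2 i j : fword F [:: i; j] = F i * F j.
Proof. by rewrite fword_cons fword1. Qed.

Lemma wev_let i : wev (wlet i) = F i.
Proof. by rewrite wev_one fword1. Qed.

Hypothesis Frel : forall r, r \in rels -> lsum q (fword F) (rel_lin r) = 0.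

Lemma lsum_cons (f : seq nat -> A) p r : lsum q f (p :: r) = lev q p.1 *: f p.2 + lsum q f r.
Proof. by rewrite /lsum big_cons. Qed.

Lemma lev1 n k : lev q [:: (n, k)] = n%:~R * q ^ k.
Proof. by rewrite /lev big_seq1. Qed.

Lemma lsum_opp (f : seq nat -> A) r :
  lsum q f [seq ([seq (- x.1, x.2) | x <- p.1], p.2) | p <- r] = - lsum q f r.
Proof.
rewrite /lsum big_map -sumrN; apply: eq_bigr => p _.
rewrite -scaleNr; congr (_ *: _); rewrite /lev big_map -sumrN; apply: eq_bigr => x _.
by rewrite rmorphN mulNr.
Qed.

Lemma rel_rhsP j i k tl : (j, i, k, tl) \in rels ->
  F j * F i = q ^ k *: (F i * F j) + lsum q (fword F) tl.
Proof.
move=> /Frel; rewrite /rel_lin !lsum_cons lsum_opp !lev1 /= => /eqP.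
rewrite !fword2 expr0z mulr1 scale1r mulN1r scaleNr addrA subr_eq0.
by rewrite subr_eq => /eqP ->; rewrite addrC.
Qed.

Lemma ruleP j i l : rule j i = Some l -> F j * F i = wev l.
Proof.
rewrite /rule; case E : [seq _ | _ <- _ & _] => [//|l' s] [<-] {l}.
have : l' \in [seq rel_rhs r | r <- rels & (r.1.1.1 == j) && (r.1.1.2 == i)].
  by rewrite E mem_head.
case/mapP=> -[[[j' i'] k] tl]; rewrite mem_filter /= => /andP[/andP[/eqP -> /eqP ->]].
move=> /rel_rhsP -> ->.
by rewrite wev_flat lsum_cons lev1 mul1r fword2.
Qed.

Lemma wev_red w : wev (wred w) = fword F w.
Proof.
elim: w => [|a w IH]; first exact: wev_one.
case: w IH => [|b w] IH; first exact: wev_one.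
have -> : wred [:: a, b & w] = if rule a b is Some l
    then wmul l [:: (1, (0, w))] else wmul (wlet a) (wred (b :: w)) by [].
case E : rule => [l|].
  by rewrite wev_mul wev_one -(ruleP E) fword_cons (fword_cons b) mulrA.
by rewrite wev_mul wev_let IH -fword_cons.
Qed.

Lemma wev_nf n l : wev (wnf n l) = wev l.
Proof.
elim: n l => // n IH l; rewrite [wnf _ _]/(wnf n _); rewrite IH gev_norm gev_flatten big_map.
apply: eq_bigr => t _; rewrite /wred1 wev_mul gev_cons gev_nil addr0 wev_red.
by rewrite /wev1 /= /fword big_nil -!scalerAl mul1r.
Qed.

Definition extend7 d (i : nat) : A := if i == 7%N then lsum q (fword F) d else F i.

Lemma wev_exp d w : wev (wexp d w) = fword (extend7 d) w.
Proof.
elim: w => [|i w IH]; first by rewrite wev_one /fword !big_nil.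
rewrite [wexp _ _]/= wev_mul IH /fword big_cons /extend7; case: eqP => _.
  by rewrite wev_flat.
by rewrite wev_let.
Qed.

Lemma wev_lexp d r : wev (lexp d r) = lsum q (fword (extend7 d)) r.
Proof.
rewrite /lexp gev_flatten big_map; apply: eq_bigr => p _.
rewrite wev_mul wev_exp wev_flat lsum_cons /lsum big_nil addr0.
by rewrite /fword big_nil -scalerAl mul1r.
Qed.

Lemma lexp_eqP n d r : wnf n (lexp d r) = [::] -> lsum q (fword (extend7 d)) r = 0.
Proof. by move=> e; rewrite -wev_lexp -(wev_nf n) e gev_nil. Qed.

End WordReflect.

(** * Normal words and their images *)

Section LRMorph.
Variables (K : fieldType) (A B : algType K) (phi : {lrmorphism A -> B}).
Lemma lrmorphD x y : phi (x + y) = phi x + phi y. Proof. exact: rmorphD. Qed.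
Lemma lrmorphB x y : phi (x - y) = phi x - phi y. Proof. exact: rmorphB. Qed.
Lemma lrmorphZ k x : phi (k *: x) = k *: phi x. Proof. exact: linearZZ. Qed.
Lemma lrmorphM x y : phi (x * y) = phi x * phi y. Proof. exact: rmorphM. Qed.
Lemma lrmorphX x n : phi (x ^+ n) = phi x ^+ n. Proof. exact: rmorphXn. Qed.
Lemma lrmorph_sum I (r : seq I) (G : I -> A) :
  phi (\sum_(i <- r) G i) = \sum_(i <- r) phi (G i).
Proof. exact: rmorph_sum. Qed.
End LRMorph.

Section Span.
Variables (K : fieldType) (A : algType K) (F : nat -> A).
Implicit Types (P Q : pred (seq nat)) (x y : A) (w v : seq nat).

Definition span_of P x := exists2 m : seq (K * seq nat),
  all (fun p => P p.2) m & x = \sum_(p <- m) p.1 *: fword F p.2.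

Lemma spn0 P : span_of P 0.
Proof. by exists [::]; rewrite ?big_nil. Qed.

Lemma spnD P x y : span_of P x -> span_of P y -> span_of P (x + y).
Proof.
case=> m mP -> [m' mP' ->]; exists (m ++ m'); first by rewrite all_cat mP.
by rewrite big_cat.
Qed.

Lemma spnZ P k x : span_of P x -> span_of P (k *: x).
Proof.
case=> m mP ->; exists [seq (k * p.1, p.2) | p <- m]; first by rewrite all_map.
by rewrite big_map scaler_sumr; apply: eq_bigr => p _; rewrite scalerA.
Qed.

Lemma spn_word P w : P w -> span_of P (fword F w).
Proof.
by move=> Pw; exists [:: (1, w)]; rewrite /= ?Pw // big_seq1 scale1r.
Qed.

Lemma spn_sub P (S : A -> Prop) x : span_of P x -> S 0 ->
    (forall y z, S y -> S z -> S (y + z)) -> (forall k y, S y -> S (k *: y)) ->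
  (forall w, P w -> S (fword F w)) -> S x.
Proof.
case=> m mP -> S0 SD SZ SP; elim: m mP => [|p m IH] /=; rewrite ?big_nil //.
by case/andP=> Pp /IH Sm; rewrite big_cons; apply: SD => //; apply/SZ/SP.
Qed.

Lemma spn_spn P Q x : span_of P x -> (forall w, P w -> span_of Q (fword F w)) -> span_of Q x.
Proof.
move=> Px; apply: (spn_sub Px); [exact: spn0 | exact: spnD | exact: spnZ].
Qed.

Lemma spnM P Q x w v : span_of P x -> (forall u, P u -> Q (w ++ u ++ v)) ->
  span_of Q (fword F w * x * fword F v).
Proof.
move=> Px PQ; apply: (spn_sub Px (S := fun x => span_of Q (_ * x * _))).
- by rewrite mulr0 mul0r; apply: spn0.
- by move=> y z; rewrite mulrDr mulrDl; apply: spnD.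
- by move=> k y; rewrite -scalerAr -scalerAl; apply: spnZ.
- by move=> u /PQ Qu; rewrite -mulrA -!fword_cat; apply: spn_word.
Qed.

Lemma spn_uniq P x : span_of P x -> exists s (c : seq nat -> K),
  [/\ uniq s, all P s, {in s, forall w, c w != 0}
    & x = \sum_(w <- s) c w *: fword F w].
Proof.
case=> m mP ->; pose c w := \sum_(p <- m | p.2 == w) p.1.
pose s := undup [seq p.2 | p <- m].
exists [seq w <- s | c w != 0], c; split.
- by rewrite filter_uniq ?undup_uniq.
- apply/allP => w; rewrite mem_filter mem_undup => /andP[_ /mapP[p pm ->]].
  exact: (allP mP).
- by move=> w; rewrite mem_filter => /andP[].
rewrite big_filter (big_mkcond (fun w => c w != 0)).
transitivity (\sum_(w <- s) c w *: fword F w); last first.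
  by apply: eq_bigr => w _; case: eqP => //= ->; rewrite scale0r.
transitivity (\sum_(w <- s) \sum_(p <- m | p.2 == w) p.1 *: fword F p.2); last first.
  apply: eq_bigr => w _; rewrite /c scaler_suml.
  by apply: eq_bigr => p /eqP ->.
transitivity (\sum_(w <- s) \sum_(p <- m)
    (if p.2 == w then p.1 *: fword F p.2 else 0)); last first.
  by apply: eq_bigr => w _; rewrite -big_mkcond.
rewrite exchange_big; apply: eq_big_seq => p pm.
rewrite -big_mkcond (eq_bigl (pred1 p.2)); last by move=> w; rewrite eq_sym.
rewrite -big_filter filter_pred1_uniq ?undup_uniq ?big_seq1 //.
by rewrite mem_undup map_f.
Qed.

End Span.

Section Rewriting.
Variables (K : fieldType) (A : algType K) (F : nat -> A).
Variables (L : seq nat) (wt : nat -> nat) (exs : seq (seq nat)).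

Definition wwt (w : seq nat) : nat := sumn (map wt w).
Definition low d w := all (mem L) w && (wwt w < d)%N.
Definition submset (e w : seq nat) :=
  all (fun i => count_mem i e <= count_mem i w)%N e.
Definition normal w := [&& all (mem L) w, sorted leq w &
  all (fun e => ~~ submset e w) exs].

Hypothesis Fsort : forall i j, i \in L -> j \in L -> (i < j)%N -> exists2 c : K,
  c != 0 & span_of F (low (wt i + wt j)) (F j * F i - c *: (F i * F j)).
Hypothesis Fex : forall e, e \in exs -> all (mem L) e /\ span_of F (low (wwt e)) (fword F e).

Lemma wwt_cat w v : wwt (w ++ v) = (wwt w + wwt v)%N.
Proof. by rewrite /wwt map_cat sumn_cat. Qed.

Lemma wwt_cons i w : wwt (i :: w) = (wt i + wwt w)%N.
Proof. by []. Qed.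

Lemma low_cat d e w v u : all (mem L) w -> all (mem L) v ->
  (d + wwt w + wwt v <= e)%N -> low d u -> low e (w ++ u ++ v).
Proof.
move=> Lw Lv de /andP[Lu ud]; rewrite /low !all_cat Lw Lv Lu !wwt_cat /=; lia.
Qed.

Lemma swapP a b : a \in L -> b \in L ->
  exists c : K, span_of F (low (wt a + wt b)) (F a * F b - c *: (F b * F a)).
Proof.
move=> La Lb; case: (ltngtP a b) => [ab|ba|<-].
- have [c c0 h] := Fsort La Lb ab; exists c^-1.
  have -> : F a * F b - c^-1 *: (F b * F a) = - c^-1 *: (F b * F a - c *: (F a * F b)).
    by rewrite scalerBr scalerA mulNr mulVf // scaleN1r scaleNr opprK addrC.
  exact: spnZ.
- by have [c _ h] := Fsort Lb La ba; exists c; rewrite addnC.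
- by exists 1; rewrite scale1r subrr; apply: spn0.
Qed.

Definition cong w v := exists c : K, span_of F (low (wwt w)) (fword F w - c *: fword F v).

Lemma cong_trans w v u : wwt w = wwt v -> cong w v -> cong v u -> cong w u.
Proof.
move=> e [c h] [c' h']; exists (c * c').
have -> : fword F w - (c * c') *: fword F u =
    (fword F w - c *: fword F v) + c *: (fword F v - c' *: fword F u).
  by rewrite scalerBr scalerA addrA subrK.
by apply: spnD => //; apply: spnZ; rewrite e.
Qed.

Lemma cong_refl w : cong w w.
Proof. by exists 1; rewrite scale1r subrr; apply: spn0. Qed.

Lemma cong_cons x w v : x \in L -> cong w v -> cong (x :: w) (x :: v).
Proof.
move=> Lx [c h]; exists c.
rewrite !fword_cons scalerAr -mulrBr -(fword1 F x) -[X in span_of _ _ X]mulr1.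
have -> : 1 = fword F [::] by rewrite /fword big_nil.
apply: (spnM h) => u; apply: low_cat; rewrite /= ?Lx //.
by rewrite !wwt_cons /wwt /=; lia.
Qed.

Lemma cong_swap a b w : a \in L -> b \in L -> all (mem L) w ->
  cong [:: a, b & w] [:: b, a & w].
Proof.
move=> La Lb Lw; have [c h] := swapP La Lb; exists c.
rewrite !fword_cons !mulrA scalerAl -mulrBl -[X in span_of _ _ (X * _)]mul1r.
have -> : 1 = fword F [::] by rewrite /fword big_nil.
apply: (spnM h) => u; apply: low_cat => //.
by rewrite !wwt_cons /wwt /=; lia.
Qed.

Lemma cong_move x v1 v2 : x \in L -> all (mem L) (v1 ++ v2) ->
  cong (x :: v1 ++ v2) (v1 ++ x :: v2).
Proof.
move=> Lx; elim: v1 => [|a v1 IH] /=; first by move=> _; apply: cong_refl.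
case/andP=> La Lv; apply: (@cong_trans _ [:: a, x & v1 ++ v2]).
- by rewrite !wwt_cons addnCA.
- exact: cong_swap.
- by apply: cong_cons => //; apply: IH.
Qed.

Lemma wwt_perm w v : perm_eq w v -> wwt w = wwt v.
Proof. by move=> wv; apply/perm_sumn/perm_map. Qed.

Lemma cong_perm w v : all (mem L) w -> perm_eq w v -> cong w v.
Proof.
elim: w v => [|x w IH] v /=.
  by move=> _; rewrite perm_sym => /perm_nilP ->; apply: cong_refl.
case/andP=> Lx Lw xwv.
have xv : x \in v by rewrite -(perm_mem xwv) mem_head.
case/splitPr: xv xwv => v1 v2 xwv.
have wv : perm_eq w (v1 ++ v2).
  by rewrite -(perm_cons x); apply: (perm_trans xwv); rewrite perm_catC /= perm_cons perm_catC.
apply: (@cong_trans _ (x :: v1 ++ v2)).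
- by apply: wwt_perm; rewrite perm_cons.
- by apply: cong_cons => //; apply: IH.
- by apply: cong_move => //; rewrite -(perm_all _ wv).
Qed.

Lemma submset_perm e w : submset e w -> exists v, perm_eq w (e ++ v).
Proof.
move=> /allP ew; have : forall x, (count_mem x e <= count_mem x w)%N.
  move=> x; case: (boolP (x \in e)) => [/ew //|/count_memPn -> //].
case/count_subseqP=> e' /perm_to_subseq[v wv] ee'; exists v.
by apply: (perm_trans wv); rewrite perm_cat2r perm_sym.
Qed.

Lemma low_normal d w : low d w -> span_of F normal (fword F w).
Proof.
elim: d w => [|d IH] w /andP[Lw wd] //.
have red v c : span_of F (low (wwt w)) (fword F w - c *: fword F v) ->
    span_of F normal (c *: fword F v) -> span_of F normal (fword F w).
  move=> h hv; rewrite -(subrK (c *: fword F v) (fword F w)); apply: spnD => //.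
  apply: (spn_spn h) => u /andP[Lu ud]; apply: IH; rewrite /low Lu /=; lia.
case: (boolP (all (fun e => ~~ submset e w) exs)) => [exw|].
  have ws : perm_eq w (sort leq w) by rewrite perm_sym perm_sort.
  have [c h] := cong_perm Lw ws; apply: (red _ _ h); apply/spnZ/spn_word.
  rewrite /normal -(perm_all _ ws) Lw (sort_sorted leq_total w) /=.
  apply/allP => e /(allP exw); apply: contra => /allP he; apply/allP => i ie.
  by move/permP: ws => ->; apply: he.
rewrite -has_predC => /hasP[e ein /negbNE sub].
have [v wv] := submset_perm sub; have [c h] := cong_perm Lw wv.
apply: (red _ _ h); apply: spnZ.
have [Le he] := Fex ein.
have Lv : all (mem L) v by move: Lw; rewrite (perm_all _ wv) all_cat => /andP[].
have hev : span_of F (low (wwt w)) (fword F (e ++ v)).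
  rewrite fword_cat -[fword F e]mul1r.
  have -> : 1 = fword F [::] by rewrite /fword big_nil.
  apply: (spnM he) => u; apply: low_cat => //.
  by rewrite (wwt_perm wv) wwt_cat /wwt /=; lia.
apply: (spn_spn hev) => u /andP[Lu ud]; apply: IH; rewrite /low Lu /=; lia.
Qed.

Lemma normal_span w : all (mem L) w -> span_of F normal (fword F w).
Proof. by move=> Lw; apply: (@low_normal (wwt w).+1); rewrite /low Lw /=. Qed.

End Rewriting.

Section Independence.
Variables (K : fieldType) (q : K) (q0 : q != 0) (c : Z6) (A : algType K).
Variables (F : nat -> A) (phi : {lrmorphism A -> qtorus q0 c}).
Variables (L : seq nat) (P : pred (seq nat)) (f : Z4 -> int) (top : nat -> Z4).
Hypothesis fD : forall g h, f (g + h) = f g + f h.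
Hypothesis PL : forall w, P w -> all (mem L) w.
Hypothesis Ftop : forall i, i \in L -> tlead f (phi (F i)) (top i).

Definition wtop (w : seq nat) : Z4 := \sum_(i <- w) top i.
Hypothesis wtop_inj : forall w v, P w -> P v -> wtop w = wtop v -> w = v.

Lemma fword_top w : all (mem L) w -> tlead f (phi (fword F w)) (wtop w).
Proof.
elim: w => [_|i w IH /= /andP[Li /IH Lw]].
  by rewrite /fword /wtop !big_nil rmorph1; apply: tlead1.
rewrite fword_cons rmorphM /wtop big_cons; apply: tleadM => //; exact: Ftop.
Qed.

Lemma seq_argmax (T : eqType) (h : T -> int) (s : seq T) : s != [::] ->
  exists2 a, a \in s & {in s, forall b, h b <= h a}.
Proof.
elim: s => // u s IH _; case: (eqVneq s [::]) => [->|s0].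
  by exists u; rewrite ?mem_head // => g; rewrite inE => /eqP ->.
have [v vs vmax] := IH s0; case: (lerP (h u) (h v)) => uv.
  exists v => [|g]; first by rewrite inE vs orbT.
  by rewrite inE => /orP[/eqP ->//|/vmax].
exists u => [|g]; first exact: mem_head.
by rewrite inE => /orP[/eqP ->//|/vmax/le_trans]; apply; exact: ltW.
Qed.

Lemma span_inj x : span_of F P x -> phi x = 0 -> x = 0.
Proof.
case/spn_uniq=> s [k [us /allP Ps k0 ->]] px0.
case: (eqVneq s [::]) => [->|s0]; first by rewrite big_nil.
have [w ws wmax] := seq_argmax (fun w => f (wtop w)) s0.
case/negP: (k0 w ws); apply/eqP.
have lw := fword_top (PL (Ps _ ws)).
have := congr1 (fun z => tcf z (wtop w)) px0.
rewrite lrmorph_sum tcf_sum tcf0 (bigD1_seq w) //= lrmorphZ tcfZ big1_seq.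
  move=> e; apply/eqP; move/eqP: e; rewrite [X in X == _]addr0 mulf_eq0.
  by rewrite (negPf lw.1) orbF.
move=> v /andP[vw vs]; rewrite lrmorphZ tcfZ; apply/eqP; rewrite mulf_eq0.
have lv := fword_top (PL (Ps _ vs)).
apply/orP; right; apply: contrapT => /negP nz.
have wv : wtop w != wtop v.
  by apply: contra vw => /eqP /wtop_inj -> //; exact: Ps.
by have := lv.2 _ wv nz; rewrite ltNge wmax.
Qed.

End Independence.

(** * Injectivity of the first chart *)

Definition lin4 (a g : Z4) : int :=
  let: (a0, a1, a2, a3) := a in let: (g0, g1, g2, g3) := g in
  a0 * g0 + a1 * g1 + a2 * g2 + a3 * g3.

Lemma lin4D a g h : lin4 a (g + h) = lin4 a g + lin4 a h.
Proof.
move: a g h => [[[??]?]?] [[[??]?]?] [[[??]?]?].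
rewrite /lin4 /=; ring.
Qed.

(* [za] and [zb] allow discarding the terms divisible by a parameter which is zero. *)
Definition tdrop (za zb : bool) (l : seq tterm) : seq tterm :=
  [seq x <- l | (za ==> (x.2.1.2.1 == 0%N)) && (zb ==> (x.2.1.2.2 == 0%N))].
Definition topcheck (f : Z4) za zb (l : seq tterm) (g : Z4) : option (nat * nat) :=
  let l0 := tdrop za zb l in
  if [seq x <- l0 | x.2.2 == g] is [:: x] then
    if ((x.1 == 1) || (x.1 == -1)) &&
       all (fun y => lin4 f y.2.2 < lin4 f g) [seq x <- l0 | x.2.2 != g]
    then Some x.2.1.2 else None
  else None.

Section Tops.
Variables (K : fieldType) (q : K) (q0 : q != 0) (c : Z6) (al be : K).
Notation T := (qtorus q0 c).
Local Notation tev := (tev q0 c al be).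
Local Notation kev := (kev q0 c al be).

Lemma gev_filter (P : pred tterm) l :
  tev l = tev [seq x <- l | P x] + tev [seq x <- l | ~~ P x].
Proof.
elim: l => [|x l IH]; first by rewrite gev_nil [RHS]addr0.
rewrite gev_cons IH /=; case: ifP => _ /=; rewrite gev_cons.
  by rewrite -[RHS]addrA.
exact: addrCA.
Qed.

Lemma tev_lt (f : Z4 -> int) (l : seq tterm) g (d : int) :
  all (fun y : tterm => f y.2.2 < d) l -> tcf (tev l) g != 0 -> f g < d.
Proof.
elim: l => [|x l IH]; first by rewrite gev_nil tcf0 eqxx.
case/andP=> xd /IH IHl; rewrite gev_cons tcfD tcfZ tcfZ tcfM.
case: (eqVneq x.2.2 g) => [<- //|_].
by rewrite mulr0 mulr0 add0r.
Qed.

Lemma tdropP (za zb : bool) l : (za -> al = 0) -> (zb -> be = 0) -> tev l = tev (tdrop za zb l).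
Proof.
move=> ha hb; rewrite /tdrop; elim: l => // -[n [[k [a b]] g]] l IH.
rewrite gev_cons [filter _ _]/=; case: ifP => hx; first by rewrite gev_cons IH.
rewrite -IH; suff -> : kev (n, (k, (a, b), g)).2 = 0.
  by rewrite scaler0; exact: add0r.
rewrite /kev /=; apply: (etrans (congr1 (fun k : K => k *: _) (_ : _ = 0))); last exact: scale0r.
move: hx => /negbT; rewrite negb_and !negb_imply => /orP[/andP[/ha -> a0]|/andP[/hb -> b0]].
  by rewrite expr0n (negPf a0) mulr0 mul0r.
by rewrite [X in _ * X]expr0n (negPf b0) mulr0.
Qed.

Lemma topcheckP f (za zb : bool) l g a b : (za -> al = 0) -> (zb -> be = 0) ->
  topcheck f za zb l g = Some (a, b) -> al ^+ a * be ^+ b != 0 ->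
  tlead (lin4 f) (tev l) g.
Proof.
move=> ha hb; rewrite (tdropP l ha hb) /topcheck; move: (tdrop _ _ _) => {}l.
case E : [seq _ <- _ | _] => [//|[n [[k ab] g']] [|//]]; case: ifP => // /andP[/= n1 lt] [eab] nz.
rewrite /= in eab; subst ab.
have {E} eg : g' = g /\ tev [seq x <- l | x.2.2 == g] = n%:~R *: kev (k, (a, b), g').
  have : (n, (k, (a, b), g')) \in [seq x <- l | x.2.2 == g] by rewrite E mem_head.
  rewrite mem_filter => /andP[/eqP /= eg _]; split=> //.
  by rewrite E gev_cons gev_nil; exact: addr0.
case: eg => -> e; rewrite (gev_filter (fun x => x.2.2 == g)) e.
set k1 := n%:~R * (q ^ k * al ^+ a * be ^+ b).
have k1n : k1 != 0.
  rewrite /k1 -mulrA mulf_neq0 //; last by rewrite mulf_neq0 ?expfz_neq0.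
  by case/orP: n1 => /eqP ->; rewrite ?rmorphN ?oppr_eq0 oner_eq0.
have -> : n%:~R *: kev (k, (a, b), g) = k1 *: tmon q0 c g.
  exact: (scalerA n%:~R (q ^ k * al ^+ a * be ^+ b) (tmon q0 c g)).
have [lt1 lt2] := tleadZ k1n (tlead_mon q0 c (lin4 f) g).
have l0 h : tcf (tev [seq x <- l | x.2.2 != g]) h != 0 -> lin4 f h < lin4 f g.
  exact: (tev_lt (f := lin4 f)).
split=> [|h hg]; rewrite tcfD.
  suff /eqP -> : tcf (tev [seq x <- l | x.2.2 != g]) g == 0 by rewrite addr0.
  by apply: contraT => /l0; rewrite ltxx.
case: (eqVneq (tcf (k1 *: tmon q0 c g) h) 0) => [->|nz1 _]; last exact: lt2.
by rewrite add0r; apply: l0.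
Qed.

End Tops.

Section WordCounts.
Variables (L : seq nat).

Lemma sum_counts (V : zmodType) (G : nat -> V) w : uniq L -> all (mem L) w ->
  \sum_(i <- w) G i = \sum_(i <- L) G i *+ count_mem i w.
Proof.
move=> uL; elim: w => [_|a w IH /= /andP[La Lw]].
  by rewrite big_nil big1 // => i _; rewrite mulr0n.
rewrite big_cons IH // [in RHS](bigD1_seq a) //= eqxx mulrS -addrA; congr (_ + _).
rewrite (bigD1_seq a) //=; congr (_ + _); apply: eq_bigr => i ia.
by rewrite [a == i]eq_sym (negPf ia).
Qed.

Lemma sorted_counts w v : sorted leq w -> sorted leq v -> all (mem L) w -> all (mem L) v ->
  {in L, forall i, count_mem i w = count_mem i v} -> w = v.
Proof.
move=> sw sv /allP Lw /allP Lv e; apply: (sorted_eq leq_trans anti_leq sw sv).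
apply/permP; apply/permP/allP => i; rewrite mem_cat => iwv; apply/eqP/e.
by case/orP: iwv => [/Lw|/Lv].
Qed.

End WordCounts.

Definition lneg (r : seq (lau * seq nat)) := [seq ([seq (- x.1, x.2) | x <- p.1], p.2) | p <- r].
Definition one_word (w : seq nat) : seq (lau * seq nat) := [:: ([:: (1, 0)], w)].
Definition letter_weight (w7 i : nat) : nat :=
  nth 0%N [:: 0; 30; 40; 20; 30; 20; 40; w7]%N i.
Definition lin_low L wt d (r : seq (lau * seq nat)) := all (fun p => low L wt d p.2) r.

(* A row (e, tl, om) of an exclusion table is the identity e = tl + om in which
   om, an expression for some Omega_i or empty, equals a constant. *)
Definition sort_table_ok d L wt (tbl : seq (nat * nat * int * seq (lau * seq nat))) :=
  all (fun r => wnf 40 (lexp d (rel_lin r)) == [::]) tbl &&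
  all (fun j => all (fun i => (i < j)%N ==> has (fun r =>
    [&& r.1.1.1 == j, r.1.1.2 == i & lin_low L wt (wt i + wt j) r.2]) tbl) L) L.
Definition excluded_table_ok d L wt (exl : seq (seq nat * seq (lau * seq nat) * seq (lau * seq nat))) :=
  all (fun x => [&& wnf 40 (lexp d (one_word x.1.1 ++ lneg (x.1.2 ++ x.2))) == [::],
    all (mem L) x.1.1, (0 < wwt wt x.1.1)%N & lin_low L wt (wwt wt x.1.1) x.1.2]) exl.
Definition chart7 d i := if i == 7%N then llin G2_cocycle chart1 d else chart1 i.
Definition top_ok d (L : seq nat) (f : Z4) za zb (top : nat -> Z4) (al0 be0 : bool) :=
  all (fun i => if topcheck f za zb (chart7 d i) (top i) is Some (a, b)
     then ((a == 0%N) || al0) && ((b == 0%N) || be0) else false) L.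

Definition generated (K : fieldType) (A : algType K) (F : nat -> A) :=
  forall P : A -> Prop, P 1 -> (forall x y, P x -> P y -> P (x + y)) ->
    (forall k x, P x -> P (k *: x)) ->
    (forall i x, (0 < i <= 6)%N -> P x -> P (F i * x)) -> forall x, P x.

Section Evaluation.
Variables (K : fieldType) (q : K) (q0 : q != 0) (al be : K) (A : algType K).
Variables (F : nat -> A) (ch : nat -> seq tterm) (phi : {lrmorphism A -> qtorus q0 G2_cocycle}).
Hypothesis phiF : forall i, phi (F i) = tev q0 G2_cocycle al be (ch i).

Lemma phi_word w : phi (fword F w) = fword (fun i => tev q0 G2_cocycle al be (ch i)) w.
Proof.
by rewrite /fword rmorph_prod; apply: eq_bigr => i _; exact: phiF.
Qed.

Lemma phi_lsum r : phi (lsum q (fword F) r) = tev q0 G2_cocycle al be (llin G2_cocycle ch r).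
Proof.
rewrite tev_lin /lsum lrmorph_sum; apply: eq_bigr => p _.
by rewrite lrmorphZ phi_word.
Qed.

End Evaluation.

Section Injectivity.
Variables (K : fieldType) (q : K) (q0 : q != 0) (al be : K) (A : algType K).
Variables (F : nat -> A).
Hypothesis Frel : forall r, r \in rels -> lsum q (fword F) (rel_lin r) = 0.
Hypothesis FOm1 : lsum q (fword F) rel_Om1 = al%:A.
Hypothesis FOm2 : lsum q (fword F) rel_Om2 = be%:A.
Hypothesis Fgen : generated F.
Notation T := (qtorus q0 G2_cocycle).
Local Notation tev := (tev q0 G2_cocycle al be).
Variable phi : {lrmorphism A -> T}.
Hypothesis phiF : forall i, phi (F i) = tev (chart1 i).

Lemma lsum_cat (f : seq nat -> A) r s : lsum q f (r ++ s) = lsum q f r + lsum q f s.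
Proof. by rewrite /lsum big_cat. Qed.

Lemma lsum_one (f : seq nat -> A) w : lsum q f (one_word w) = f w.
Proof. by rewrite /lsum big_seq1 lev1 mul1r expr0z scale1r. Qed.

Lemma lsum_low (G : nat -> A) L wt d r : lin_low L wt d r ->
  span_of G (low L wt d) (lsum q (fword G) r).
Proof.
rewrite /lin_low; elim: r => [_|p r IH /= /andP[pl rl]].
  by rewrite /lsum big_nil; apply: spn0.
by rewrite lsum_cons; apply: spnD (IH rl); apply/spnZ/spn_word.
Qed.

Lemma inj_case d (L : seq nat) w7 tbl exl f (za zb : bool) (top : nat -> Z4) (al0 be0 : bool) :
  {subset [:: 1; 2; 3; 4; 5; 6]%N <= L} ->
  sort_table_ok d L (letter_weight w7) tbl -> excluded_table_ok d L (letter_weight w7) exl ->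
  all (fun x => [|| x.2 == [::], x.2 == rel_Om1 | x.2 == rel_Om2]) exl ->
  (za -> al = 0) -> (zb -> be = 0) -> (al0 -> al != 0) -> (be0 -> be != 0) ->
  top_ok d L f za zb top al0 be0 ->
  (forall w v, normal L [seq x.1.1 | x <- exl] w -> normal L [seq x.1.1 | x <- exl] v ->
     wtop top w = wtop top v -> w = v) ->
  forall x, phi x = 0 -> x = 0.
Proof.
set wt := letter_weight w7; set G := extend7 q F d.
move=> sL /andP[/allP tblP /allP sortP] /allP exP /allP omP ha hb ha0 hb0 /allP topP winj x.
have GE i : (0 < i <= 6)%N -> G i = F i by rewrite /G /extend7; case: eqP => // ->.
have nfP r : wnf 40 (lexp d r) = [::] -> lsum q (fword G) r = 0.
  by move=> e; apply: (lexp_eqP q0 Frel e).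
have lsumE r : {in r, forall p, all (fun i => (0 < i <= 6)%N) p.2} ->
    lsum q (fword G) r = lsum q (fword F) r.
  move=> rP; rewrite /lsum; apply: eq_big_seq => p /rP /allP ps; congr (_ *: _).
  by rewrite /fword; apply: eq_big_seq => i /ps; apply: GE.
have Gsort i j : i \in L -> j \in L -> (i < j)%N -> exists2 c : K,
    c != 0 & span_of G (low L wt (wt i + wt j)) (G j * G i - c *: (G i * G j)).
  move=> Li Lj ij; have := allP (sortP j Lj) i Li; rewrite ij /=.
  case/hasP=> [[[[j' i'] k] tl] rin /= /and3P[/eqP ej /eqP ei tlow]]; subst j' i'.
  exists (q ^ k); first exact: expfz_neq0.
  have /eqP/nfP := tblP _ rin; rewrite /rel_lin !lsum_cons lsum_opp !lev1 /=.
  rewrite !fword2 expr0z mulr1 scale1r mulN1r scaleNr addrA => /eqP.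
  by rewrite subr_eq0 => /eqP ->; apply: lsum_low.
have Gex e : e \in [seq x.1.1 | x <- exl] ->
    all (mem L) e /\ span_of G (low L wt (wwt wt e)) (fword G e).
  case/mapP=> -[[e' tl] om] ein /= ->{e}.
  have h : [&& wnf 40 (lexp d (one_word e' ++ lneg (tl ++ om))) == [::],
    all (mem L) e', (0 < wwt wt e')%N & lin_low L wt (wwt wt e') tl] := exP _ ein.
  case/and4P: h => /eqP/nfP.
  rewrite lsum_cat lsum_one lsum_opp lsum_cat => /eqP; rewrite subr_eq0 => /eqP -> Le e0 tlow.
  split=> //; apply: spnD; first exact: lsum_low.
  have s1 k : span_of G (low L wt (wwt wt e')) k%:A.
    apply: spnZ; have -> : 1 = fword G [::] by rewrite /fword big_nil.
    by apply: spn_word; rewrite /low /wwt.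
  case/or3P: (omP _ ein) => /eqP /= ->.
  - by rewrite /lsum big_nil; apply: spn0.
  - by rewrite lsumE ?FOm1 //; apply/allP.
  - by rewrite lsumE ?FOm2 //; apply/allP.
have Gtop i : i \in L -> tlead (lin4 f) (phi (G i)) (top i).
  move=> /topP; case E : topcheck => [[a b]|] // /andP[ha1 hb1].
  have -> : phi (G i) = tev (chart7 d i).
    by rewrite /G /extend7 /chart7; case: eqP => _; [rewrite (phi_lsum phiF) | rewrite phiF].
  apply: (topcheckP q0 G2_cocycle ha hb E); rewrite mulf_neq0 //.
    by case/orP: ha1 => [/eqP ->|/ha0 a1]; rewrite ?expr0 ?oner_eq0 // expf_neq0.
  by case/orP: hb1 => [/eqP ->|/hb0 a1]; rewrite ?expr0 ?oner_eq0 // expf_neq0.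
apply: (@span_inj _ _ _ _ _ G phi L (normal L [seq x.1.1 | x <- exl]) (lin4 f) top) => //.
- exact: lin4D.
- by move=> w /and3P[].
have : span_of G (fun w => all (mem L) w) x.
  apply: Fgen x; [ | exact: spnD | exact: spnZ | ].
    have -> : 1 = fword G [::] by rewrite /fword big_nil.
    exact: spn_word.
  move=> i x hi hx; have Li : i \in L.
    by apply: sL; case: i hi => [|[|[|[|[|[|[|]]]]]]].
  rewrite -(GE i hi) -(fword1 G i) -[X in span_of _ _ X]mulr1.
  have -> : 1 = fword G [::] by rewrite /fword big_nil.
  by apply: (spnM hx) => u Lu; rewrite cats0 /= Li.
move=> hx; apply: (spn_spn hx) => w Lw; exact: (normal_span Gsort Gex).
Qed.

End Injectivity.

(* For beta = 0 the images of F_2 F_4 and F_3^3 have the same leading exponent, and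
   their difference W is added as a seventh letter; for alpha = 0 the same holds
   for F_1 F_3 and F_2, with difference V. *)
Definition Wlin : seq (lau * seq nat) :=
  [:: ([:: (1, 0)], [:: 2; 4]%N); ([:: (-1, 0)], [:: 3; 3; 3]%N)].
Definition Vlin : seq (lau * seq nat) :=
  [:: ([:: (1, 0)], [:: 1; 3]%N); ([:: (-1, 0)], [:: 2]%N)].
Definition relsW : seq (nat * nat * int * seq (lau * seq nat)) :=
  [:: (7%N, 1%N, -3, [:: ]);
      (7%N, 2%N, -3, [:: ]);
      (7%N, 3%N, 0, [:: ]);
      (7%N, 4%N, 3, [:: ]);
      (7%N, 5%N, 3, [:: ]);
      (7%N, 6%N, 0, [:: ([:: (-1, -6); (1, 0)], [:: 2; 5; 5; 5]%N); ([:: (1, -13); (1, -11); (1, -9); (-1, -7); (-1, -5); (-1, -3)], [:: 3; 3; 5; 5]%N); ([:: (-1, -15); (-1, -13); (-1, -11); (1, -9); (1, -7); (1, -5)], [:: 3; 4; 5]%N); ([:: (1, -12); (-1, -6)], [:: 4; 4]%N)])].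
Definition relsV : seq (nat * nat * int * seq (lau * seq nat)) :=
  [:: (7%N, 1%N, -1, [:: ]);
      (7%N, 2%N, 0, [:: ]);
      (7%N, 3%N, 1, [:: ]);
      (7%N, 4%N, 3, [:: ]);
      (7%N, 5%N, 0, [:: ([:: (-1, -2); (1, 0)], [:: 1; 4]%N); ([:: (1, -5); (-1, -3)], [:: 3; 3]%N)]);
      (7%N, 6%N, -3, [:: ([:: (1, -17); (1, -15); (-1, -11); (-1, -9)], [:: 3; 5]%N); ([:: (-1, -17); (1, -11)], [:: 4]%N); ([:: (-1, -9); (1, -3)], [:: 1; 5; 5]%N)])].
Definition exsG : seq (seq nat * seq (lau * seq nat) * seq (lau * seq nat)) :=
  [:: ([:: 1; 3; 5]%N, [:: ([:: (1, 0)], [:: 1; 4]%N); ([:: (1, 0)], [:: 2; 5]%N); ([:: (-1, -3)], [:: 3; 3]%N)], rel_Om1);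
      ([:: 2; 4; 6]%N, [:: ([:: (1, 0)], [:: 2; 5; 5; 5]%N); ([:: (1, 0)], [:: 3; 3; 3; 6]%N); ([:: (-1, -7); (-1, -5); (-1, -3)], [:: 3; 3; 5; 5]%N); ([:: (1, -9); (1, -7); (1, -5)], [:: 3; 4; 5]%N); ([:: (-1, -6)], [:: 4; 4]%N)], rel_Om2)].
Definition exsW : seq (seq nat * seq (lau * seq nat) * seq (lau * seq nat)) :=
  [:: ([:: 1; 3; 5]%N, [:: ([:: (1, 0)], [:: 1; 4]%N); ([:: (1, 0)], [:: 2; 5]%N); ([:: (-1, -3)], [:: 3; 3]%N)], rel_Om1);
      ([:: 2; 4]%N, [:: ([:: (1, 0)], [:: 7]%N); ([:: (1, 0)], [:: 3; 3; 3]%N)], [::]);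
      ([:: 6; 7]%N, [:: ([:: (1, -6)], [:: 2; 5; 5; 5]%N); ([:: (-1, -13); (-1, -11); (-1, -9)], [:: 3; 3; 5; 5]%N); ([:: (1, -15); (1, -13); (1, -11)], [:: 3; 4; 5]%N); ([:: (-1, -12)], [:: 4; 4]%N)], rel_Om2)].
Definition exsV : seq (seq nat * seq (lau * seq nat) * seq (lau * seq nat)) :=
  [:: ([:: 2; 4; 6]%N, [:: ([:: (1, 0)], [:: 2; 5; 5; 5]%N); ([:: (1, 0)], [:: 3; 3; 3; 6]%N); ([:: (-1, -7); (-1, -5); (-1, -3)], [:: 3; 3; 5; 5]%N); ([:: (1, -9); (1, -7); (1, -5)], [:: 3; 4; 5]%N); ([:: (-1, -6)], [:: 4; 4]%N)], rel_Om2);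
      ([:: 1; 3]%N, [:: ([:: (1, 0)], [:: 7]%N); ([:: (1, 0)], [:: 2]%N)], [::]);
      ([:: 5; 7]%N, [:: ([:: (1, -2)], [:: 1; 4]%N); ([:: (-1, -5)], [:: 3; 3]%N)], rel_Om1)].

Definition top_of (t1 t2 t7 : Z4) (i : nat) : Z4 :=
  nth 0 [:: 0; t1; t2; (1, 0, 0, 0); (0, 1, 0, 0); (0, 0, 1, 0); (0, 0, 0, 1); t7] i.

Definition L6 := [:: 1; 2; 3; 4; 5; 6]%N.
Definition L7 := [:: 1; 2; 3; 4; 5; 6; 7]%N.

Lemma normal_inj (L : seq nat) (exs : seq (seq nat)) (top : nat -> Z4) : uniq L ->
  (forall n m : nat -> nat,
     all (fun e => ~~ all (fun i => count_mem i e <= n i)%N e) exs ->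
     all (fun e => ~~ all (fun i => count_mem i e <= m i)%N e) exs ->
     \sum_(i <- L) top i *+ n i = \sum_(i <- L) top i *+ m i ->
     {in L, forall i, n i = m i}) ->
  forall w v, normal L exs w -> normal L exs v -> wtop top w = wtop top v -> w = v.
Proof.
move=> uL H w v /and3P[Lw sw ew] /and3P[Lv sv ev].
rewrite /wtop (sum_counts _ uL Lw) (sum_counts _ uL Lv) => e.
exact: (sorted_counts sw sv Lw Lv (H (fun i => count_mem i w) (fun i => count_mem i v) ew ev e)).
Qed.

Lemma tupM (a b c d : int) n :
  ((a, b, c, d) : Z4) *+ n = (a * n%:Z, b * n%:Z, c * n%:Z, d * n%:Z).
Proof.
elim: n => [|n IH]; first by rewrite mulr0n !mulr0.
by rewrite mulrS IH !intS !mulrDr !mulr1.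
Qed.

Lemma tupD (a b c d a' b' c' d' : int) :
  ((a, b, c, d) : Z4) + (a', b', c', d') = (a + a', b + b', c + c', d + d').
Proof. by []. Qed.

Ltac cone_tac :=
  let n := fresh "n" in let m := fresh "m" in let nP := fresh in let mP := fresh in
  let e := fresh in
  move=> n m nP mP; rewrite !big_cons !big_nil !tupM ?addr0 !tupD => e;
  case: e => ? ? ? ?; move: nP mP; rewrite /= ?andbT => nP mP;
  let i := fresh "i" in
  move=> i; rewrite !inE;
  repeat (case/orP; [move=> /eqP ->; lia|]); move=> /eqP ->; lia.

Lemma coneG : forall w v, normal L6 [seq x.1.1 | x <- exsG] w ->
  normal L6 [seq x.1.1 | x <- exsG] v ->
  wtop (top_of (-1, 0, -1, 0) (0, -1, 0, -1) 0) w =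
  wtop (top_of (-1, 0, -1, 0) (0, -1, 0, -1) 0) v -> w = v.
Proof. apply: normal_inj => //; rewrite /L6 /top_of /=. cone_tac. Qed.
Lemma coneW : forall w v, normal L7 [seq x.1.1 | x <- exsW] w ->
  normal L7 [seq x.1.1 | x <- exsW] v ->
  wtop (top_of (-1, 0, -1, 0) (3, -1, 0, 0) (3, -1, 3, -1)) w =
  wtop (top_of (-1, 0, -1, 0) (3, -1, 0, 0) (3, -1, 3, -1)) v -> w = v.
Proof. apply: normal_inj => //; rewrite /L7 /top_of /=. cone_tac. Qed.
Lemma coneV : forall w v, normal L7 [seq x.1.1 | x <- exsV] w ->
  normal L7 [seq x.1.1 | x <- exsV] v ->
  wtop (top_of (-1, -1, 0, -1) (0, -1, 0, -1) (-1, 0, -1, -1)) w =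
  wtop (top_of (-1, -1, 0, -1) (0, -1, 0, -1) (-1, 0, -1, -1)) v -> w = v.
Proof. apply: normal_inj => //; rewrite /L7 /top_of /=. cone_tac. Qed.

Section ChartInjective.
Variables (K : fieldType) (q : K) (q0 : q != 0) (al be : K) (A : algType K).
Variables (F : nat -> A).
Hypothesis ab0 : (al != 0) || (be != 0).
Hypothesis Frel : forall r, r \in rels -> lsum q (fword F) (rel_lin r) = 0.
Hypothesis FOm1 : lsum q (fword F) rel_Om1 = al%:A.
Hypothesis FOm2 : lsum q (fword F) rel_Om2 = be%:A.
Hypothesis Fgen : generated F.
Variable phi : {lrmorphism A -> qtorus q0 G2_cocycle}.
Hypothesis phiF : forall i, phi (F i) = tev q0 G2_cocycle al be (chart1 i).

Lemma phi_inj0 x : phi x = 0 -> x = 0.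
Proof.
move: x; case: (eqVneq al 0) ab0 => [a0 /= b0|a0 _].
  apply: (inj_case Frel FOm1 FOm2 Fgen phiF (d := Vlin) (L := L7) (w7 := 45)
    (tbl := rels ++ relsV) (exl := exsV) (f := (-6, -8, -1, 6)) (za := true) (zb := false)
    (top := top_of (-1, -1, 0, -1) (0, -1, 0, -1) (-1, 0, -1, -1))
    (al0 := false) (be0 := true)) => //; try by vm_compute.
  - by apply/allP.
  - exact: coneV.
case: (eqVneq be 0) => [b0|b0].
  apply: (inj_case Frel FOm1 FOm2 Fgen phiF (d := Wlin) (L := L7) (w7 := 65)
    (tbl := rels ++ relsW) (exl := exsW) (f := (-6, -8, -1, 6)) (za := false) (zb := true)
    (top := top_of (-1, 0, -1, 0) (3, -1, 0, 0) (3, -1, 3, -1))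
    (al0 := true) (be0 := false)) => //; try by vm_compute.
  - by apply/allP.
  - exact: coneW.
apply: (inj_case Frel FOm1 FOm2 Fgen phiF (d := [::]) (L := L6) (w7 := 0)
    (tbl := rels) (exl := exsG) (f := (-6, -8, -1, 8)) (za := false) (zb := false)
    (top := top_of (-1, 0, -1, 0) (0, -1, 0, -1) 0)
    (al0 := true) (be0 := true)) => //; try by vm_compute.
exact: coneG.
Qed.

Lemma phi_inj : injective phi.
Proof.
move=> x y e; apply/eqP; rewrite -subr_eq0; apply/eqP/phi_inj0.
by rewrite lrmorphB e subrr.
Qed.

End ChartInjective.

(** * Obstructions to divisibility *)

Definition ylin : seq (lau * seq nat) :=
  [:: ([:: (1, 0)], [:: 3; 5]%N); ([:: (-1, 0)], [:: 4]%N)].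
Definition Zlin : seq (lau * seq nat) :=
  [:: ([:: (1, 0)], [:: 4; 6]%N); ([:: (-1, 0)], [:: 5; 5; 5]%N)].

Section TwoTops.
Variables (K : fieldType) (q : K) (q0 : q != 0) (c : Z6).
Notation T := (qtorus q0 c).

(* The exponents h of x satisfy f_i(h) <= f_i(g) - f_i(z_i) for i = 1, 2, so those of
   x z have (f_1 + f_2)-degree less than that of g. *)
Lemma two_tops (f1 f2 : Z4) (x z : T) g z1 z2 :
  tlead (lin4 f1) (x * z) g -> tlead (lin4 f2) (x * z) g ->
  tlead (lin4 f1) z z1 -> tlead (lin4 f2) z z2 ->
  ~ (forall h, tcf z h != 0 -> lin4 f1 h + lin4 f2 h < lin4 f1 z1 + lin4 f2 z2).
Proof.
move=> g1 g2 l1 l2 lt.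
have [a [b [e xa zb]]] := tcf_mul_neq0 g1.1.
have := tdeg_quot (lin4D f1) g1 l1 erefl xa.
have := tdeg_quot (lin4D f2) g2 l2 erefl xa.
have := lt b zb; rewrite e !lin4D; lia.
Qed.

End TwoTops.

Definition two_ok (f1 f2 : Z4) (z : seq tterm) (z1 z2 : Z4) :=
  all (fun t => lin4 f1 t.2.2 + lin4 f2 t.2.2 < lin4 f1 z1 + lin4 f2 z2) z.

Section NonUnits.
Variables (K : fieldType) (q : K) (q0 : q != 0) (al be : K) (A : algType K).
Variables (F : nat -> A) (psi : {lrmorphism A -> qtorus q0 G2_cocycle}).
Hypothesis psiF : forall i, psi (F i) = tev q0 G2_cocycle al be (chart2 i).
Let y := lsum q (fword F) ylin.
Let Z := lsum q (fword F) Zlin.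

Lemma psi_top f r g a b : topcheck f false false (llin G2_cocycle chart2 r) g = Some (a, b) ->
  al ^+ a * be ^+ b != 0 -> tlead (lin4 f) (psi (lsum q (fword F) r)) g.
Proof. by rewrite (phi_lsum psiF); apply: topcheckP. Qed.

Lemma psi_top0 f r g : topcheck f false false (llin G2_cocycle chart2 r) g = Some (0, 0)%N ->
  tlead (lin4 f) (psi (lsum q (fword F) r)) g.
Proof. by move=> h; apply: (psi_top h); rewrite !expr0 mulr1 oner_eq0. Qed.

Lemma psi_topX f r g n : tlead (lin4 f) (psi (lsum q (fword F) r)) g ->
  tlead (lin4 f) (psi (lsum q (fword F) r ^+ n)) (g *+ n).
Proof. by rewrite lrmorphX; apply/tleadX/lin4D. Qed.

Lemma lsum_let (G : nat -> A) i : lsum q (fword G) (one_word [:: i]) = G i.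
Proof. by rewrite lsum_one fword1. Qed.

Lemma psi_two f1 f2 r z1 z2 x p g :
  two_ok f1 f2 (llin G2_cocycle chart2 r) z1 z2 ->
  tlead (lin4 f1) (psi (lsum q (fword F) r)) z1 ->
  tlead (lin4 f2) (psi (lsum q (fword F) r)) z2 ->
  tlead (lin4 f1) (psi p) g -> tlead (lin4 f2) (psi p) g ->
  x * lsum q (fword F) r <> p.
Proof.
move=> ok l1 l2 g1 g2 e; move: g1 g2; rewrite -e lrmorphM => g1 g2.
apply: (two_tops g1 g2 l1 l2) => h; rewrite (phi_lsum psiF).
exact: (tev_lt (f := fun h => lin4 f1 h + lin4 f2 h)).
Qed.

Lemma F6_nondiv x m n k : x * F 6%N <> y ^+ m * Z ^+ n * F 5%N ^+ k.
Proof.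
rewrite -(lsum_let F 6) -(lsum_let F 5).
apply: (@psi_two (-6, -4, 1, 7) (-6, -3, -1, 7) _ (-3, 1, 0, 0) (0, 0, -3, 2) _ _
  ((-1, 1, -1, 1) *+ m + (-3, 2, -3, 2) *+ n + (-2, 1, 0, 0) *+ k)).
- by vm_compute.
- by apply: psi_top0; vm_compute.
- by apply: psi_top0; vm_compute.
all: rewrite !lrmorphM; apply: (tleadM (lin4D _)); first (apply: (tleadM (lin4D _))).
all: by apply: psi_topX; apply: psi_top0; vm_compute.
Qed.

Lemma F5_nondiv x m n : x * F 5%N <> y ^+ m * Z ^+ n * F 4%N.
Proof.
rewrite -(lsum_let F 4) -(lsum_let F 5).
apply: (@psi_two (-6, -4, 0, 7) (-6, -5, -7, 7) _ (-2, 1, 0, 0) (0, 0, -1, 1) _ _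
  ((-1, 1, -1, 1) *+ m + (-3, 2, -3, 2) *+ n + (-3, 2, 0, 0))).
- by vm_compute.
- by apply: psi_top0; vm_compute.
- by apply: psi_top0; vm_compute.
all: rewrite !lrmorphM; apply: (tleadM (lin4D _)); first (apply: (tleadM (lin4D _))).
all: try apply: psi_topX; apply: psi_top0; vm_compute; reflexivity.
Qed.

Lemma Z_nondiv x m : be != 0 -> x * Z <> y ^+ m.
Proof.
move=> b0; apply: (@psi_two (-6, -7, -7, 7) (-5, 1, 7, 7) _ (-3, 2, -3, 2) (0, -2, 3, -1) _ _
  ((-1, 1, -1, 1) *+ m)).
- by vm_compute.
- by apply: psi_top0; vm_compute.
- have h : topcheck (-5, 1, 7, 7) false false (llin G2_cocycle chart2 Zlin) (0, -2, 3, -1) = Some (0, 1)%N.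
    by vm_compute.
  by apply: (psi_top h); rewrite expr0 expr1 mul1r.
- by apply: psi_topX; apply: psi_top0; vm_compute.
- by apply: psi_topX; apply: psi_top0; vm_compute.
Qed.

Lemma y_nonunit x : al != 0 -> x * y <> 1.
Proof.
move=> a0; apply: (@psi_two (-7, -7, -7, -7) (-7, -7, 1, -7) _ (-2, 1, -1, 0) (-1, 0, 0, 0) _ _ 0).
- by vm_compute.
- have h : topcheck (-7, -7, -7, -7) false false (llin G2_cocycle chart2 ylin) (-2, 1, -1, 0) = Some (1, 0)%N.
    by vm_compute.
  by apply: (psi_top h); rewrite expr0 expr1 mulr1.
- have h : topcheck (-7, -7, 1, -7) false false (llin G2_cocycle chart2 ylin) (-1, 0, 0, 0) = Some (1, 0)%N.
    by vm_compute.
  by apply: (psi_top h); rewrite expr0 expr1 mulr1.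
- by rewrite rmorph1; apply: tlead1.
- by rewrite rmorph1; apply: tlead1.
Qed.

End NonUnits.

(** * Derivations into the torus *)

HB.lock Definition tder (K : fieldType) (q : K) (q0 : q != 0) (c : Z6)
    (chi : Z4 -> K) (x : qtorus q0 c) : qtorus q0 c :=
  mlin (fun g => chi g *: tmon q0 c g) x.

Section LeibnizLinear.
Variables (K : fieldType) (B : algType K).

Lemma leibniz_linl k (x x' dx dx' y dy : B) :
  (k *: dx + dx') * y + (k *: x + x') * dy =
  k *: (dx * y + x * dy) + (dx' * y + x' * dy).
Proof. by rewrite !mulrDl -!scalerAl scalerDr addrACA. Qed.

Lemma leibniz_linr k (y y' dy dy' x dx : B) :
  dx * (k *: y + y') + x * (k *: dy + dy') =
  k *: (dx * y + x * dy) + (dx * y' + x * dy').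
Proof. by rewrite !mulrDr -!scalerAr scalerDr addrACA. Qed.

Lemma mul_linl k (x x' y : B) : (k *: x + x') * y = k *: (x * y) + x' * y.
Proof. by rewrite mulrDl scalerAl. Qed.

Lemma mul_linr k (x x' y : B) : y * (k *: x + x') = k *: (y * x) + y * x'.
Proof. by rewrite mulrDr scalerAr. Qed.

End LeibnizLinear.

Section TorusDerivations.
Variables (K : fieldType) (q : K) (q0 : q != 0) (c : Z6).
Notation T := (qtorus q0 c).
Notation t := (tmon q0 c).
Hypothesis qnroot : forall n, (0 < n)%N -> q ^+ n != 1.

Lemma qexp_inj (a b : int) : q ^ a = q ^ b -> a = b.
Proof.
have pos (m : int) : 0 < m -> q ^ m != 1.
  by case: m => // n n0; rewrite -exprnP; apply: qnroot.
move=> ab; have e : q ^ (a - b) = 1.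
  by rewrite expfzDr // ab -expfzDr // subrr.
have e' : q ^ (b - a) = 1.
  by rewrite -opprB -invr_expz e invr1.
apply/eqP; rewrite eq_le !leNgt; apply/andP; split; apply/negP => lt.
  by have := pos (a - b); rewrite subr_gt0 e eqxx => /(_ lt).
by have := pos (b - a); rewrite subr_gt0 e' eqxx => /(_ lt).
Qed.

Section Weight.
Variable chi : Z4 -> K.
Hypothesis chiD : forall g h, chi (g + h) = chi g + chi h.

Lemma tder_linear : linear (tder chi : T -> T).
Proof. by rewrite tder.unlock => k x y; exact: mlinP. Qed.

Lemma tderZ k (x : T) : tder chi (k *: x) = k *: tder chi x.
Proof. by rewrite tder.unlock; exact: mlinZ. Qed.

Lemma tderD (x y : T) : tder chi (x + y) = tder chi x + tder chi y.
Proof. by have := tder_linear 1 x y; rewrite !scale1r. Qed.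

Lemma tder_mon g : tder chi (t g) = chi g *: t g.
Proof. by rewrite tder.unlock tmon.unlock mlinU scale1r. Qed.

Lemma tderM (x y : T) : tder chi (x * y) = tder chi x * y + x * tder chi y.
Proof.
move: x; apply: (@eq_linear _ _ q0 c (fun x => tder chi (x * y))
  (fun x => tder chi x * y + x * tder chi y)) => [k x x'|k x x'|g].
- by rewrite mul_linl tder_linear.
- by rewrite tder_linear; exact: leibniz_linl.
move: y; apply: (@eq_linear _ _ q0 c (fun y => tder chi (t g * y))
  (fun y => tder chi (t g) * y + t g * tder chi y)) => [k y y'|k y y'|h].
- by rewrite mul_linr tder_linear.
- by rewrite tder_linear; exact: leibniz_linr.
rewrite !tder_mon tmonM tderZ tder_mon -(scalerAl (chi g)) -(scalerAr (chi h)) tmonM.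
by rewrite -scalerDl -chiD [LHS]scalerA [RHS]scalerA mulrC.
Qed.

End Weight.

Lemma tcf_ZMr (X : T) k g h :
  tcf (X * (k *: t g)) (h + g) = k * (tcf X h * q ^ kap c h g).
Proof. by rewrite tcf_mulZr tcfMr. Qed.

Lemma tcf_ZMl (X : T) k g h :
  tcf ((k *: t g) * X) (g + h) = k * (q ^ kap c g h * tcf X h).
Proof. by rewrite tcf_mulZl tcfMl. Qed.

(* [g 0, ..., g n.-1] separate the characters [om c h], so the exact sequence
   comparing the [X i] forces them to come from one element, up to scalars. *)
Lemma torus_inner (n : nat) (g : 'I_n -> Z4) (k : 'I_n -> K) (X : 'I_n -> T) :
  (forall i, k i != 0) ->
  (forall i j, X i * (k j *: t (g j)) + (k i *: t (g i)) * X j =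
     q ^ om c (g i) (g j) *: (X j * (k i *: t (g i)) + (k j *: t (g j)) * X i)) ->
  (forall h, h != 0 -> exists i, om c h (g i) != 0) ->
  exists (u : T) (wt : 'I_n -> K), forall i,
    X i = u * (k i *: t (g i)) - (k i *: t (g i)) * u + wt i *: (k i *: t (g i)).
Proof.
move=> k0 XX sep.
pose d h i := q ^ kap c h (g i) - q ^ kap c (g i) h.
have d0 h i : om c h (g i) != 0 -> d h i != 0.
  by apply: contra; rewrite subr_eq0 /om subr_eq0 => /eqP/qexp_inj ->.
have cross h i j : k j * tcf (X i) (h + g i) * d h j = k i * tcf (X j) (h + g j) * d h i.
  pose G := h + g i + g j.
  have e1 := tcf_ZMr (X i) (k j) (g j) (h + g i).
  have e2 := tcf_ZMl (X j) (k i) (g i) (h + g j).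
  have e3 := tcf_ZMr (X j) (k i) (g i) (h + g j).
  have e4 := tcf_ZMl (X i) (k j) (g j) (h + g i).
  have E2 : g i + (h + g j) = G by rewrite (addrA (g i)) (addrC (g i)).
  have E3 : h + g j + g i = G by rewrite -(addrA h) (addrC (g j)) (addrA h).
  have E4 : g j + (h + g i) = G by rewrite (addrC (g j)).
  rewrite E2 in e2; rewrite E3 in e3; rewrite E4 in e4.
  have e5 := etrans (esym (tcfD (X i * (k j *: t (g j))) _ G)) (etrans (congr1 (fun x : T => tcf x G) (XX i j))
    (etrans (tcfZ _ _ _) (congr1 _ (tcfD (X j * (k i *: t (g i))) _ G)))).
  have := etrans (congr2 +%R (esym e1) (esym e2)) (etrans e5 (congr1 _ (congr2 +%R e3 e4))).
  clear e1 e2 e3 e4 e5.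
  rewrite !kapDl !kapDr /d; move: (tcf (X i) _) (tcf (X j) _) => x y.
  have qD := fun a b => expfzDr a b q0.
  rewrite /om !qD -!invr_expz.
  move: (qz_neq0 q0 (kap c (g i) (g j))) (qz_neq0 q0 (kap c (g j) (g i))).
  move: (q ^ kap c (g i) (g j)) (q ^ kap c (g j) (g i)) (q ^ kap c h (g i))
    (q ^ kap c h (g j)) (q ^ kap c (g i) h) (q ^ kap c (g j) h) => A B a b a' b' A0 B0 e.
  apply: (mulfI A0); rewrite !mulrBr.
  apply/eqP; rewrite -subr_eq0; apply/eqP; move/eqP: e; rewrite -subr_eq0 => /eqP e.
  rewrite -[RHS]e; field.
  by rewrite ?A0 ?B0.
pose U h := if [pick i | om c h (g i) != 0] is Some i
            then tcf (X i) (h + g i) / (k i * d h i) else 0.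
have UE h i : h != 0 -> tcf (X i) (h + g i) = U h * k i * d h i.
  move=> h0; rewrite /U; case: pickP => [j dj|/= H]; last first.
    by have [j] := sep h h0; rewrite H.
  have kd : k j * d h j != 0 by rewrite mulf_neq0 ?d0.
  apply: (mulIf kd); have := cross h i j; move: kd; move: (tcf (X i) _) (tcf (X j) _) => x y kd e.
  rewrite mulrCA mulrA e; field.
  by rewrite d0 ?k0.
pose r := undup [seq h <- flatten [seq [seq s - g i | s <- tsupp (X i)] | i <- enum 'I_n] | h != 0].
pose u : T := \sum_(h <- r) U h *: t h.
have uE h : h != 0 -> tcf u h = U h.
  move=> h0; rewrite /u tcf_sum.
  transitivity (\sum_(i <- r) (U i * (i == h)%:R)).
    by apply: eq_bigr => i _; rewrite tcfZ tcfM.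
  case: (boolP (h \in r)) => hr.
    rewrite (bigD1_seq h hr (undup_uniq _)) /= eqxx mulr1 big1 ?addr0 // => i.
    by move=> /negPf ->; rewrite mulr0.
  rewrite big_seq big1 => [|i ir]; last first.
    by case: eqP => [ih|_]; rewrite ?mulr0 //; rewrite -ih ir in hr.
  rewrite /U; case: pickP => // i hi; suff -> : tcf (X i) (h + g i) = 0 by rewrite mul0r.
  apply: contraNeq hr; rewrite -tsuppP => hX; rewrite mem_undup mem_filter h0 /=.
  apply/flattenP; exists [seq s - g i | s <- tsupp (X i)].
    by apply: map_f; rewrite mem_enum.
  by apply/mapP; exists (h + g i); rewrite // addrK.
exists u, (fun i => tcf (X i) (g i) / k i) => i; apply: tcfP => h'.
rewrite -(subrK (g i) h'); move: (h' - g i) => h.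
have e1 := tcf_ZMr u (k i) (g i) h.
have e2 := tcf_ZMl u (k i) (g i) h.
rewrite (addrC (g i)) in e2.
rewrite tcfD tcfB e1 e2 (tcfZ _ (k i *: _)) (tcfZ (k i)) tcfM.
case: (eqVneq h 0) => [->|h0].
  rewrite add0r eqxx kap0l kap0r expr0z mulr1 mul1r subrr add0r mulr1.
  by rewrite divfK.
have -> : (g i == h + g i) = false.
  by apply/negbTE; rewrite -{1}(add0r (g i)) (inj_eq (addIr (g i))) eq_sym.
rewrite (UE h i h0) (uE h h0)  /d mulr0 mulr0; ring.
Qed.

End TorusDerivations.

(** * Denominators *)

Section Lowering.
Variables (K : fieldType) (A B : algType K) (phi : {lrmorphism A -> B}).
Variables (u : B) (delta : B -> B) (D : A -> A).
Hypothesis phi_inj : injective phi.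
Hypothesis deltaD : forall x y, delta (x + y) = delta x + delta y.
Hypothesis deltaZ : forall k x, delta (k *: x) = k *: delta x.
Hypothesis deltaM : forall x y, delta (x * y) = delta x * y + x * delta y.
Hypothesis phiD : forall a, phi (D a) = u * phi a - phi a * u + delta (phi a).
Implicit Types (a b r s x y F X Y : A).

Definition img (z : B) := exists a, phi a = z.
Definition denom a := img (phi a * u).
Local Notation J := denom.
Definition qc x y := exists2 k : K, k != 0 & x * y = k *: (y * x).
Definition eig w x := delta (phi x) = w *: phi x.
Definition rreg s := forall z, z * phi s = 0 -> z = 0.

Lemma imgD z z' : img z -> img z' -> img (z + z').
Proof. by move=> [a <-] [b <-]; exists (a + b); rewrite lrmorphD. Qed.

Lemma imgZ k z : img z -> img (k *: z).
Proof. by move=> [a <-]; exists (k *: a); rewrite lrmorphZ. Qed.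

Lemma imgN z : img z -> img (- z).
Proof. by rewrite -scaleN1r; apply: imgZ. Qed.

Lemma imgZ' k z : k != 0 -> img (k *: z) -> img z.
Proof. by move=> k0 /(imgZ k^-1); rewrite scalerA mulVf // scale1r. Qed.

Lemma JM b a : J a -> J (b * a).
Proof. by move=> [c ca]; exists (b * c); rewrite lrmorphM ca lrmorphM mulrA. Qed.

Lemma JZ k a : J a -> J (k *: a).
Proof. by move=> /(imgZ k); rewrite /denom lrmorphZ -scalerAl. Qed.

Lemma JZ' k a : k != 0 -> J (k *: a) -> J a.
Proof. by move=> k0; rewrite /denom lrmorphZ -scalerAl; apply: imgZ'. Qed.

Lemma JB a b : J a -> J b -> J (a - b).
Proof. by move=> Ja Jb; rewrite /denom lrmorphB mulrBl; apply: imgD => //; apply: imgN. Qed.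

Lemma J_right x a : J x -> (J (x * a) <-> img (phi x * delta (phi a))).
Proof.
move=> [c cx].
have ha : phi a * u = u * phi a - phi (D a) + delta (phi a).
  by rewrite phiD opprD opprB addrA subrK addrC subrK.
have e : phi (x * a) * u = phi (c * a - x * D a) + phi x * delta (phi a).
  by rewrite lrmorphB !lrmorphM cx -!mulrA ha mulrDr mulrBr.
rewrite /denom e; split=> h; last by apply: imgD => //; exists (c * a - x * D a).
rewrite -(addKr (phi (c * a - x * D a)) (phi x * _)); apply: imgD => //.
by apply: imgN; exists (c * a - x * D a).
Qed.

Lemma qcM x y z : qc x z -> qc y z -> qc (x * y) z.
Proof.
move=> [k k0 xz] [l l0 yz]; exists (k * l); first by rewrite mulf_neq0.
by rewrite -mulrA yz -scalerAr (mulrA x) xz -scalerAl scalerA mulrC mulrA.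
Qed.

Lemma qc1 z : qc 1 z.
Proof. by exists 1; rewrite ?oner_neq0 // mul1r mulr1 scale1r. Qed.

Lemma qcX x z n : qc x z -> qc (x ^+ n) z.
Proof.
move=> xz; elim: n => [|n IH]; first exact: qc1.
by rewrite exprS; apply: qcM.
Qed.

Lemma qc_sym x y : qc x y -> qc y x.
Proof.
move=> [k k0 e]; exists k^-1; first by rewrite invr_neq0.
by rewrite e scalerA mulVf // scale1r.
Qed.

Lemma pow_comm s x p n : s * x = p *: (x * s) -> s ^+ n * x = p ^+ n *: (x * s ^+ n).
Proof.
move=> sx; elim: n => [|n IH]; first by rewrite !expr0 mul1r mulr1 scale1r.
by rewrite !exprSr -mulrA sx -scalerAr (mulrA _ x) IH -scalerAl scalerA mulrC mulrA.
Qed.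

Lemma rreg_phi s z w : rreg s -> phi z * phi s = phi w * phi s -> z = w.
Proof.
move=> rs e; apply: phi_inj; apply/eqP; rewrite -subr_eq0; apply/eqP/rs.
by rewrite mulrBl e subrr.
Qed.

Lemma rreg_cancel s z w : rreg s -> z * s = w * s -> z = w.
Proof. by move=> rs e; apply: (rreg_phi rs); rewrite -!lrmorphM e. Qed.

Section Quotient.
Variables (F s X Y : A) (lX lY ls : K).
Hypothesis Fs : F * s = X + Y.
Hypothesis rs : rreg s.
Hypotheses (eX : eig lX X) (eY : eig lY Y) (es : eig ls s).

Lemma delta_quot :
  delta (phi F) * phi s = phi ((lX - ls) *: X + (lY - ls) *: Y).
Proof.
have := deltaM (phi F) (phi s); rewrite es -lrmorphM Fs lrmorphD deltaD eX eY => /eqP.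
rewrite -scalerAr -lrmorphM Fs addrC -subr_eq => /eqP <-.
by rewrite [X in X - _]addrC !lrmorphD !lrmorphZ scalerDr !scalerBl opprD addrACA.
Qed.

Lemma eig_quot : lX = lY -> eig (lX - ls) F.
Proof.
move=> lXY; apply/eqP; rewrite -subr_eq0; apply/eqP/rs.
by rewrite mulrBl delta_quot lXY -scalerDr -Fs lrmorphZ lrmorphM scalerAl subrr.
Qed.

Lemma J_stop r : qc r F -> J r -> (forall x, x * s <> r * Y) -> lX = lY.
Proof.
move=> [k k0 rF] Jr ndiv; apply/eqP; apply: contrapT => /negP; rewrite -subr_eq0 => l0.
have : J (r * F) by rewrite rF; apply/JZ/JM.
case/J_right => [//|a ha].
set d := lX - lY in l0.
have inner : ((lX - ls) / d) *: (X + Y)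
    - d^-1 *: ((lX - ls) *: X + (lY - ls) *: Y) = Y.
  rewrite mulrC -scalerA -scalerBr [(lX - ls) *: (X + Y)]scalerDr opprD addrACA subrr add0r -scalerBl.
  by rewrite opprB addrA subrK scalerA mulVf // scale1r.
apply: (ndiv (r * ((lX - ls) / d *: F) - d^-1 *: a)); apply: phi_inj.
rewrite lrmorphM lrmorphB mulrBl [phi (d^-1 *: a)]lrmorphZ ha -(scalerAl d^-1) -(mulrA (phi r)) delta_quot.
by rewrite -!lrmorphM -lrmorphZ -lrmorphB -(mulrA r) -(scalerAl _ F) Fs scalerAr -mulrBr inner.
Qed.

Lemma J_lower r p p' j : qc r F -> s * X = p *: (X * s) -> s * Y = p' *: (Y * s) ->
  p ^+ j.+1 != p' ^+ j.+1 -> J (r * s ^+ j.+1) -> J (r * Y * s ^+ j).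
Proof.
move=> rF sX sY pp Jr; have [k k0 rF'] := qc_sym rF.
have sXY (c c' : K) : s ^+ j.+1 * (c *: X + c' *: Y) =
    (c * p ^+ j.+1 *: X + c' * p' ^+ j.+1 *: Y) * s ^+ j.+1.
  rewrite mulrDr -!scalerAr (pow_comm _ sX) (pow_comm _ sY) !scalerA mulrDl.
  by rewrite -!scalerAl.
have J1 : J (r * s ^+ j.+1 * F).
  apply/J_right => //.
  pose w := r * ((lX - ls) * p ^+ j.+1 *: X + (lY - ls) * p' ^+ j.+1 *: Y) * s ^+ j.
  exists w; apply/eqP; rewrite -subr_eq0; apply/eqP/rs; rewrite mulrBl -mulrA delta_quot.
  by rewrite -!lrmorphM -(mulrA r) sXY /w (exprSr s) !mulrA subrr.
have e1 : r * s ^+ j.+1 * F = r * (p ^+ j.+1 *: X + p' ^+ j.+1 *: Y) * s ^+ j.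
  apply: (rreg_cancel rs); rewrite -!mulrA Fs -exprSr; congr (_ * _).
  by have := sXY 1 1; rewrite !scale1r !mul1r.
have e2 : F * (r * s ^+ j.+1) = k *: (r * (X + Y) * s ^+ j).
  by rewrite mulrA rF' exprS -scalerAl !mulrA -(mulrA r F) Fs.
have : J (r * s ^+ j.+1 * F - (p ^+ j.+1 / k) *: (F * (r * s ^+ j.+1))).
  by apply: JB => //; apply: JZ; apply: JM.
rewrite e1 e2 scalerA divfK // scalerAl -mulrBl scalerAr -mulrBr scalerDr.
rewrite opprD addrACA subrr add0r -scalerBl -scalerAr -scalerAl.
by apply: JZ'; rewrite subr_eq0 eq_sym.
Qed.

End Quotient.

Lemma eigM l m x y : eig l x -> eig m y -> eig (l + m) (x * y).
Proof.
rewrite /eig lrmorphM deltaM => -> ->.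
by rewrite -scalerAl -scalerAr scalerDl.
Qed.

Lemma eigD l x y : eig l x -> eig l y -> eig l (x + y).
Proof. by rewrite /eig lrmorphD deltaD => -> ->; rewrite scalerDr. Qed.

Lemma eigZ l k x : eig l x -> eig l (k *: x).
Proof. by rewrite /eig lrmorphZ deltaZ => ->; rewrite !scalerA mulrC. Qed.

Lemma eig1 : eig 0 1.
Proof.
have := deltaM 1 1; rewrite /eig rmorph1 !mulr1 mul1r scale0r => e.
by apply: (addIr (delta 1)); rewrite add0r -e.
Qed.

End Lowering.

Section Agree.
Variables (K : fieldType) (A B : algType K) (phi : {lrmorphism A -> B}).
Variables (u : B) (delta : B -> B) (D : A -> A).
Hypothesis deltaD : forall x y, delta (x + y) = delta x + delta y.
Hypothesis deltaZ : forall k x, delta (k *: x) = k *: delta x.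
Hypothesis deltaM : forall x y, delta (x * y) = delta x * y + x * delta y.
Hypothesis DD : forall x y, D (x + y) = D x + D y.
Hypothesis DZ : forall k x, D (k *: x) = k *: D x.
Hypothesis DM : forall x y, D (x * y) = D x * y + x * D y.

Definition agree a := phi (D a) = u * phi a - phi a * u + delta (phi a).

Lemma agreeD a b : agree a -> agree b -> agree (a + b).
Proof.
rewrite /agree DD !lrmorphD deltaD => -> ->.
by rewrite mulrDr mulrDl opprD addrACA [in RHS](addrACA (u * phi a)).
Qed.

Lemma agreeZ k a : agree a -> agree (k *: a).
Proof.
by rewrite /agree DZ !lrmorphZ deltaZ => ->; rewrite scalerDr scalerBr scalerAr scalerAl.
Qed.

Lemma ad_leibniz (a b da db : B) :
  (u * a - a * u + da) * b + a * (u * b - b * u + db) =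
  u * (a * b) - a * b * u + (da * b + a * db).
Proof.
rewrite !mulrDl !mulrDr !mulNr !mulrN !mulrA addrACA; congr (_ + _).
by rewrite addrA subrK.
Qed.

Lemma agreeM a b : agree a -> agree b -> agree (a * b).
Proof. by rewrite /agree DM !(lrmorphD, lrmorphM) deltaM => -> ->; rewrite ad_leibniz. Qed.

Lemma agree1 : agree 1.
Proof.
have d1 : delta 1 = 0.
  by have := deltaM 1 1; rewrite !mulr1 mul1r => e; apply: (addrI (delta 1)); rewrite -e addr0.
have D1 : D 1 = 0.
  by have := DM 1 1; rewrite !mulr1 mul1r => e; apply: (addrI (D 1)); rewrite -e addr0.
by rewrite /agree D1 rmorph0 rmorph1 d1 mulr1 mul1r subrr addr0.
Qed.

Lemma agree_quot F s : rreg phi s -> agree s -> agree (F * s) -> agree F.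
Proof.
move=> rs es eFs; apply/eqP; rewrite -subr_eq0; apply/eqP/rs.
rewrite mulrBl; apply/eqP; rewrite subr_eq0; apply/eqP.
apply: (addIr (phi F * phi (D s))); move: eFs.
by rewrite /agree DM lrmorphD !lrmorphM deltaM => ->; rewrite es ad_leibniz.
Qed.

End Agree.

(* P, X and V0 satisfy F_2 Z = P + beta, F_1 y = X + alpha, and V0 y = q^-5 beta
   when alpha = 0. *)
Definition Plin : seq (lau * seq nat) :=
  [:: ([:: (1, 0)], [:: 3; 3; 3; 6]%N);
      ([:: (-1, -7); (-1, -5); (-1, -3)], [:: 3; 3; 5; 5]%N);
      ([:: (1, -9); (1, -7); (1, -5)], [:: 3; 4; 5]%N);
      ([:: (-1, -6)], [:: 4; 4]%N)].
Definition Xlin : seq (lau * seq nat) :=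
  [:: ([:: (1, 0)], [:: 2; 5]%N); ([:: (-1, -3)], [:: 3; 3]%N)].
Definition V0lin : seq (lau * seq nat) :=
  [:: ([:: (1, 0)], [:: 1; 3; 6]%N); ([:: (-1, 0)], [:: 2; 6]%N);
      ([:: (-1, -3)], [:: 1; 5; 5]%N); ([:: (1, -11); (1, -9)], [:: 3; 5]%N);
      ([:: (-1, -11)], [:: 4]%N)].

Definition chart1_image (r : seq (lau * seq nat)) := llin G2_cocycle chart1 r.
Definition one_letter (i : nat) := one_word [:: i].
Definition qcomm_ok za zb r s (k : int) :=
  gnorm (tdrop za zb (lmul G2_cocycle (chart1_image r) (chart1_image s) ++
    lscale [:: (-1, k)] (lmul G2_cocycle (chart1_image s) (chart1_image r)))) == [::].
Definition prod_ok za zb r s (l : seq tterm) :=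
  gnorm (tdrop za zb (lmul G2_cocycle (chart1_image r) (chart1_image s) ++ lscale [:: (-1, 0)] l)) == [::].

Section ChartIdentities.
Variables (K : fieldType) (q : K) (q0 : q != 0) (al be : K) (A : algType K).
Variables (F : nat -> A) (phi : {lrmorphism A -> qtorus q0 G2_cocycle}).
Hypothesis phi_inj : injective phi.
Hypothesis phiF : forall i, phi (F i) = tev q0 G2_cocycle al be (chart1 i).
Local Notation tev := (tev q0 G2_cocycle al be).
Local Notation t := (tmon q0 G2_cocycle).
Local Notation el := (lsum q (fword F)).

Lemma tev_eq0 (za zb : bool) l : (za -> al = 0) -> (zb -> be = 0) ->
  gnorm (tdrop za zb l) == [::] -> tev l = 0.
Proof. by move=> ha hb /eqP e; rewrite (tdropP q0 G2_cocycle l ha hb) -gev_norm e gev_nil. Qed.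

Lemma tev_cat_opp l l' (k : int) : tev (l ++ lscale [:: (-1, k)] l') = 0 ->
  tev l = q ^ k *: tev l'.
Proof.
rewrite gev_cat tev_scale lev1 mulN1r scaleNr => e.
by apply/eqP; rewrite -subr_eq0; apply/eqP.
Qed.

Lemma qcommP (za zb : bool) r s k : (za -> al = 0) -> (zb -> be = 0) ->
  qcomm_ok za zb r s k -> el r * el s = q ^ k *: (el s * el r).
Proof.
move=> ha hb /(tev_eq0 ha hb)/tev_cat_opp; rewrite !tev_mul => e.
by apply: phi_inj; rewrite lrmorphZ !lrmorphM !(phi_lsum phiF).
Qed.

Lemma prodP (za zb : bool) r s l : (za -> al = 0) -> (zb -> be = 0) ->
  prod_ok za zb r s l -> phi (el r * el s) = tev l.
Proof.
move=> ha hb /(tev_eq0 ha hb)/tev_cat_opp; rewrite tev_mul expr0z => e.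
rewrite lrmorphM !(phi_lsum phiF); apply: (etrans e); exact: scale1r.
Qed.

Lemma phi_lmul r (x : A) l : phi x = tev l -> phi (el r * x) = tev (lmul G2_cocycle (chart1_image r) l).
Proof. by move=> e; rewrite lrmorphM e tev_mul (phi_lsum phiF). Qed.

Lemma lsum_letter i : el (one_letter i) = F i.
Proof. exact: lsum_let. Qed.

Lemma phi_mono r k g : chart1_image r = [:: (1, (k, (0%N, 0%N), g))] -> phi (el r) = q ^ k *: t g.
Proof.
rewrite (phi_lsum phiF) /chart1_image => ->; rewrite gev_cons gev_nil /kev.
by rewrite !expr0 !mulr1 [1%:~R *: _]scale1r; apply: addr0.
Qed.

Lemma mono_rreg (x : A) (k : int) g : phi x = q ^ k *: t g -> rreg phi x.
Proof.
move=> e z; rewrite e => h; apply: (@tmon_regr _ _ _ _ z g).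
apply/eqP; have /eqP := h; rewrite -(scalerAr (q ^ k)) scaler_eq0.
by rewrite (negPf (qz_neq0 q0 k)).
Qed.

End ChartIdentities.

Definition torus_gen (i : nat) : seq (lau * seq nat) := nth [::] [:: one_letter 5; one_letter 6; ylin; Zlin] i.
Definition torus_gen_exp (i : nat) : Z4 :=
  nth 0 [:: (0, 0, 1, 0); (0, 0, 0, 1); (1, 0, 1, 0); (0, 1, 0, 1)] i.

Lemma torus_gen_separate h : h != 0 -> exists i : 'I_4, om G2_cocycle h (torus_gen_exp i) != 0.
Proof.
move=> h0; apply: contrapT => H; case/eqP: h0.
have z (i : 'I_4) : om G2_cocycle h (torus_gen_exp i) = 0.
  by apply/eqP; apply: contrapT => /negP hi; apply: H; exists i.
move: (z (inord 0)) (z (inord 1)) (z (inord 2)) (z (inord 3)); rewrite /torus_gen_exp !inordK //.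
case: h {H z} => [[[h0 h1] h2] h3]; rewrite /om /kap /G2_cocycle /= => e0 e1 e2 e3.
have -> : h0 = 0 by lia.
have -> : h1 = 0 by lia.
have -> : h2 = 0 by lia.
by have -> : h3 = 0 by lia.
Qed.

Section DerivationTorus.
Variables (K : fieldType) (q : K) (q0 : q != 0) (al be : K) (A : algType K).
Hypothesis qnroot : forall n, (0 < n)%N -> q ^+ n != 1.
Variables (F : nat -> A) (phi : {lrmorphism A -> qtorus q0 G2_cocycle}).
Hypothesis Fgen : generated F.
Hypothesis phi_inj : injective phi.
Hypothesis phiF : forall i, phi (F i) = tev q0 G2_cocycle al be (chart1 i).
Variable D : A -> A.
Hypothesis DD : forall x y, D (x + y) = D x + D y.
Hypothesis DZ : forall k x, D (k *: x) = k *: D x.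
Hypothesis DM : forall x y, D (x * y) = D x * y + x * D y.
Notation T := (qtorus q0 G2_cocycle).
Local Notation tev := (tev q0 G2_cocycle al be).
Local Notation t := (tmon q0 G2_cocycle).
Local Notation el := (lsum q (fword F)).

Lemma phi_monomial r g : chart1_image r = [:: (1, (0, (0%N, 0%N), g))] -> phi (el r) = t g.
Proof. by move=> /(phi_mono phiF) ->; rewrite expr0z; apply: scale1r. Qed.

Lemma phi_torus_gen (i : 'I_4) : phi (el (torus_gen i)) = t (torus_gen_exp i).
Proof. by apply: phi_monomial; case: i => [[|[|[|[|]]]]] //= _; vm_compute. Qed.

Lemma rreg_torus_gen (i : 'I_4) : rreg phi (el (torus_gen i)).
Proof.
by apply: (@mono_rreg _ _ _ _ phi _ 0 (torus_gen_exp i)); rewrite phi_torus_gen expr0z scale1r.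
Qed.

Lemma torus_gen_comm (i j : 'I_4) :
  el (torus_gen i) * el (torus_gen j) = q ^ om G2_cocycle (torus_gen_exp i) (torus_gen_exp j) *:
    (el (torus_gen j) * el (torus_gen i)).
Proof. by apply: phi_inj; rewrite lrmorphZ !lrmorphM !phi_torus_gen tmon_comm. Qed.

Lemma cross_term (B : algType K) (x x' y y' : B) :
  x * y + x' * y' = x * (1 *: y) + (1 *: x') * y'.
Proof. by rewrite !scale1r. Qed.

Lemma D_cross (i j : 'I_4) :
  phi (D (el (torus_gen i))) * (1 *: t (torus_gen_exp j)) +
    (1 *: t (torus_gen_exp i)) * phi (D (el (torus_gen j))) =
  q ^ om G2_cocycle (torus_gen_exp i) (torus_gen_exp j) *:
    (phi (D (el (torus_gen j))) * (1 *: t (torus_gen_exp i))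
     + (1 *: t (torus_gen_exp j)) * phi (D (el (torus_gen i)))).
Proof.
have := congr1 (fun x => phi (D x)) (torus_gen_comm i j).
rewrite /= DM DZ DM lrmorphZ !lrmorphD !lrmorphM !phi_torus_gen => e.
exact: (etrans (esym (cross_term _ _ _ _)) (etrans e (congr1 _ (cross_term _ _ _ _)))).
Qed.

Lemma F_3_5 : F 3%N * F 5%N = el ylin + F 4%N.
Proof.
rewrite /ylin !lsum_cons /lsum big_nil !lev1 !expr0z mul1r mulr1 scale1r.
by rewrite fword2 fword1 scaleN1r addr0 subrK.
Qed.

Definition F5cube_lin : seq (lau * seq nat) := one_word [:: 5; 5; 5]%N.

Lemma F_4_6 : F 4%N * F 6%N = el Zlin + el F5cube_lin.
Proof.
rewrite {1}/lsum {1}/Zlin !big_cons big_nil !lev1 !expr0z mul1r mulr1 scale1r.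
by rewrite [el F5cube_lin]lsum_one fword2 scaleN1r addr0 subrK.
Qed.

Lemma F_2_Z : F 2%N * el Zlin = el Plin + be *: 1.
Proof.
have e : phi (el (one_letter 2) * el Zlin) = tev (chart1_image Plin ++ [:: (1, (0, (0%N, 1%N), 0))]).
  by apply: (prodP (za := false) (zb := false) phiF) => //; vm_compute.
apply: phi_inj; rewrite lsum_letter in e; rewrite e gev_cat.
have -> : tev (chart1_image Plin) = phi (el Plin) by rewrite (phi_lsum phiF).
rewrite lrmorphD; congr (_ + _).
rewrite gev_cons gev_nil /kev expr0z expr0 expr1 !mul1r [1%:~R *: _]scale1r.
by rewrite lrmorphZ rmorph1; apply: addr0.
Qed.

Lemma F_1_y : F 1%N * el ylin = el Xlin + al *: 1.
Proof.
have e : phi (el (one_letter 1) * el ylin) = tev (chart1_image Xlin ++ [:: (1, (0, (1%N, 0%N), 0))]).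
  by apply: (prodP (za := false) (zb := false) phiF) => //; vm_compute.
apply: phi_inj; rewrite lsum_letter in e; rewrite e gev_cat.
have -> : tev (chart1_image Xlin) = phi (el Xlin) by rewrite (phi_lsum phiF).
rewrite lrmorphD; congr (_ + _).
rewrite gev_cons gev_nil /kev expr0z expr0 expr1 !mul1r mulr1 [1%:~R *: _]scale1r.
by rewrite lrmorphZ rmorph1; apply: addr0.
Qed.

Definition zchar (c5 c6 cy cZ : K) (g : Z4) : K :=
  let: (g0, g1, g2, g3) := g in
  g0%:~R * cy + g1%:~R * cZ + (g2 - g0)%:~R * c5 + (g3 - g1)%:~R * c6.

Lemma zcharD c5 c6 cy cZ g h :
  zchar c5 c6 cy cZ (g + h) = zchar c5 c6 cy cZ g + zchar c5 c6 cy cZ h.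
Proof.
move: g h => [[[g0 g1] g2] g3] [[[h0 h1] h2] h3].
rewrite /zchar /=.
by rewrite !rmorphB !rmorphD /=; ring.
Qed.

Lemma derivation_torus : exists (u : T) (c5 c6 cy cZ : K),
  [/\ forall a, phi (D a) = u * phi a - phi a * u + tder (zchar c5 c6 cy cZ) (phi a),
      eig phi (tder (zchar c5 c6 cy cZ)) c5 (F 5%N),
      eig phi (tder (zchar c5 c6 cy cZ)) c6 (F 6%N),
      eig phi (tder (zchar c5 c6 cy cZ)) cy (el ylin) &
      eig phi (tder (zchar c5 c6 cy cZ)) cZ (el Zlin)].
Proof.
have [u [wt Xmu]] := torus_inner qnroot (k := fun=> 1) (fun=> oner_neq0 K) D_cross torus_gen_separate.
pose c5 := wt (inord 0); pose c6 := wt (inord 1).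
pose cy := wt (inord 2); pose cZ := wt (inord 3).
exists u, c5, c6, cy, cZ; set chi := zchar _ _ _ _.
have chi_gg (i : 'I_4) : chi (torus_gen_exp i) = wt i.
  case: i => [[|[|[|[|]]]] // hi]; rewrite /chi /zchar /= ?(subr0, subrr, mul0r, add0r, addr0, mul1r).
  - by congr wt; apply: val_inj; rewrite /= inordK.
  - by congr wt; apply: val_inj; rewrite /= inordK.
  - by congr wt; apply: val_inj; rewrite /= inordK.
  - by congr wt; apply: val_inj; rewrite /= inordK.
have eig_s (i : 'I_4) : eig phi (tder chi) (wt i) (el (torus_gen i)).
  by rewrite /eig phi_torus_gen tder_mon chi_gg.
have ag_s (i : 'I_4) : agree phi u (tder chi) D (el (torus_gen i)).
  by rewrite /agree Xmu phi_torus_gen tder_mon chi_gg !scale1r.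
have s5 : F 5%N = el (torus_gen (inord 0 : 'I_4)) by rewrite inordK // [RHS]lsum_letter.
have s6 : F 6%N = el (torus_gen (inord 1 : 'I_4)) by rewrite inordK // [RHS]lsum_letter.
have sy : el ylin = el (torus_gen (inord 2 : 'I_4)) by rewrite inordK.
have sZ : el Zlin = el (torus_gen (inord 3 : 'I_4)) by rewrite inordK.
split; last first.
- by rewrite sZ; exact: eig_s.
- by rewrite sy; exact: eig_s.
- by rewrite s6; exact: eig_s.
- by rewrite s5; exact: eig_s.
have dD (x y : T) : tder chi (x + y) = tder chi x + tder chi y := tderD chi x y.
have dZ k (x : T) : tder chi (k *: x) = k *: tder chi x := tderZ chi k x.
have dM (x y : T) : tder chi (x * y) = tder chi x * y + x * tder chi y.
  exact: (tderM (@zcharD c5 c6 cy cZ)).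
have aM := agreeM (phi := phi) (u := u) dM DM.
have aD := agreeD (phi := phi) (u := u) dD DD.
have aZ := agreeZ (phi := phi) (u := u) dZ DZ.
have a1 : agree phi u (tder chi) D 1 := agree1 phi u dM DM.
have aq F' s := @agree_quot _ _ _ phi u _ _ dM DM F' s.
have a5 : agree phi u (tder chi) D (F 5%N) by rewrite s5; exact: ag_s.
have a6 : agree phi u (tder chi) D (F 6%N) by rewrite s6; exact: ag_s.
have ay : agree phi u (tder chi) D (el ylin) by rewrite sy; exact: ag_s.
have aZ' : agree phi u (tder chi) D (el Zlin) by rewrite sZ; exact: ag_s.
have r5 : rreg phi (F 5%N) by rewrite s5; exact: rreg_torus_gen.
have r6 : rreg phi (F 6%N) by rewrite s6; exact: rreg_torus_gen.
have ry : rreg phi (el ylin) by rewrite sy; exact: rreg_torus_gen.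
have rZ : rreg phi (el Zlin) by rewrite sZ; exact: rreg_torus_gen.
have a_word (w : seq nat) : (forall i, i \in w -> agree phi u (tder chi) D (F i)) ->
    agree phi u (tder chi) D (fword F w).
  elim: w => [|i w IH] h; first by rewrite /fword big_nil.
  rewrite fword_cons; apply: aM; first by apply: h; rewrite mem_head.
  by apply: IH => j jw; apply: h; rewrite inE jw orbT.
have a_el (r : seq (lau * seq nat)) (L : seq nat) :
    (forall i, i \in L -> agree phi u (tder chi) D (F i)) ->
    all (fun p => all (mem L) p.2) r -> agree phi u (tder chi) D (el r).
  move=> hL; elim: r => [_|p r IH /= /andP[/allP pL rL]].
    by rewrite /lsum big_nil -(scale0r 1); apply: aZ.
  by rewrite lsum_cons; apply: aD (IH rL); apply/aZ/a_word => i /pL /hL.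
have a4 : agree phi u (tder chi) D (F 4%N).
  apply: (aq _ (F 6%N)) => //; rewrite F_4_6; apply: aD => //.
  by apply: (a_el _ [:: 5]%N) => // i; rewrite inE => /eqP ->.
have a3 : agree phi u (tder chi) D (F 3%N).
  by apply: (aq _ (F 5%N)) => //; rewrite F_3_5; apply: aD.
have a3456 i : i \in [:: 3; 4; 5; 6]%N -> agree phi u (tder chi) D (F i).
  by rewrite !inE => /or4P[] /eqP ->.
have a2 : agree phi u (tder chi) D (F 2%N).
  apply: (aq _ (el Zlin)) => //; rewrite F_2_Z; apply: aD; last exact: aZ.
  by apply: (a_el _ [:: 3; 4; 5; 6]%N).
have a23456 i : i \in [:: 2; 3; 4; 5; 6]%N -> agree phi u (tder chi) D (F i).
  by rewrite inE => /orP[/eqP -> //|/a3456].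
have aa1 : agree phi u (tder chi) D (F 1%N).
  apply: (aq _ (el ylin)) => //; rewrite F_1_y; apply: aD; last exact: aZ.
  by apply: (a_el _ [:: 2; 3; 4; 5; 6]%N).
apply: Fgen => //.
move=> i x hi ax; apply: aM => //.
by case: i hi => [|[|[|[|[|[|[|]]]]]]].
Qed.

End DerivationTorus.

Section Monomials.
Variables (K : fieldType) (q : K) (q0 : q != 0) (c : Z6).
Notation T := (qtorus q0 c).
Local Notation t := (tmon q0 c).

Definition umon (x : T) g := exists2 k : K, k != 0 & x = k *: t g.

Lemma umon_t g : umon (t g) g.
Proof. by exists 1; rewrite ?oner_neq0 // scale1r. Qed.

Lemma umonM x y g h : umon x g -> umon y h -> umon (x * y) (g + h).
Proof.
move=> [k k0 ->] [l l0 ->]; exists (k * l * q ^ kap c g h).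
  by rewrite !mulf_neq0 ?qz_neq0.
exact: tmonZM.
Qed.

Lemma umonX x g n : umon x g -> umon (x ^+ n) (g *+ n).
Proof.
move=> xg; elim: n => [|n IH]; first exact: (umon_t 0).
by rewrite exprS mulrS; apply: umonM.
Qed.

Lemma umon_inv x g : umon x g -> exists k : K, t g = k *: x.
Proof.
by move=> [k k0 ->]; exists k^-1; rewrite [RHS]scalerA mulVf // [RHS]scale1r.
Qed.

End Monomials.

Section Denominators.
Variables (K : fieldType) (q : K) (q0 : q != 0) (al be : K) (A : algType K).
Hypothesis qnroot : forall n, (0 < n)%N -> q ^+ n != 1.
Hypothesis ab0 : (al != 0) || (be != 0).
Variables (F : nat -> A) (phi psi : {lrmorphism A -> qtorus q0 G2_cocycle}).
Hypothesis phi_inj : injective phi.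
Hypothesis phiF : forall i, phi (F i) = tev q0 G2_cocycle al be (chart1 i).
Hypothesis psiF : forall i, psi (F i) = tev q0 G2_cocycle al be (chart2 i).
Variable D : A -> A.
Notation T := (qtorus q0 G2_cocycle).
Local Notation t := (tmon q0 G2_cocycle).
Local Notation el := (lsum q (fword F)).
Variables (u : T) (delta : T -> T) (c5 c6 cy cZ : K).
Hypothesis deltaD : forall x y, delta (x + y) = delta x + delta y.
Hypothesis deltaZ : forall k x, delta (k *: x) = k *: delta x.
Hypothesis deltaM : forall x y, delta (x * y) = delta x * y + x * delta y.
Hypothesis phiD : forall a, phi (D a) = u * phi a - phi a * u + delta (phi a).
Local Notation eg := (eig phi delta).
Hypothesis eig_F5 : eg c5 (F 5%N).
Hypothesis eig_F6 : eg c6 (F 6%N).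
Hypothesis eig_y : eg cy (el ylin).
Hypothesis eig_Z : eg cZ (el Zlin).
Local Notation J := (denom phi u).
Local Notation y := (el ylin).
Local Notation Z := (el Zlin).

Definition S4 m n i j : A := y ^+ m * Z ^+ n * F 5%N ^+ i * F 6%N ^+ j.

Lemma rreg_F5 : rreg phi (F 5%N).
Proof.
by have := rreg_torus_gen phiF (i := Ordinal (isT : (0 < 4)%N)); rewrite [torus_gen _]/(one_letter 5) lsum_letter.
Qed.
Lemma rreg_F6 : rreg phi (F 6%N).
Proof.
by have := rreg_torus_gen phiF (i := Ordinal (isT : (1 < 4)%N)); rewrite [torus_gen _]/(one_letter 6) lsum_letter.
Qed.
Lemma rreg_y : rreg phi y.
Proof. exact: (rreg_torus_gen phiF (i := Ordinal (isT : (2 < 4)%N))). Qed.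
Lemma rreg_Z : rreg phi Z.
Proof. exact: (rreg_torus_gen phiF (i := Ordinal (isT : (3 < 4)%N))). Qed.

Lemma S4_mon m n i j :
  umon (phi (S4 m n i j)) (m%:Z, n%:Z, m%:Z + i%:Z, n%:Z + j%:Z).
Proof.
have -> : (m%:Z, n%:Z, m%:Z + i%:Z, n%:Z + j%:Z) =
    (1, 0, 1, 0) *+ m + (0, 1, 0, 1) *+ n + (0, 0, 1, 0) *+ i + (0, 0, 0, 1) *+ j :> Z4.
  by rewrite !tupM !tupD !mul0r !mul1r !addr0 !add0r.
have uel r g : chart1_image r = [:: (1, (0, (0%N, 0%N), g))] -> umon (phi (el r)) g.
  by move=> /(phi_monomial phiF) ->; apply: umon_t.
have uy : umon (phi y) (1, 0, 1, 0) by apply: uel; vm_compute.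
have uZ : umon (phi Z) (0, 1, 0, 1) by apply: uel; vm_compute.
have u5 : umon (phi (F 5%N)) (0, 0, 1, 0).
  by rewrite -(lsum_letter q F 5); apply: uel; vm_compute.
have u6 : umon (phi (F 6%N)) (0, 0, 0, 1).
  by rewrite -(lsum_letter q F 6); apply: uel; vm_compute.
rewrite /S4 !lrmorphM !lrmorphX.
exact: (umonM (umonM (umonM (umonX m uy) (umonX n uZ)) (umonX i u5)) (umonX j u6)).
Qed.

Lemma img_cone (h0 h1 h2 h3 : int) : 0 <= h0 -> 0 <= h1 -> h0 <= h2 -> h1 <= h3 ->
  img phi (t (h0, h1, h2, h3)).
Proof.
move=> p0 p1 p2 p3; have [k e] := umon_inv (S4_mon `|h0| `|h1| `|h2 - h0| `|h3 - h1|).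
have E : (h0, h1, h2, h3) = (Posz `|h0|, Posz `|h1|, Posz `|h0| + Posz `|h2 - h0|,
    Posz `|h1| + Posz `|h3 - h1|) :> Z4.
  by rewrite !gez0_abs ?subr_ge0 // !(addrC h0) !(addrC h1) !subrK.
by exists (k *: S4 `|h0| `|h1| `|h2 - h0| `|h3 - h1|); rewrite lrmorphZ -e E.
Qed.

Definition norm4 (g : Z4) : nat := `|g.1.1.1| + `|g.1.1.2| + `|g.1.2| + `|g.2|.

Lemma J_nonempty : exists m n i j, J (S4 m n i j).
Proof.
pose b := \max_(g <- tsupp u) norm4 g; exists b, b, (b + b)%N, (b + b)%N.
have [k k0 e] := S4_mon b b (b + b) (b + b).
have Jsum (r : seq Z4) : (forall g, g \in r -> (norm4 g <= b)%N) ->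
    img phi (phi (S4 b b (b + b) (b + b)) * \sum_(g <- r) tcf u g *: t g).
  elim: r => [_|g r IH rb]; first by rewrite big_nil mulr0; exists 0; exact: rmorph0.
  rewrite big_cons mulrDr; apply: imgD; last by apply: IH => h hr; rewrite rb ?inE ?hr ?orbT.
  rewrite e -scalerAr; apply: imgZ; rewrite -scalerAl; apply: imgZ.
  rewrite tmonM; apply: imgZ; have := rb g (mem_head _ _).
  case: g {rb} => [[[g0 g1] g2] g3]; rewrite /norm4 /= => gb.
  by rewrite tupD; apply: img_cone; lia.
rewrite /denom [X in _ * X](tsumE u); apply: Jsum => g gu.
exact: (leq_bigmax_seq (F := norm4)).
Qed.

Lemma qc_of_check r s k : qcomm_ok false false r s k -> qc (el r) (el s).
Proof.
move=> ok; exists (q ^ k); first exact: expfz_neq0.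
by apply: (qcommP (za := false) (zb := false) phi_inj phiF).
Qed.

Lemma comm_of_check r s k : qcomm_ok false false r s k -> el r * el s = q ^ k *: (el s * el r).
Proof. exact: (qcommP (za := false) (zb := false) phi_inj phiF). Qed.

Lemma qpow_neq (k k' : int) j : k != k' -> (q ^ k) ^+ j.+1 != (q ^ k') ^+ j.+1.
Proof.
apply: contra => /eqP; rewrite !exprnP !exprz_exp => /(qexp_inj q0 qnroot) e.
by apply/eqP; apply: mulIf e.
Qed.

Lemma F5cube_lin_eq : el F5cube_lin = F 5%N ^+ 3.
Proof. by rewrite [LHS]lsum_one /fword !big_cons big_nil mulr1 !exprS expr0 mulr1. Qed.

Lemma eig_cube : eg (c5 + (c5 + c5)) (el F5cube_lin).
Proof.
by rewrite F5cube_lin_eq !exprS expr0 mulr1; exact: (eigM deltaM eig_F5 (eigM deltaM eig_F5 eig_F5)).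
Qed.

Lemma qc_yZ5_4 m n i : qc (y ^+ m * Z ^+ n * F 5%N ^+ i) (F 4%N).
Proof.
rewrite -(lsum_letter q F 4) -(lsum_letter q F 5); apply: qcM; first apply: qcM.
all: apply: qcX.
- by apply: (qc_of_check (k := 0)); vm_compute.
- by apply: (qc_of_check (k := -3)); vm_compute.
- by apply: (qc_of_check (k := -3)); vm_compute.
Qed.

Lemma lower6 m n i j : J (S4 m n i j.+1) -> J (S4 m n (i + 3) j).
Proof.
move=> h; rewrite /S4 exprD (mulrA _ (F 5%N ^+ i)) -F5cube_lin_eq.
have s1 : F 6%N * Z = q ^ (-3) *: (Z * F 6%N).
  by rewrite -(lsum_letter q F 6); apply: comm_of_check; vm_compute.
have s2 : F 6%N * el F5cube_lin = q ^ (-9) *: (el F5cube_lin * F 6%N).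
  by rewrite -(lsum_letter q F 6); apply: comm_of_check; vm_compute.
exact: (J_lower phi_inj deltaD deltaM phiD (F_4_6 q F) rreg_F6 eig_Z eig_cube eig_F6 (qc_yZ5_4 m n i)
  s1 s2 (@qpow_neq (-3) (-9) j isT) h).
Qed.

Lemma lower6_all m n i j : J (S4 m n i j) -> exists i', J (S4 m n i' 0).
Proof.
elim: j i => [|j IH] i h; first by exists i.
by apply: (IH (i + 3)%N); apply: lower6.
Qed.

Lemma stop6 m n i : J (S4 m n i 0) -> cZ = c5 + (c5 + c5).
Proof.
rewrite /S4 expr0 mulr1 => h.
apply: (J_stop phi_inj deltaD deltaM phiD (F_4_6 q F) eig_Z eig_cube eig_F6 (qc_yZ5_4 m n i) h) => x.
by rewrite F5cube_lin_eq -(mulrA _ (F 5%N ^+ i)) -exprD; apply: (F6_nondiv psiF).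
Qed.

Lemma qc_yZ_3 m n : qc (y ^+ m * Z ^+ n) (F 3%N).
Proof.
rewrite -(lsum_letter q F 3); apply: qcM; apply: qcX.
- by apply: (qc_of_check (k := -1)); vm_compute.
- by apply: (qc_of_check (k := -3)); vm_compute.
Qed.

Section After6.
Hypothesis cZ5 : cZ = c5 + (c5 + c5).

Lemma eig_F4 : eg (cZ - c6) (F 4%N).
Proof. exact: (eig_quot deltaD deltaM (F_4_6 q F) rreg_F6 eig_Z eig_cube eig_F6 cZ5). Qed.

Lemma Z_y n : exists2 k : K, k != 0 & Z ^+ n * y = k *: (y * Z ^+ n).
Proof. by apply: qcX; apply: (qc_of_check (k := -3)); vm_compute. Qed.

Lemma F_3_5' : F 3%N * F 5%N = F 4%N + y.
Proof. by rewrite (F_3_5 q) addrC. Qed.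

Lemma lower5 m n i : J (S4 m n i.+1 0) -> J (S4 m.+1 n i 0).
Proof.
rewrite /S4 !expr0 !mulr1 => h.
have s1 : F 5%N * F 4%N = q ^ (-3) *: (F 4%N * F 5%N).
  by rewrite -(lsum_letter q F 4) -(lsum_letter q F 5); apply: comm_of_check; vm_compute.
have s2 : F 5%N * y = q ^ (-1) *: (y * F 5%N).
  by rewrite -(lsum_letter q F 5); apply: comm_of_check; vm_compute.
have := J_lower phi_inj deltaD deltaM phiD F_3_5' rreg_F5 eig_F4 eig_y eig_F5 (qc_yZ_3 m n)
  s1 s2 (@qpow_neq (-3) (-1) i isT) h.
have [k k0 e] := Z_y n; rewrite -(mulrA (y ^+ m)) e -scalerAr mulrA -exprSr -scalerAl.
exact: JZ'.
Qed.

Lemma lower5_all m n i : J (S4 m n i 0) -> exists m', J (S4 m' n 0 0).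
Proof.
elim: i m => [|i IH] m h; first by exists m.
by apply: (IH m.+1); apply: lower5.
Qed.

Lemma stop5 m n : J (S4 m n 0 0) -> cy = cZ - c6.
Proof.
rewrite /S4 !expr0 !mulr1 => h.
apply: (J_stop phi_inj deltaD deltaM phiD (F_3_5 q F) eig_y eig_F4 eig_F5 (qc_yZ_3 m n) h) => x.
exact: (F5_nondiv psiF).
Qed.

Section After5.
Hypothesis cy4 : cy = cZ - c6.

Lemma eig_F3 : eg (cy - c5) (F 3%N).
Proof. exact: (eig_quot deltaD deltaM (F_3_5 q F) rreg_F5 eig_y eig_F4 eig_F5 cy4). Qed.

Let vv := c6.
Let uu := c5 - c6.

Lemma eig_cast a b x : eg a x -> a = b -> eg b x.
Proof. by move=> h <-. Qed.

Lemma eig_weight (i : nat) : (2 < i <= 6)%N -> eg (G2_weight uu vv i) (F i).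
Proof.
move=> hi; have : [|| i == 3, i == 4, i == 5 | i == 6]%N by lia.
case/or4P=> /eqP ->.
- by apply: (eig_cast eig_F3); rewrite cy4 cZ5 /uu /vv /G2_weight /=; ring.
- by apply: (eig_cast eig_F4); rewrite cZ5 /uu /vv /G2_weight /=; ring.
- by apply: (eig_cast eig_F5); rewrite /uu /vv /G2_weight /=; ring.
- by apply: (eig_cast eig_F6).
Qed.

Lemma eig_word (l : seq nat) (w : nat -> K) :
  (forall i, i \in l -> eg (w i) (F i)) -> eg (\sum_(i <- l) w i) (fword F l).
Proof.
elim: l => [|i l IH] h; first by rewrite /fword !big_nil; apply: (eig1 phi deltaM).
rewrite fword_cons big_cons; apply: (eigM deltaM); first by apply: h; rewrite mem_head.
by apply: IH => j jl; apply: h; rewrite inE jl orbT.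
Qed.

Lemma eig_P : eg (6%:R * uu + 4%:R * vv) (el Plin).
Proof.
have hw (l : seq nat) : all (fun i => 2 < i <= 6)%N l ->
    \sum_(i <- l) G2_weight uu vv i = 6%:R * uu + 4%:R * vv ->
    eg (6%:R * uu + 4%:R * vv) (fword F l).
  by move=> /allP hl <-; apply: eig_word => i /hl /eig_weight.
rewrite /Plin !lsum_cons /lsum big_nil addr0.
apply: (eigD deltaD); [|apply: (eigD deltaD); [|apply: (eigD deltaD)]];
  apply: (eigZ deltaZ); (apply: hw; first exact: isT);
  by rewrite !big_cons big_nil /G2_weight /=; ring.
Qed.

Lemma F_2_Z' : F 2%N * Z = el Plin + be *: 1.
Proof. exact: (F_2_Z phi_inj phiF). Qed.

Lemma qc_y_2 m : qc (y ^+ m) (F 2%N).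
Proof. by rewrite -(lsum_letter q F 2); apply/qcX/(qc_of_check (k := -3)); vm_compute. Qed.

Lemma eig_beta : (6%:R * uu + 4%:R * vv) * be = 0 ->
  eg (6%:R * uu + 4%:R * vv) (be *: 1).
Proof.
move=> h; rewrite /eig lrmorphZ deltaZ rmorph1.
have := eig1 phi deltaM; rewrite /eig rmorph1 scale0r => ->.
by rewrite scaler0 scalerA h scale0r.
Qed.

Lemma eig_F2 : (6%:R * uu + 4%:R * vv) * be = 0 -> eg (G2_weight uu vv 2) (F 2%N).
Proof.
move=> h; have := eig_quot deltaD deltaM F_2_Z' rreg_Z eig_P (eig_beta h) eig_Z erefl.
by move=> h2; apply: (eig_cast h2); rewrite cZ5 /G2_weight /uu /vv /=; ring.
Qed.

Lemma lowerZ m n : be != 0 -> J (S4 m n.+1 0 0) -> J (S4 m n 0 0).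
Proof.
rewrite /S4 !expr0 !mulr1 => b0 h.
have s1 : Z * el Plin = q ^ (-6) *: (el Plin * Z) by apply: comm_of_check; vm_compute.
have s2 : Z * (be *: 1) = q ^ 0 *: ((be *: 1) * Z).
  by rewrite expr0z scale1r -scalerAl -scalerAr mul1r mulr1.
have := J_lower phi_inj deltaD deltaM phiD F_2_Z' rreg_Z eig_P (eigZ deltaZ be (eig1 phi deltaM)) eig_Z
  (qc_y_2 m) s1 s2 (@qpow_neq (-6) 0 n isT) h.
by rewrite -scalerAr mulr1 -scalerAl; apply: JZ'.
Qed.

Lemma stopZ m : be != 0 -> J (S4 m 0 0 0) -> 6%:R * uu + 4%:R * vv = 0.
Proof.
rewrite /S4 !expr0 !mulr1 => b0 h.
apply: (J_stop phi_inj deltaD deltaM phiD F_2_Z' eig_P (eigZ deltaZ be (eig1 phi deltaM)) eig_Z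
  (qc_y_2 m) h) => x.
rewrite -scalerAr mulr1 => e; apply: (Z_nondiv psiF (x := be^-1 *: x) (m := m) b0).
by rewrite -scalerAl e scalerA mulVf // scale1r.
Qed.

Lemma dW_Z : be = 0 -> el Wlin * Z = q ^ (-3) *: y ^+ 3.
Proof.
move=> b0; apply: phi_inj.
have e : phi (el Wlin * Z) = tev q0 G2_cocycle al be (lscale [:: (1, -3)]
    (lmul G2_cocycle (chart1_image ylin) (lmul G2_cocycle (chart1_image ylin) (chart1_image ylin)))).
  by apply: (prodP (za := false) (zb := true) phiF) => //; vm_compute.
have y3 : phi (y ^+ 3) = tev q0 G2_cocycle al be
    (lmul G2_cocycle (chart1_image ylin) (lmul G2_cocycle (chart1_image ylin) (chart1_image ylin))).
  rewrite !exprS expr0 mulr1; apply: (phi_lmul phiF); apply: (phi_lmul phiF).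
  exact: phi_lsum.
rewrite e tev_scale lev1 mul1r -y3 lrmorphZ; reflexivity.
Qed.

Lemma lowerW m n : be = 0 -> J (S4 m n.+1 0 0) -> J (S4 (m + 3) n 0 0).
Proof.
rewrite /S4 !expr0 !mulr1 => b0 /(JM (el Wlin)).
have [k k0 e] : qc (y ^+ m) (el Wlin).
  apply: qcX; apply: qc_sym; exists (q ^ 3); first exact: expfz_neq0.
  by apply: (qcommP (za := false) (zb := true) phi_inj phiF) => //; vm_compute.
have [k' k'0 ->] : exists2 k', k' != 0 & el Wlin * (y ^+ m * Z ^+ n.+1) = k' *: (y ^+ (m + 3) * Z ^+ n).
  have [l l0 e'] : qc (el Wlin) (y ^+ m) by apply: qc_sym; exists k.
  exists (l * q ^ (-3)); first by rewrite mulf_neq0 ?expfz_neq0.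
  rewrite mulrA e' exprS -scalerAl -(mulrA (y ^+ m)) (mulrA (el Wlin)) dW_Z //.
  by rewrite -scalerAl -scalerAr scalerA mulrA -exprD.
exact: JZ'.
Qed.

Lemma lowerZ_all m n : J (S4 m n 0 0) -> exists m', J (S4 m' 0 0 0).
Proof.
elim: n m => [|n IH] m h; first by exists m.
case: (eqVneq be 0) => [b0|b0]; first by apply: IH (lowerW b0 h).
exact: IH (lowerZ b0 h).
Qed.

Section AfterZ.
Hypothesis wbe : (6%:R * uu + 4%:R * vv) * be = 0.

Lemma eig_X : eg (4%:R * uu + 2%:R * vv) (el Xlin).
Proof.
have hw (l : seq nat) : all (fun i => 1 < i <= 6)%N l ->
    \sum_(i <- l) G2_weight uu vv i = 4%:R * uu + 2%:R * vv ->
    eg (4%:R * uu + 2%:R * vv) (fword F l).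
  move=> /allP hl <-; apply: eig_word => i /hl hi.
  case: (eqVneq i 2%N) => [->|i2]; first exact: (eig_F2 wbe).
  by apply: eig_weight; lia.
rewrite /Xlin !lsum_cons /lsum big_nil addr0.
apply: (eigD deltaD); apply: (eigZ deltaZ); (apply: hw; first exact: isT);
  by rewrite !big_cons big_nil /G2_weight /=; ring.
Qed.

Lemma F_1_y' : F 1%N * y = el Xlin + al *: 1.
Proof. exact: (F_1_y phi_inj phiF). Qed.

Lemma lowery m : J (S4 m.+1 0 0 0) -> J (S4 m 0 0 0).
Proof.
rewrite /S4 !expr0 !mulr1 => h.
case: (eqVneq al 0) => [a0|a0].
  have b0 : be != 0 by move: ab0; rewrite a0 eqxx.
  have e : el V0lin * y = q ^ (-5) * be *: 1.
    apply: phi_inj; rewrite lrmorphZ rmorph1.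
    have -> : phi (el V0lin * y) = tev q0 G2_cocycle al be [:: (1, (-5, (0%N, 1%N), 0))].
      by apply: (prodP (za := true) (zb := false) phiF) => //; vm_compute.
    by rewrite gev_cons gev_nil /kev expr0 expr1 mulr1 [1%:~R *: _]scale1r; apply: addr0.
  have := JM (el V0lin) h; rewrite exprS mulrA e -scalerAl mul1r.
  by apply: JZ'; rewrite mulf_neq0 ?expfz_neq0.
have s1 : y * el Xlin = q ^ (-2) *: (el Xlin * y) by apply: comm_of_check; vm_compute.
have s2 : y * (al *: 1) = q ^ 0 *: ((al *: 1) * y).
  by rewrite expr0z scale1r -scalerAl -scalerAr mul1r mulr1.
have h1 : J (1 * y ^+ m.+1) by rewrite mul1r.
have := J_lower phi_inj deltaD deltaM phiD F_1_y' rreg_y eig_X (eigZ deltaZ al (eig1 phi deltaM)) eig_y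
  (qc1 _) s1 s2 (@qpow_neq (-2) 0 m isT) h1.
by rewrite mul1r -scalerAl mul1r; apply: JZ'.
Qed.

Lemma lowery_all m : J (S4 m 0 0 0) -> J 1.
Proof.
elim: m => [|m IH] h; last by apply: IH; apply: lowery.
by move: h; rewrite /S4 !expr0 !mulr1.
Qed.

Lemma stopy : J 1 -> (4%:R * uu + 2%:R * vv) * al = 0.
Proof.
move=> h; case: (eqVneq al 0) => [->|a0]; first by rewrite mulr0.
suff -> : 4%:R * uu + 2%:R * vv = 0 by rewrite mul0r.
apply: (J_stop phi_inj deltaD deltaM phiD F_1_y' eig_X (eigZ deltaZ al (eig1 phi deltaM)) eig_y
  (qc1 _) h) => x.
rewrite mul1r => e; apply: (y_nonunit psiF (x := al^-1 *: x) a0).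
by rewrite -scalerAl e scalerA mulVf // scale1r.
Qed.

Lemma eig_F1 : (4%:R * uu + 2%:R * vv) * al = 0 -> eg (G2_weight uu vv 1) (F 1%N).
Proof.
move=> h; have eal : eg (4%:R * uu + 2%:R * vv) (al *: 1).
  rewrite /eig lrmorphZ deltaZ rmorph1.
  have := eig1 phi deltaM; rewrite /eig rmorph1 scale0r => ->.
  by rewrite scaler0 scalerA h scale0r.
have h2 := eig_quot deltaD deltaM F_1_y' rreg_y eig_X eal eig_y erefl.
by apply: (eig_cast h2); rewrite cy4 cZ5 /G2_weight /uu /vv /=; ring.
Qed.

End AfterZ.
End After5.
End After6.

Lemma derivation_weights : exists (x : A) (a b : K),
  [/\ (4%:R * a + 2%:R * b) * al = 0, (6%:R * a + 4%:R * b) * be = 0 &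
    forall i, (0 < i <= 6)%N -> D (F i) = x * F i - F i * x + G2_weight a b i *: F i].
Proof.
have [m [n [i [j /lower6_all[i' h6]]]]] := J_nonempty.
have cZ5 := stop6 h6; have [m' h5] := lower5_all cZ5 h6.
have cy4 := stop5 cZ5 h5; have [m2 hZ] := lowerZ_all cZ5 cy4 h5.
have wbe : (6%:R * (c5 - c6) + 4%:R * c6) * be = 0.
  case: (eqVneq be 0) => [->|b0]; first by rewrite mulr0.
  by rewrite (stopZ cZ5 cy4 b0 hZ) mul0r.
have h1 := lowery_all cZ5 cy4 wbe hZ.
have wal := stopy cZ5 cy4 wbe h1.
have [x ux] := h1; rewrite rmorph1 mul1r in ux.
exists x, (c5 - c6), c6; split=> // k hk; apply: phi_inj.
have ek : eg (G2_weight (c5 - c6) c6 k) (F k).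
  have : [|| k == 1, k == 2 | 2 < k <= 6]%N by lia.
  case/or3P=> [/eqP ->|/eqP ->|hk2]; [exact: eig_F1|exact: eig_F2|exact: eig_weight].
by rewrite phiD ek -ux lrmorphD lrmorphB !lrmorphM lrmorphZ.
Qed.

End Denominators.

Section Structure.
Variables (K : fieldType) (q : K) (q0 : q != 0) (al be : K) (A : algType K).
Hypothesis qnroot : forall n, (0 < n)%N -> q ^+ n != 1.
Hypothesis ab0 : (al != 0) || (be != 0).
Variables (F : nat -> A) (phi psi : {lrmorphism A -> qtorus q0 G2_cocycle}).
Hypothesis Frel : forall r, r \in rels -> lsum q (fword F) (rel_lin r) = 0.
Hypothesis FOm1 : lsum q (fword F) rel_Om1 = al%:A.
Hypothesis FOm2 : lsum q (fword F) rel_Om2 = be%:A.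
Hypothesis Fgen : generated F.
Hypothesis phiF : forall i, phi (F i) = tev q0 G2_cocycle al be (chart1 i).
Hypothesis psiF : forall i, psi (F i) = tev q0 G2_cocycle al be (chart2 i).
Local Notation t := (tmon q0 G2_cocycle).
Local Notation el := (lsum q (fword F)).

Let inj_phi : injective phi := phi_inj ab0 Frel FOm1 FOm2 Fgen phiF.

Lemma derivation_structure (D : A -> A) :
  (forall x y, D (x + y) = D x + D y) -> (forall k x, D (k *: x) = k *: D x) ->
  (forall x y, D (x * y) = D x * y + x * D y) ->
  exists (x : A) (a b : K),
  [/\ (4%:R * a + 2%:R * b) * al = 0, (6%:R * a + 4%:R * b) * be = 0 &
    forall i, (0 < i <= 6)%N -> D (F i) = x * F i - F i * x + G2_weight a b i *: F i].
Proof.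
move=> DD DZ DM.
have [u [c5 [c6 [cy [cZ [phiD e5 e6 ey eZ]]]]]] :=
  derivation_torus qnroot Fgen inj_phi phiF DD DZ DM.
apply: (derivation_weights qnroot ab0 inj_phi phiF psiF _ _ _ phiD e5 e6 ey eZ).
- by move=> x y; apply: tderD.
- by move=> k x; apply: tderZ.
- by move=> x y; apply: tderM; apply: zcharD.
Qed.

Lemma comm_coef (X : qtorus q0 G2_cocycle) g k : X * t g - t g * X = k *: t g -> k = 0.
Proof.
move=> e.
have e1 := tcfMr X g 0; have e2 := tcfMl X g 0.
rewrite add0r in e1; rewrite addr0 in e2.
have e3 := etrans (esym (tcfB (X * t g) (t g * X) g))
  (etrans (congr1 (fun x : qtorus q0 G2_cocycle => tcf x g) e) (tcfZ k (t g) g)).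
have := etrans (congr2 (fun x y : K => x - y) (esym e1) (esym e2)) e3.
by rewrite tcfM eqxx mulr1 kap0l kap0r expr0z mulr1 mul1r subrr => ->.
Qed.

Lemma comm_F5 x k : x * F 5%N - F 5%N * x = k *: F 5%N -> k = 0.
Proof.
move=> /(congr1 phi); rewrite lrmorphB !lrmorphM lrmorphZ -(lsum_letter q F 5).
have -> : phi (el (one_letter 5)) = t (0, 0, 1, 0) by apply: (phi_monomial phiF); vm_compute.
exact: comm_coef.
Qed.

Lemma comm_om (X : qtorus q0 G2_cocycle) g h : X * t g = t g * X -> tcf X h != 0 -> om G2_cocycle h g = 0.
Proof.
move=> e X0; have e1 := tcfMr X g h; have e2 := tcfMl X g h.
rewrite (addrC g) in e2.
have := etrans (esym e1) (etrans (congr1 (fun x : qtorus q0 G2_cocycle => tcf x (h + g)) e) e2).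
rewrite mulrC => /(mulIf X0)/(qexp_inj q0 qnroot) e3.
by rewrite /om e3 subrr.
Qed.

Lemma center_scalar x : (forall i, (0 < i <= 6)%N -> x * F i = F i * x) ->
  exists k : K, x = k *: 1.
Proof.
move=> cx.
have cw (w : seq nat) : all (fun i => 0 < i <= 6)%N w -> x * fword F w = fword F w * x.
  elim: w => [|i w IH]; first by rewrite /fword big_nil mulr1 mul1r.
  by case/andP=> hi /IH e; rewrite fword_cons mulrA cx // -mulrA e mulrA.
have cl r : all (fun p : lau * seq nat => all (fun i => 0 < i <= 6)%N p.2) r ->
    x * el r = el r * x.
  elim: r => [|p r IH]; first by rewrite /lsum big_nil mulr0 mul0r.
  by case/andP=> /cw e /IH e'; rewrite lsum_cons mulrDr mulrDl -scalerAr -scalerAl e e'.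
have ct (i : 'I_4) : phi x * t (torus_gen_exp i) = t (torus_gen_exp i) * phi x.
  rewrite -(phi_torus_gen phiF) -!lrmorphM cl //.
  by case: i => [[|[|[|[|]]]]].
exists (tcf (phi x) 0); apply: inj_phi; rewrite lrmorphZ rmorph1; apply: tcfP => h.
rewrite tcfZ (tcfM q0 G2_cocycle 0 h); case: (eqVneq 0 h) => [<-|h0]; first by rewrite mulr1.
rewrite mulr0; apply: contraNeq h0 => xh; apply: contraT; rewrite eq_sym => h0.
have [i] := torus_gen_separate h0; by rewrite (comm_om (ct i) xh) eqxx.
Qed.

End Structure.

(** * The algebra A_{alpha,beta} *)

Section FreeHom.
Variables (K : fieldType) (I : choiceType) (B : algType K) (g : I -> B).

Definition free_hom (x : free_alg K I) : B :=
  mlin (fun m : {fmonom I} => \prod_(i <- m) g i) x.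

Lemma free_hom_linear : linear free_hom.
Proof. exact: mlin_linear. Qed.

Lemma free_homU (m : {fmonom I}) : free_hom << m >> = \prod_(i <- m) g i.
Proof. by rewrite /free_hom mlinU scale1r. Qed.

Lemma free_hom_gen i : free_hom (free_gen K i) = g i.
Proof. by rewrite free_homU fmU big_seq1. Qed.

Lemma free_hom1 : free_hom 1 = 1.
Proof. by rewrite [LHS](free_homU (@mone {fmonom I})) fm1 big_nil. Qed.

Lemma free_homM x y : free_hom (x * y) = free_hom x * free_hom y.
Proof.
move: x; apply: (eq_malg_linear (f := fun x => free_hom (x * y))
  (f' := fun x => free_hom x * free_hom y)) => [k x x'|k x x'|m].
- by rewrite [(_ + _) * y]mulrDl -scalerAl free_hom_linear.
- by rewrite free_hom_linear mulrDl scalerAl.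
move: y; apply: (eq_malg_linear (f := fun y => free_hom (<< m >> * y))
  (f' := fun y => free_hom << m >> * free_hom y)) => [k y y'|k y y'|m'].
- by rewrite mulrDr -[X in free_hom (X + _)]fmalg_scaleAr free_hom_linear.
- by rewrite free_hom_linear mulrDr scalerAr.
rewrite !free_homU.
have -> : (<< m >> : free_alg K I) * << m' >> = << mmul m m' >>.
  by apply: (etrans (fgmulUU 1 1 m m')); rewrite mulr1.
by rewrite free_homU fmM big_cat.
Qed.

End FreeHom.

Lemma free_alg_ind (K : fieldType) (I : choiceType) (P : free_alg K I -> Prop) :
  P 1 -> (forall x y, P x -> P y -> P (x + y)) -> (forall k x, P x -> P (k *: x)) ->
  (forall i x, P x -> P (free_gen K i * x)) -> forall x, P x.
Proof.
move=> P1 PD PZ PM x; rewrite (malg_span x).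
apply: (big_ind P) => [||m _]; [by rewrite -(scale0r 1); apply: PZ | exact: PD | apply: PZ].
case: m => s; elim: s => [|i s IH].
  by have -> : FMonom [::] = @mone {fmonom I} by apply: val_inj; rewrite /= fm1.
have -> : << FMonom (i :: s) >> = free_gen K i * << FMonom s >> :> free_alg K I; last exact: PM.
apply: esym; apply: (etrans (fgmulUU 1 1 (fmu i) (FMonom s))); rewrite mulr1.
by have -> : FMonom (i :: s) = mmul (fmu i) (FMonom s) by apply: val_inj; rewrite /= fmM fmU.
Qed.

Section Lift.
Variables (K : fieldType) (B C : algType K) (S : B -> Prop) (f : B -> C).
Hypotheses (fl : linear f) (fM : forall x y, f (x * y) = f x * f y) (f1 : f 1 = 1).
Hypothesis fS : forall s, S s -> f s = 0.

Lemma quot_lift : exists f' : alg_quot S -> C, [/\ linear f',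
  forall x y, f' (x * y) = f' x * f' y, f' 1 = 1 & forall x, f' (alg_class S x) = f x].
Proof.
have f0 : f 0 = 0 by have := fl (-1) 0 0; rewrite !scaleN1r oppr0 addr0 addNr.
have fD x y : f (x + y) = f x + f y by have := fl 1 x y; rewrite !scale1r.
have fI x : x \in ideal S -> f x = 0.
  move=> /asboolP; elim=> [//|a s b y Ss _ IH].
  by rewrite fD !fM (fS Ss) mulr0 mul0r add0r.
pose f' (c : alg_quot S) := f (repr c).
have fE x : f' (alg_class S x) = f x.
  apply/eqP; rewrite -subr_eq0; apply/eqP.
  have -> : f' (alg_class S x) - f x = f (repr (alg_class S x) - x).
    by rewrite -scaleN1r addrC -fl scaleN1r addrC.
  by apply: fI; apply/alg_class_eqP; rewrite /alg_class /mod_class reprK.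
exists f'; split=> //.
- move=> k c d; have [x ->] := alg_class_surj c; have [y ->] := alg_class_surj d.
  by rewrite -alg_classZ -linearD !fE fl.
- move=> c d; have [x ->] := alg_class_surj c; have [y ->] := alg_class_surj d.
  by rewrite -alg_classMr !fE fM.
- by rewrite -[1]/(alg_class S 1) fE.
Qed.

End Lift.

Definition gen_scale (K : fieldType) (q : K) (i : nat) : K :=
  let n := q ^+ 4 + q ^+ 2 + 1 in
  nth 0 [:: 0; q ^+ 9 / (q ^+ 2 - 1); q ^+ 9 / n; 1; (q ^+ 2 - 1) / n; 1; q ^+ 9 / n] i.

Section Rescaling.
Variables (K : fieldType) (q : K) (q0 : q != 0) (B : algType K).
Hypothesis qnroot : forall n, (0 < n)%N -> q ^+ n != 1.
Variables (E F : nat -> B).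
Hypothesis EF : forall i, (0 < i <= 6)%N -> E i = gen_scale q i *: F i.
Local Notation el := (lsum q (fword F)).

Lemma q2_neq : q ^+ 2 - 1 != 0.
Proof. by rewrite subr_eq0 qnroot. Qed.
Lemma q2_neq' : 1 + -1 * q ^+ 2 != 0.
Proof. by rewrite mulN1r -opprB oppr_eq0 q2_neq. Qed.
Lemma q6_neq : q ^+ 6 - 1 != 0.
Proof. by rewrite subr_eq0 qnroot. Qed.
Lemma qn_neq : q ^+ 4 + q ^+ 2 + 1 != 0.
Proof.
apply: contraNneq q6_neq => n0.
have -> : q ^+ 6 - 1 = (q ^+ 2 - 1) * (q ^+ 4 + q ^+ 2 + 1) by ring.
by rewrite n0 mulr0.
Qed.

Lemma mu_neq0 i : (0 < i <= 6)%N -> gen_scale q i != 0.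
Proof.
case: i => [|[|[|[|[|[|[|]]]]]]] // _; rewrite /gen_scale /= ?oner_neq0 //.
all: by rewrite mulf_neq0 ?invr_neq0 ?expf_neq0 ?q2_neq ?qn_neq.
Qed.

Lemma word2 i j : (0 < i <= 6)%N -> (0 < j <= 6)%N ->
  E i * E j = (gen_scale q i * gen_scale q j) *: fword F [:: i; j].
Proof. by move=> hi hj; rewrite !EF // fword2 -scalerAl -scalerAr scalerA. Qed.

Lemma word1 i : (0 < i <= 6)%N -> E i = gen_scale q i *: fword F [:: i].
Proof. by move=> hi; rewrite EF // fword1. Qed.

Lemma wordX2 i : (0 < i <= 6)%N -> E i ^+ 2 = gen_scale q i ^+ 2 *: fword F [:: i; i].
Proof. by move=> hi; rewrite EF // exprZn fword2 (expr2 (F i)). Qed.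

Lemma wordX3 i : (0 < i <= 6)%N -> E i ^+ 3 = gen_scale q i ^+ 3 *: fword F [:: i; i; i].
Proof.
by move=> hi; rewrite EF // exprZn !fword_cons /fword big_nil mulr1 !(exprS (F i)) expr0 mulr1.
Qed.

Lemma levE (l : lau) : lev q l = foldr (fun p x => p.1%:~R * q ^ p.2 + x) 0 l.
Proof. by rewrite /lev; elim: l => [|p l IH]; rewrite ?big_nil // big_cons IH. Qed.

Ltac int_powers :=
  repeat match goal with |- context [@exprz ?R ?x ?z] =>
    let z' := eval vm_compute in z in
    lazymatch z' with
    | Posz ?n => change (@exprz R x z) with (x ^+ n)
    | Negz ?n => change (@exprz R x z) with (x ^- n.+1)
    end end.
Ltac int_consts :=
  repeat match goal with |- context [@intmul ?R 1 ?z] =>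
    let z' := eval vm_compute in z in
    lazymatch z' with
    | Posz ?n => change (@intmul R 1 z) with (n%:R : R)
    | Negz ?n => change (@intmul R 1 z) with (- n.+1%:R : R)
    end end.
Ltac scalar_tac := int_powers; int_consts; rewrite /gen_scale /=; field;
  rewrite ?q0 ?q2_neq ?qn_neq ?q6_neq ?q2_neq'.
Ltac lin_tac := lazymatch goal with
  | |- _ *: _ + _ = _ => apply: f_equal2; [congr (_ *: _) | lin_tac]
  | |- _ *: _ = _ => congr (_ *: _) end.

Lemma G2_rescaled : foldr (fun p Q => (exists2 c : K, c != 0 &
    p.1.1 - p.1.2 = c *: el (rel_lin p.2)) /\ Q) True (zip (G2_relations q E) rels).
Proof.
rewrite /G2_relations /rels.
rewrite !word2 // !wordX2 // !wordX3 // ?(word1 (i := 2)) // ?(word1 (i := 3)) //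
  ?(word1 (i := 4)) // ?(word1 (i := 5)) // /=.
repeat match goal with |- (exists2 _, _ & _) /\ _ => split | |- True => exact: I end.
all: match goal with |- exists2 c, _ & _ *: fword F [:: ?j; ?i] - _ = _ =>
  exists (gen_scale q j * gen_scale q i); first by rewrite mulf_neq0 ?mu_neq0 end.
all: rewrite !lsum_cons /lsum big_nil addr0 !levE /=.
all: rewrite !scalerA ?scalerDr !scalerA !opprD ?opprK -?scaleNr -?addrA.
all: lin_tac.
all: by scalar_tac.
Qed.

Lemma word_mul (a b : K) (w v : seq nat) :
  (a *: fword F w) * (b *: fword F v) = (a * b) *: fword F (w ++ v).
Proof. by rewrite -scalerAl -scalerAr scalerA fword_cat. Qed.

Lemma Omega1_rescaled :
  Omega1_expr q E = (gen_scale q 1 * gen_scale q 3 * gen_scale q 5) *: el rel_Om1.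
Proof.
rewrite /Omega1_expr !wordX2 // (word1 (i := 1)) // (word1 (i := 2)) // (word1 (i := 3)) //
  (word1 (i := 4)) // (word1 (i := 5)) // !word_mul [_ ++ _]/=.
rewrite !lsum_cons /lsum big_nil addr0 !levE /= !scalerA ?scalerDr !scalerA -!addrA.
lin_tac.
all: by scalar_tac.
Qed.

Lemma Omega2_rescaled :
  Omega2_expr q E = (gen_scale q 2 * gen_scale q 4 * gen_scale q 6) *: el rel_Om2.
Proof.
rewrite /Omega2_expr !wordX2 // !wordX3 // (word1 (i := 2)) // (word1 (i := 3)) //
  (word1 (i := 4)) // (word1 (i := 5)) // (word1 (i := 6)) // !word_mul [_ ++ _]/=.
rewrite !lsum_cons /lsum big_nil addr0 !levE /= !scalerA ?scalerDr !scalerA -!addrA.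
lin_tac.
all: by scalar_tac.
Qed.
End Rescaling.

Section AlgebraMaps.
Variables (K : fieldType) (q : K) (R R' : algType K) (h : R -> R').
Hypotheses (hl : linear h) (hM : forall x y, h (x * y) = h x * h y) (h1 : h 1 = 1).

Let hD x y : h (x + y) = h x + h y.
Proof. by have := hl 1 x y; rewrite !scale1r. Qed.
Let h0 : h 0 = 0.
Proof. by apply: (addrI (h 0)); rewrite -hD !addr0. Qed.
Let hZ k x : h (k *: x) = k *: h x.
Proof. by have := hl k x 0; rewrite !addr0 h0 addr0. Qed.
Let hN x : h (- x) = - h x.
Proof. by rewrite -scaleN1r hZ scaleN1r. Qed.
Let hX x n : h (x ^+ n) = h x ^+ n.
Proof. by elim: n => [|n IH]; rewrite ?expr0 // !exprS hM IH. Qed.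

Lemma G2_relations_map (E : nat -> R) :
  G2_relations q (fun i => h (E i)) = [seq (h r.1, h r.2) | r <- G2_relations q E].
Proof. by rewrite /G2_relations /= !(hD, hN, hZ, hM, hX). Qed.

Lemma Omega1_map (E : nat -> R) : Omega1_expr q (fun i => h (E i)) = h (Omega1_expr q E).
Proof. by rewrite /Omega1_expr !(hD, hZ, hM, hX). Qed.

Lemma Omega2_map (E : nat -> R) : Omega2_expr q (fun i => h (E i)) = h (Omega2_expr q E).
Proof. by rewrite /Omega2_expr !(hD, hZ, hM, hX). Qed.

Lemma lrmorphism_of : exists phi : {lrmorphism R -> R'}, phi =1 h.
Proof.
pose Lm := GRing.isLinear.Build K R R' *:%R h hl.
pose Mm := GRing.isMonoidMorphism.Build R R' h (h1, hM).
pose phi : {lrmorphism R -> R'} := HB.pack h Lm Mm.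
by exists phi.
Qed.

End AlgebraMaps.

Definition alpha_of (K : fieldType) (q alpha : K) := alpha / (gen_scale q 1 * gen_scale q 3 * gen_scale q 5).
Definition beta_of (K : fieldType) (q beta : K) := beta / (gen_scale q 2 * gen_scale q 4 * gen_scale q 6).

Section AquotHom.
Variables (K : fieldType) (q : K) (q0 : q != 0).
Hypothesis qnroot : forall n, (0 < n)%N -> q ^+ n != 1.
Variables (alpha beta : K) (B : algType K) (F : nat -> B).
Hypothesis Frel : forall r, r \in rels -> lsum q (fword F) (rel_lin r) = 0.
Hypothesis FOm1 : lsum q (fword F) rel_Om1 = (alpha_of q alpha)%:A.
Hypothesis FOm2 : lsum q (fword F) rel_Om2 = (beta_of q beta)%:A.

Lemma mu135_neq0 : gen_scale q 1 * gen_scale q 3 * gen_scale q 5 != 0.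
Proof. by have m := mu_neq0 q0 qnroot; rewrite mulf_neq0 ?m // mulf_neq0 ?m. Qed.

Lemma mu246_neq0 : gen_scale q 2 * gen_scale q 4 * gen_scale q 6 != 0.
Proof. by have m := mu_neq0 q0 qnroot; rewrite mulf_neq0 ?m // mulf_neq0 ?m. Qed.

Lemma Aquot_hom : exists f : Aquot q alpha beta -> B, [/\ linear f,
  forall x y, f (x * y) = f x * f y, f 1 = 1 &
  forall i, (0 < i <= 6)%N -> f (e q alpha beta i) = gen_scale q i *: F i].
Proof.
pose g (j : 'I_6) := gen_scale q j.+1 *: F j.+1; pose h := @free_hom K _ B g.
have hl : linear h := @free_hom_linear _ _ _ g.
have hM := @free_homM _ _ _ g; have h1 := @free_hom1 _ _ _ g.
have hE i : (0 < i <= 6)%N -> h (free_E K i) = gen_scale q i *: F i.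
  by case: i => // i hi; rewrite /h /free_E free_hom_gen /g inordK.
have hrel x : G2_relators q x -> h x = 0.
  case=> r rin ->; have hD : h (r.1 - r.2) = h r.1 - h r.2.
    by rewrite -[- r.2]scaleN1r addrC hl scaleN1r addrC.
  rewrite hD; pose r' := (h r.1, h r.2).
  have r'in : r' \in G2_relations q (fun i => h (free_E K i)).
    by rewrite (G2_relations_map q hl hM h1); apply/mapP; exists r.
  have := in_foldrP (G2_rescaled q0 qnroot hE).
  pose i := index r' (G2_relations q (fun i => h (free_E K i))).
  have szi : (i < size (G2_relations q (fun i => h (free_E K i))))%N by rewrite index_mem.
  have zin : (r', nth (0%N, 0%N, 0, [::]) rels i) \in
      zip (G2_relations q (fun i => h (free_E K i))) rels.
    have -> : (r', nth (0%N, 0%N, 0, [::]) rels i) =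
       nth (r', (0%N, 0%N, 0, [::])) (zip (G2_relations q (fun i => h (free_E K i))) rels) i.
      by rewrite nth_zip // nth_index.
    by apply: mem_nth; rewrite size_zip; exact: szi.
  move=> /(_ _ zin) [c c0 /= ->].
  by rewrite Frel ?scaler0 // mem_nth.
have [f0 [f0l f0M f01 f0E]] := quot_lift hl hM h1 hrel.
pose f1 : UqG2 q -> B := f0.
have f1l : linear f1 := f0l.
have f1M (x y : UqG2 q) : f1 (x * y) = f1 x * f1 y := f0M x y.
have f11 : f1 1 = 1 := f01.
have f1E x : f1 (alg_class (G2_relators q) x) = h x := f0E x.
have f1e i : (0 < i <= 6)%N -> f1 (E q i) = gen_scale q i *: F i by move=> hi; rewrite f1E hE.
have f1C (x : UqG2 q) k y : f1 x = k *: y -> y = 1 -> f1 (x - k%:A) = 0.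
  by move=> fx y1; rewrite addrC -scaleNr f1l f11 fx y1 scaleNr addNr.
have frel x : A_relators q alpha beta x -> f1 x = 0.
  case=> ->; apply: (f1C _ _ 1) => //.
    rewrite /Omega1 -(Omega1_map q f1l f1M f11) (Omega1_rescaled q0 qnroot f1e) FOm1.
    by rewrite scalerA mulrC divfK ?mu135_neq0.
  rewrite /Omega2 -(Omega2_map q f1l f1M f11) (Omega2_rescaled q0 qnroot f1e) FOm2.
  by rewrite scalerA mulrC divfK ?mu246_neq0.
have [f [fl fM f11' fE]] := quot_lift f1l f1M f11 frel.
by exists f; split=> // i hi; rewrite fE f1e.
Qed.

End AquotHom.

Section ChartPoints.
Variables (K : fieldType) (q : K) (q0 : q != 0) (al be : K) (ch : nat -> seq tterm).
Local Notation tev := (tev q0 G2_cocycle al be).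

Lemma chart_rels : all (fun r => llin G2_cocycle ch (rel_lin r) == [::]) rels ->
  forall r, r \in rels -> lsum q (fword (fun i => tev (ch i))) (rel_lin r) = 0.
Proof. by move=> /allP ok r /ok/eqP e; rewrite -tev_lin e gev_nil. Qed.

Lemma chart_Om1 r : llin G2_cocycle ch r = [:: mk_tterm 0 1 0 0 0 0 0] ->
  lsum q (fword (fun i => tev (ch i))) r = al *: 1.
Proof.
move=> e; rewrite -tev_lin e gev_cons gev_nil /kev expr0z expr0 expr1 mul1r mulr1.
by rewrite [1%:~R *: _]scale1r; apply: addr0.
Qed.

Lemma chart_Om2 r : llin G2_cocycle ch r = [:: mk_tterm 0 0 1 0 0 0 0] ->
  lsum q (fword (fun i => tev (ch i))) r = be *: 1.
Proof.
move=> e; rewrite -tev_lin e gev_cons gev_nil /kev expr0z expr0 expr1 mul1r mul1r.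
by rewrite [1%:~R *: _]scale1r; apply: addr0.
Qed.

End ChartPoints.

(* [Aquot q alpha beta] is only known to be a possibly zero ring; the alias records
   a proof of 1 != 0, which makes it an [algType]. *)
Definition Anz (K : fieldType) (q alpha beta : K) of
  (1 != 0 :> Aquot q alpha beta) := Aquot q alpha beta.

Section NonZeroQuotient.
Variables (K : fieldType) (q alpha beta : K) (nz : 1 != 0 :> Aquot q alpha beta).
HB.instance Definition _ := GRing.Lmodule.on (Anz nz).
HB.instance Definition _ := GRing.PzRing.on (Anz nz).
HB.instance Definition _ := GRing.PzSemiRing_isNonZero.Build (Anz nz) nz.
HB.instance Definition _ := GRing.Lmodule_isLalgebra.Build K (Anz nz)
  (@alg_scaleAl _ _ (A_relators q alpha beta)).
HB.instance Definition _ := GRing.Lalgebra_isAlgebra.Build K (Anz nz)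
  (@alg_scaleAr _ _ (A_relators q alpha beta)).
End NonZeroQuotient.

Section Aquot.
Variables (K : fieldType) (q : K) (q0 : q != 0).
Hypothesis qnroot : forall n, (0 < n)%N -> q ^+ n != 1.
Variables (alpha beta : K).
Local Notation R := (A_relators q alpha beta).
Local Notation AQ := (Aquot q alpha beta).
Local Notation e := (e q alpha beta).
Local Notation al := (alpha_of q alpha).
Local Notation be := (beta_of q beta).
Local Notation T := (qtorus q0 G2_cocycle).

Lemma Aquot_ind (P : AQ -> Prop) : P 1 -> (forall x y, P x -> P y -> P (x + y)) ->
  (forall k x, P x -> P (k *: x)) ->
  (forall i x, (0 < i <= 6)%N -> P x -> P (e i * x)) -> forall x, P x.
Proof.
move=> P1 PD PZ PM x; have [x1 ->] := alg_class_surj x; have [z ->] := alg_class_surj x1.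
pose c (z : free_alg K 'I_6) : AQ := alg_class R (alg_class (G2_relators q) z).
rewrite -/(c z); elim/free_alg_ind: z => [|u v Pu Pv|k u Pu|i u Pu]; rewrite /c.
- exact: P1.
- by rewrite linearD linearD; apply: PD.
- by rewrite alg_classZ alg_classZ; apply: PZ.
rewrite alg_classMr alg_classMr.
have -> : free_gen K i = free_E K i.+1 by rewrite /free_E /= inord_val.
by apply: PM => //=; exact: ltn_ord.
Qed.

Lemma Aquot_to_torus (ch : nat -> seq tterm) :
  all (fun r => llin G2_cocycle ch (rel_lin r) == [::]) rels ->
  llin G2_cocycle ch rel_Om1 = [:: mk_tterm 0 1 0 0 0 0 0] -> llin G2_cocycle ch rel_Om2 = [:: mk_tterm 0 0 1 0 0 0 0] ->
  exists f : AQ -> T, [/\ linear f, forall x y, f (x * y) = f x * f y, f 1 = 1 &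
  forall i, (0 < i <= 6)%N -> f (e i) = gen_scale q i *: tev q0 G2_cocycle al be (ch i)].
Proof.
move=> h1 h2 h3; apply: (Aquot_hom (F := fun i => tev q0 G2_cocycle al be (ch i)) q0 qnroot).
- exact: chart_rels.
- exact: chart_Om1.
- exact: chart_Om2.
Qed.

Lemma Aquot_neq0 : 1 != 0 :> AQ.
Proof.
have [f [fl _ f1 _]] := Aquot_to_torus chart1_rels chart1_Om1 chart1_Om2.
apply/eqP => /(congr1 f); rewrite f1.
have -> : f 0 = 0 by have := fl (-1) 0 0; rewrite !scaleN1r oppr0 addr0 addNr.
by apply/eqP; apply: oner_neq0.
Qed.

Let A := Anz Aquot_neq0.
Let F (i : nat) : A := if (0 < i <= 6)%N then (gen_scale q i)^-1 *: (e i : A) else 0.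

Lemma e_mu i : (0 < i <= 6)%N -> (e i : A) = gen_scale q i *: F i.
Proof. by move=> hi; rewrite /F hi scalerA mulfV ?scale1r // (mu_neq0 q0 qnroot). Qed.

Lemma F_generated : generated F.
Proof.
move=> P P1 PD PZ PM x; apply: (Aquot_ind (P := P)) x => // i x hi Px.
have -> : e i * x = gen_scale q i *: (F i * (x : A)) by rewrite scalerAl -e_mu.
by apply/PZ/PM.
Qed.

Let cl (z : free_alg K 'I_6) : A := alg_class R (alg_class (G2_relators q) z).
Let cl_linear : linear cl.
Proof. by move=> k x y; rewrite /cl linearP linearP. Qed.
Let clM x y : cl (x * y) = cl x * cl y.
Proof. by rewrite /cl alg_classMr; exact: alg_classMr. Qed.

Lemma F_rels r : r \in rels -> lsum q (fword F) (rel_lin r) = 0.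
Proof.
move=> rin; have hE := in_foldrP (G2_rescaled q0 qnroot e_mu).
pose i := index r rels.
have szi : (i < size rels)%N by rewrite index_mem.
pose z0 : A * A := (0, 0).
have zin : (nth z0 (G2_relations q (e : nat -> A)) i, r) \in zip (G2_relations q (e : nat -> A)) rels.
  have -> : (nth z0 (G2_relations q (e : nat -> A)) i, r) =
      nth (z0, r) (zip (G2_relations q (e : nat -> A)) rels) i.
    by rewrite nth_zip // nth_index.
  by apply: mem_nth; rewrite size_zip; exact: szi.
have [c c0 /= ec] := hE _ zin.
suff : c *: lsum q (fword F) (rel_lin r) = 0.
  by move/eqP; rewrite scaler_eq0 (negPf c0) => /eqP.
rewrite -ec; have : nth z0 (G2_relations q (e : nat -> A)) i \in G2_relations q (e : nat -> A).
  by apply: mem_nth; exact: szi.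
rewrite -[e : nat -> A]/(fun i => cl (free_E K i)) (G2_relations_map q cl_linear clM (erefl _)).
case/mapP=> s sin -> /=; apply/eqP; rewrite subr_eq0; apply/eqP.
congr (alg_class R _); apply/alg_class_eqP; apply: mem_ideal; by exists s.
Qed.

Let cl1 (z : UqG2 q) : A := alg_class R z.
Let cl1_linear : linear cl1.
Proof. by move=> k x y; rewrite /cl1 linearP. Qed.
Let cl1M x y : cl1 (x * y) = cl1 x * cl1 y.
Proof. exact: alg_classMr. Qed.
Let cl1A (k : K) : cl1 k%:A = k *: 1.
Proof. exact: alg_classZ. Qed.

Lemma F_Om1 : lsum q (fword F) rel_Om1 = al%:A.
Proof.
have := Omega1_rescaled q0 qnroot e_mu.
rewrite -[e : nat -> A]/(fun i => cl1 (E q i)) (Omega1_map q cl1_linear cl1M (erefl _)).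
have -> : cl1 (Omega1_expr q (E q)) = alpha *: 1.
  by rewrite -cl1A; apply/alg_class_eqP; apply: mem_ideal; left.
move=> h; apply: (scalerI (mu135_neq0 q0 qnroot)); rewrite -h scalerA /alpha_of.
by rewrite mulrC divfK // (mu135_neq0 q0 qnroot).
Qed.

Lemma F_Om2 : lsum q (fword F) rel_Om2 = be%:A.
Proof.
have := Omega2_rescaled q0 qnroot e_mu.
rewrite -[e : nat -> A]/(fun i => cl1 (E q i)) (Omega2_map q cl1_linear cl1M (erefl _)).
have -> : cl1 (Omega2_expr q (E q)) = beta *: 1.
  by rewrite -cl1A; apply/alg_class_eqP; apply: mem_ideal; right.
move=> h; apply: (scalerI (mu246_neq0 q0 qnroot)); rewrite -h scalerA /beta_of.
by rewrite mulrC divfK // (mu246_neq0 q0 qnroot).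
Qed.

Lemma F_chart (ch : nat -> seq tterm) :
  all (fun r => llin G2_cocycle ch (rel_lin r) == [::]) rels ->
  llin G2_cocycle ch rel_Om1 = [:: mk_tterm 0 1 0 0 0 0 0] -> llin G2_cocycle ch rel_Om2 = [:: mk_tterm 0 0 1 0 0 0 0] ->
  (forall i, ~~ (0 < i <= 6)%N -> ch i = [::]) ->
  exists phi : {lrmorphism A -> T}, forall i, phi (F i) = tev q0 G2_cocycle al be (ch i).
Proof.
move=> h1 h2 h3 h4; have [f [fl fM f1 fe]] := Aquot_to_torus h1 h2 h3.
pose f' : A -> T := f.
have f'l : linear f' := fl.
have f'M (x y : A) : f' (x * y) = f' x * f' y := fM x y.
have [phi phiE] := lrmorphism_of f'l f'M f1; exists phi => i.
rewrite /F; case: ifP => hi.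
  rewrite lrmorphZ phiE /f' fe // [LHS]scalerA mulVf ?(mu_neq0 q0 qnroot) //.
  exact: scale1r.
by rewrite rmorph0 h4 ?hi // gev_nil.
Qed.

Hypothesis ab0 : (alpha != 0) || (beta != 0).

Lemma albe0 : (al != 0) || (be != 0).
Proof.
rewrite /alpha_of /beta_of !mulf_eq0 !invr_eq0.
by rewrite (negPf (mu135_neq0 q0 qnroot)) (negPf (mu246_neq0 q0 qnroot)) !orbF.
Qed.

Lemma chart_out1 i : ~~ (0 < i <= 6)%N -> chart1 i = [::].
Proof. by case: i => [|[|[|[|[|[|[|]]]]]]]. Qed.

Lemma chart_out2 i : ~~ (0 < i <= 6)%N -> chart2 i = [::].
Proof. by case: i => [|[|[|[|[|[|[|]]]]]]]. Qed.

Lemma Aquot_derivation (D : derivation R) : exists (x : AQ) (a b : K),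
  [/\ (4%:R * a + 2%:R * b) * alpha = 0, (6%:R * a + 4%:R * b) * beta = 0 &
    forall i, (0 < i <= 6)%N -> D (e i) = x * e i - e i * x + G2_weight a b i *: e i].
Proof.
have [phi phiF] := F_chart chart1_rels chart1_Om1 chart1_Om2 chart_out1.
have [psi psiF] := F_chart chart2_rels chart2_Om1 chart2_Om2 chart_out2.
have [Dl DM] := derivationP D; pose D' : A -> A := D.
have D'l : linear D' := Dl.
have D'M (x y : A) : D' (x * y) = D' x * y + x * D' y := DM x y.
have D'D (x y : A) : D' (x + y) = D' x + D' y by have := D'l 1 x y; rewrite !scale1r.
have D'0 : D' 0 = 0 by apply: (addrI (D' 0)); rewrite -D'D !addr0.
have D'Z k (x : A) : D' (k *: x) = k *: D' x by have := D'l k x 0; rewrite !addr0 D'0 addr0.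
have [x [a [b [ha hb hD]]]] := derivation_structure qnroot albe0 F_rels F_Om1 F_Om2
  F_generated phiF psiF D'D D'Z D'M.
exists x, a, b; split.
- move/eqP: ha; rewrite /alpha_of mulrA mulf_eq0 invr_eq0.
  by rewrite (negPf (mu135_neq0 q0 qnroot)) orbF => /eqP.
- move/eqP: hb; rewrite /beta_of mulrA mulf_eq0 invr_eq0.
  by rewrite (negPf (mu246_neq0 q0 qnroot)) orbF => /eqP.
move=> i hi; have := hD i hi; set xA : A := x.
have m0 := mu_neq0 q0 qnroot hi.
move=> /(congr1 (fun z => gen_scale q i *: z)); rewrite -D'Z -e_mu // => h.
apply: (etrans h); rewrite scalerDr scalerBr scalerAr scalerAl -e_mu //.
by rewrite !scalerA mulrC -scalerA -e_mu.
Qed.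

Lemma Aquot_comm5 (x : AQ) k : x * e 5%N - e 5%N * x = k *: e 5%N -> k = 0.
Proof.
have [phi phiF] := F_chart chart1_rels chart1_Om1 chart1_Om2 chart_out1.
move=> h; apply: (comm_F5 phiF (x := x : A)).
have m0 : gen_scale q 5 != 0 := mu_neq0 q0 qnroot (isT : (0 < 5 <= 6)%N).
apply: (scalerI m0); rewrite scalerBr scalerAr scalerAl -e_mu //.
by rewrite scalerA mulrC -scalerA -e_mu.
Qed.

Lemma Aquot_center (x : AQ) : (forall i, (0 < i <= 6)%N -> x * e i = e i * x) ->
  exists k : K, x = k *: (1 : AQ).
Proof.
have [phi phiF] := F_chart chart1_rels chart1_Om1 chart1_Om2 chart_out1.
move=> h; apply: (center_scalar qnroot albe0 F_rels F_Om1 F_Om2 F_generated phiF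
  (x := x : A)) => i hi.
have m0 := mu_neq0 q0 qnroot hi.
by apply: (scalerI m0); rewrite scalerAr scalerAl -e_mu //; apply: h.
Qed.

Lemma derivation_eq (D D' : derivation R) :
  (forall i, (0 < i <= 6)%N -> D (e i) = D' (e i)) -> D = D'.
Proof.
move=> h; have [Dl DM] := derivationP D; have [Dl' DM'] := derivationP D'.
have d1 (E : derivation R) : E 1 = 0.
  have [_ EM] := derivationP E; have := EM 1 1; rewrite !mulr1 mul1r => e1.
  by apply: (addrI (E 1)); rewrite -e1 addr0.
have dD (E : derivation R) x y : E (x + y) = E x + E y.
  by have [El _] := derivationP E; have := El 1 x y; rewrite !scale1r.
have d0 (E : derivation R) : E 0 = 0 by apply: (addrI (E 0)); rewrite -dD !addr0.
have dZ (E : derivation R) k x : E (k *: x) = k *: E x.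
  by have [El _] := derivationP E; have := El k x 0; rewrite !addr0 d0 addr0.
apply: derivation_ext => x; elim/Aquot_ind: x => [|x y hx hy|k x hx|i x hi hx].
- by rewrite !d1.
- by rewrite !dD hx hy.
- by rewrite !dZ hx.
- by rewrite DM DM' h // hx.
Qed.

End Aquot.

Lemma commutatorB (R : pzRingType) (x y z : R) :
  (x - y) * z - z * (x - y) = (x * z - z * x) - (y * z - z * y).
Proof. by rewrite mulrBl mulrBr !opprD !opprK addrACA. Qed.

Section Decomposition.
Variables (K : fieldType) (q : K) (q0 : q != 0).
Hypothesis qnroot : forall n, (0 < n)%N -> q ^+ n != 1.
Variables (alpha beta : K).
Hypothesis ab0 : (alpha != 0) || (beta != 0).
Local Notation R := (A_relators q alpha beta).
Local Notation AQ := (Aquot q alpha beta).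
Local Notation e := (e q alpha beta).

Lemma ad_eq (x y : AQ) : ad x = ad y :> derivation R <-> exists c : K, y = x + c *: (1 : AQ).
Proof.
split=> [h|[c ->]].
  have [i _|c yx] := Aquot_center q0 qnroot ab0 (x := y - x).
    have hi : ad x (e i) = ad y (e i) by rewrite h.
    apply/eqP; rewrite -subr_eq0; apply/eqP.
    by rewrite commutatorB -!adE hi subrr.
  by exists c; rewrite -yx addrC subrK.
apply: derivation_ext => z; rewrite !adE mulrDl mulrDr -alg_scaleAl -alg_scaleAr.
by rewrite mul1r mulr1 opprD addrACA subrr addr0.
Qed.

Lemma ad_scale_eq (theta : derivation R) (x y : AQ) (lam nu : K) :
  theta (e 5%N) = e 5%N ->
  ad x + lam *: theta = ad y + nu *: theta <->
  nu = lam /\ exists c : K, y = x + c *: (1 : AQ).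
Proof.
move=> t5; split=> [h|[-> /ad_eq -> //]].
have nl : nu = lam.
  apply/eqP; rewrite -subr_eq0; apply/eqP; apply: (Aquot_comm5 q0 qnroot (x := x - y)).
  have h5 : (ad x + lam *: theta) (e 5%N) = (ad y + nu *: theta) (e 5%N) by rewrite h.
  move: h5; rewrite !derivationDE !derivationZE t5 commutatorB -!adE => h5.
  have -> : ad x (e 5%N) = ad y (e 5%N) + nu *: e 5%N - lam *: e 5%N by rewrite -h5 addrK.
  by rewrite scalerBl -(addrA (ad y (e 5%N))) [LHS]addrC addKr.
split=> //; apply/ad_eq; move: h; rewrite nl; exact: addIr.
Qed.

Lemma HH1_line (theta : derivation R) : theta (e 5%N) = e 5%N ->
  (forall D : derivation R, exists (x : AQ) (lam : K), D = ad x + lam *: theta) ->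
  forall h : HH1 R, exists! lam : K, h = lam *: HH1_class theta.
Proof.
move=> t5 dec h; have [D ->] := mod_class_surj h; have [x [lam ->]] := dec D.
have cl k : k *: HH1_class theta = mod_class (@inner K (UqG2 q) R) (k *: theta).
  by rewrite [RHS]linearZ.
exists lam; split.
  rewrite cl; apply/mod_class_eqP; rewrite addrK; apply/asboolP; by exists x.
move=> nu; rewrite cl => /mod_class_eqP/asboolP[z].
rewrite -addrA -scalerBl => hz.
have : ad x + (lam - nu) *: theta = ad z + 0 *: theta by rewrite hz scale0r addr0.
by case/(ad_scale_eq _ _ _ _ t5) => /esym/eqP; rewrite subr_eq0 => /eqP.
Qed.

End Decomposition.

Theorem theorem5p12 (K : fieldType) (q : K)
    (q_neq0 : q != 0)
    (q_not_root_of_unity : forall n : nat, (0 < n)%N -> q ^+ n != 1)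
    (two_neq0 : 2%:R != 0 :> K) :
  [/\ forall alpha beta : K, alpha != 0 -> beta != 0 ->
        forall D : derivation (A_relators q alpha beta),
        exists x : Aquot q alpha beta, forall y : Aquot q alpha beta,
          D = ad y <-> exists c : K, y = x + c *: (1 : Aquot q alpha beta),

      forall alpha : K, alpha != 0 ->
        forall theta : derivation (A_relators q alpha 0), is_theta theta ->
        forall D : derivation (A_relators q alpha 0),
        exists (x : Aquot q alpha 0) (lambda : K),
        forall (y : Aquot q alpha 0) (mu : K),
          D = ad y + mu *: theta <->
          mu = lambda /\ exists c : K, y = x + c *: (1 : Aquot q alpha 0),

      forall beta : K, beta != 0 ->
        forall theta : derivation (A_relators q 0 beta), is_theta_tilde theta ->
        forall D : derivation (A_relators q 0 beta),
        exists (x : Aquot q 0 beta) (lambda : K),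
        forall (y : Aquot q 0 beta) (mu : K),
          D = ad y + mu *: theta <->
          mu = lambda /\ exists c : K, y = x + c *: (1 : Aquot q 0 beta),

      (forall alpha : K, alpha != 0 ->
        forall theta : derivation (A_relators q alpha 0), is_theta theta ->
        forall h : HH1 (A_relators q alpha 0),
        exists! lambda : K, h = lambda *: HH1_class theta) /\
      (forall beta : K, beta != 0 ->
        forall theta : derivation (A_relators q 0 beta), is_theta_tilde theta ->
        forall h : HH1 (A_relators q 0 beta),
        exists! lambda : K, h = lambda *: HH1_class theta)

    & forall alpha beta : K, alpha != 0 -> beta != 0 ->
        forall h : HH1 (A_relators q alpha beta), h = HH1_class 0].
Proof.
pose nr := q_not_root_of_unity.
have eq_a (a b alpha : K) : alpha != 0 -> (4%:R * a + 2%:R * b) * alpha = 0 -> b = - (2%:R * a).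
  move=> a0 /eqP; rewrite mulf_eq0 (negPf a0) orbF.
  have -> : 4%:R * a + 2%:R * b = 2%:R * (b - - (2%:R * a)) by ring.
  by rewrite mulf_eq0 (negPf two_neq0) orFb subr_eq0 => /eqP.
have eq_b (a b beta : K) : beta != 0 -> (6%:R * a + 4%:R * b) * beta = 0 ->
    3%:R * a + 2%:R * b = 0.
  move=> b0 /eqP; rewrite mulf_eq0 (negPf b0) orbF.
  have -> : 6%:R * a + 4%:R * b = 2%:R * (3%:R * a + 2%:R * b) by ring.
  by rewrite mulf_eq0 (negPf two_neq0) orFb => /eqP.
have inner_ab (alpha beta : K) : alpha != 0 -> beta != 0 ->
    forall D : derivation (A_relators q alpha beta), exists x, D = ad x.
  move=> a0 b0 D; have ab0 : (alpha != 0) || (beta != 0) by rewrite a0.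
  have [x [a [b [/(eq_a _ _ _ a0) ha /(eq_b _ _ _ b0) hb hD]]]] := Aquot_derivation q_neq0 nr ab0 D.
  have a00 : a = 0 by move: hb; rewrite ha => hb; apply/eqP; rewrite -oppr_eq0 -hb; apply/eqP; ring.
  exists x; apply: (derivation_eq (D' := ad x)) => i hi; rewrite hD // ha a00 adE.
  have -> : G2_weight 0 (- (2%:R * 0)) i = 0 :> K.
    by case: i hi => [|[|[|[|[|[|[|]]]]]]] // _; rewrite /G2_weight /=; ring.
  by rewrite scale0r addr0.
have dec_a (alpha : K) : alpha != 0 ->
    forall theta : derivation (A_relators q alpha 0), is_theta theta ->
    forall D : derivation (A_relators q alpha 0), exists x lam, D = ad x + lam *: theta.
  move=> a0 theta [[t1 t2 t3] [t4 t5 t6]] D.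
  have ab0 : (alpha != 0) || ((0 : K) != 0) by rewrite a0.
  have [x [a [b [/(eq_a _ _ _ a0) hb _ hD]]]] := Aquot_derivation q_neq0 nr ab0 D.
  exists x, (- a); apply: derivation_eq => i hi.
  rewrite hD // derivationDE derivationZE adE; congr (_ + _).
  case: i hi => [|[|[|[|[|[|[|]]]]]]] // _; rewrite ?(t1, t2, t3, t4, t5, t6) hb /G2_weight /=.
  - by rewrite scalerN scaleNr opprK.
  - by rewrite scalerN scaleNr opprK; congr (_ *: _); ring.
  - by rewrite scaler0 -[RHS](scale0r (e q alpha 0 3%N)); congr (_ *: _); ring.
  - by congr (_ *: _); ring.
  - by congr (_ *: _); ring.
  - by rewrite -scaler_nat scalerA; congr (_ *: _); ring.
have dec_b (beta : K) : beta != 0 ->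
    forall theta : derivation (A_relators q 0 beta), is_theta_tilde theta ->
    forall D : derivation (A_relators q 0 beta), exists x lam, D = ad x + lam *: theta.
  move=> b0 theta [[t1 t2 t3] [t4 t5 t6]] D.
  have ab0 : ((0 : K) != 0) || (beta != 0) by rewrite b0 orbT.
  have [x [a [b [_ /(eq_b _ _ _ b0) hb hD]]]] := Aquot_derivation q_neq0 nr ab0 D.
  have ea : a = - 2%:R * (a + b) by apply/eqP; rewrite -subr_eq0 -hb; apply/eqP; ring.
  have eb : b = 3%:R * (a + b) by apply/eqP; rewrite -subr_eq0 -oppr_eq0 -hb; apply/eqP; ring.
  exists x, (a + b); apply: derivation_eq => i hi.
  rewrite hD // derivationDE derivationZE adE; congr (_ + _).
  move: (a + b) ea eb => l -> ->.
  case: i hi => [|[|[|[|[|[|[|]]]]]]] // _; rewrite ?(t1, t2, t3, t4, t5, t6) /G2_weight /=.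
  - by rewrite -scaler_nat -scaleNr scalerA; congr (_ *: _); ring.
  - by rewrite -scaler_nat -scaleNr scalerA; congr (_ *: _); ring.
  - by rewrite scalerN -scaleNr; congr (_ *: _); ring.
  - by rewrite scaler0 -[RHS](scale0r (e q 0 beta 4%N)); congr (_ *: _); ring.
  - by congr (_ *: _); ring.
  - by rewrite -scaler_nat scalerA; congr (_ *: _); ring.
split.
- move=> alpha beta a0 b0 D; have [x ->] := inner_ab _ _ a0 b0 D; exists x => y.
  by apply: (ad_eq q_neq0 nr); rewrite a0.
- move=> alpha a0 theta th D; have [x [lam ->]] := dec_a _ a0 _ th D; exists x, lam => y nu.
  by apply: (ad_scale_eq q_neq0 nr); [rewrite a0 | case: th => _ []].
- move=> beta b0 theta th D; have [x [lam ->]] := dec_b _ b0 _ th D; exists x, lam => y nu.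
  by apply: (ad_scale_eq q_neq0 nr); [rewrite b0 orbT | case: th => _ []].
- split=> [alpha a0 theta th|beta b0 theta th]; apply: (HH1_line q_neq0 nr).
  + by rewrite a0.
  + by case: th => _ [].
  + exact: dec_a.
  + by rewrite b0 orbT.
  + by case: th => _ [].
  + exact: dec_b.
- move=> alpha beta a0 b0 h; have [D ->] := mod_class_surj h.
  have [x ->] := inner_ab _ _ a0 b0 D; apply/mod_class_eqP.
  by rewrite subr0; apply/asboolP; exists x.
Qed.
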